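(* Let $D\subset \mathbb{R}^n$ be a bounded domain for which $$\lim_{t\to\infty} e^{\lambda_D t}\,P_z[\tau_D>t]=\psi(z)\int_D\psi(y)\,dy$$ holds for every $z\in D$, where $\tau_D$ is the first exit time from $D$ of $n$-dimensional Brownian motion started at $z$, $\lambda_D$ is the first eigenvalue of $\frac12\Delta$ on $D$ with Dirichlet boundary conditions, and $\psi$ is its corresponding eigenfunction. Let $\tau_D(Z)=\inf\{t\ge 0: Z_t\notin D\}$ be the first exit time from $D$ of the iterated Brownian motion $Z$ started at $z$. Then for every $z\in D$, $$2C(z)\le \liminf_{t\to\infty} t^{-1/2}\exp\Big(\tfrac32\pi^{2/3}\lambda_D^{2/3}t^{1/3}\Big)P_z[\tau_D(Z)>t]\le \limsup_{t\to\infty} t^{-1/2}\exp\Big(\tfrac32\pi^{2/3}\lambda_D^{2/3}t^{1/3}\Big)P_z[\tau_D(Z)>t]\le \pi C(z),$$ where $C(z)=\lambda_D\sqrt{2\pi/3}\,\Big(\psi(z)\int_D\psi(y)\,dy\Big)^2$.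
   Context: Iterated Brownian motion in $\mathbb{R}^n$ started at $z$: let $X^+_t$, $X^-_t$ be independent $n$-dimensional Brownian motions started at $0$, and $Y_t$ an independent one-dimensional Brownian motion started at $0$. Define the two-sided Brownian motion $X_t=X^+_t$ for $t\ge0$ and $X_t=X^-_{-t}$ for $t<0$. The iterated Brownian motion started at $z$ is $Z_t=z+X(Y_t)$, $t\ge 0$. *)

(* Defs.v *)
From HB Require Import structures.
From mathcomp Require Import all_boot all_order all_algebra.
From mathcomp Require Import all_classical all_reals all_analysis.

Set Implicit Arguments.
Unset Strict Implicit.
Unset Printing Implicit Defensive.

Import Order.TTheory GRing.Theory Num.Def Num.Theory.
Import numFieldNormedType.Exports.

Local Open Scope classical_set_scope.
Local Open Scope ring_scope.

Section analysis_Rn.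
Context {R : realType}.

(** n-dimensional Lebesgue integral of a (Borel) function, computed as the
    iterated one-dimensional Lebesgue integral (Fubini--Tonelli); R^0 is a
    point carrying the unit mass. *)
Fixpoint leb_integral (n : nat) : ('rV[R]_n -> \bar R) -> \bar R :=
  match n with
  | 0 => fun f => f 0
  | m.+1 => fun f =>
      (\int[@lebesgue_measure R]_(x in setT)
         leb_integral (fun v : 'rV[R]_m => f (row_mx (\row_(j < 1) x) v)))%E
  end.

Definition int_on n (D : set 'rV[R]_n) (f : 'rV[R]_n -> R) : \bar R :=
  leb_integral (fun y => (\1_D y * f y)%:E).

Definition borelRn n : set (set 'rV[R]_n) := <<s [set U | open U] >>.
Definition borel_fun n (f : 'rV[R]_n -> R) :=
  forall B : set R, measurable B -> borelRn (f @^-1` B).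

Definition basis_vec n (i : 'I_n) : 'rV[R]_n := delta_mx 0 i.
Definition pderiv n (i : 'I_n) (f : 'rV[R]_n -> R) : 'rV[R]_n -> R :=
  fun x => 'D_(basis_vec i) f x.

Definition iter_dderiv n (vs : seq 'rV[R]_n) (f : 'rV[R]_n -> R) :
  'rV[R]_n -> R := foldr (fun v g => fun x => 'D_v g x) f vs.
Definition smooth n (f : 'rV[R]_n -> R) :=
  forall vs : seq 'rV[R]_n,
    continuous (iter_dderiv vs f) /\
    forall v x, derivable (iter_dderiv vs f) x v.

Definition test_fun n (D : set 'rV[R]_n) (f : 'rV[R]_n -> R) :=
  smooth f /\
  exists K : set 'rV[R]_n, [/\ compact K, K `<=` D & forall x, ~ K x -> f x = 0].

(** psi belongs to H^1_0(D) = closure of C_c^infinity(D) in W^{1,2}(D),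
    with weak gradient g *)
Definition H10_grad n (D : set 'rV[R]_n) (psi : 'rV[R]_n -> R)
    (g : 'I_n -> 'rV[R]_n -> R) :=
  [/\ borel_fun (fun y => \1_D y * psi y),
      (forall i, borel_fun (fun y => \1_D y * g i y)),
      (int_on D (fun y => (psi y ^+ 2)%R) < +oo)%E,
      (forall i, int_on D (fun y => (g i y ^+ 2)%R) < +oo)%E &
      exists phi : nat -> 'rV[R]_n -> R,
        [/\ forall k, test_fun D (phi k),
            (fun k => int_on D (fun y => (phi k y - psi y) ^+ 2)) @ \oo --> 0%E &
            (fun k => int_on D (fun y => \sum_(i < n) (pderiv i (phi k) y - g i y) ^+ 2))
              @ \oo --> 0%E]].

(** (lam, psi) is a Dirichlet eigenpair of (1/2) Laplacian on D, i.e.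
    (1/2) Delta psi = - lam psi weakly with psi in H^1_0(D), psi <> 0 *)
Definition dirichlet_eigenpair n (D : set 'rV[R]_n) (lam : R)
    (psi : 'rV[R]_n -> R) :=
  (0 < int_on D (fun y => (psi y ^+ 2)%R))%E /\
  exists g, H10_grad D psi g /\
    forall eta, test_fun D eta ->
      int_on D (fun y => 2^-1 * \sum_(i < n) g i y * pderiv i eta y) =
      int_on D (fun y => lam * psi y * eta y).

Definition first_dirichlet_eigenvalue n (D : set 'rV[R]_n) (lam : R) :=
  (exists psi, dirichlet_eigenpair D lam psi) /\
  forall mu psi, dirichlet_eigenpair D mu psi -> lam <= mu.

Definition first_dirichlet_eigenfunction n (D : set 'rV[R]_n) (lam : R)
    (psi : 'rV[R]_n -> R) :=
  [/\ first_dirichlet_eigenvalue D lam, dirichlet_eigenpair D lam psi,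
      int_on D (fun y => psi y ^+ 2) = 1%E,
      (forall z, D z -> {for z, continuous psi}) &
      (forall z, D z -> 0 < psi z)].

Definition is_domain n (D : set 'rV[R]_n) := [/\ D !=set0, open D & connected D].

End analysis_Rn.

Section brownian.
Context {R : realType} {d : measure_display} {T : measurableType d}.
Variable P : probability T R.

Definition brownian_motion m (B : R -> T -> 'rV[R]_m) :=
  [/\ (forall t (i : 'I_m), 0 <= t -> measurable_fun setT (fun w => B t w 0 i)),
      (forall w, B 0 w = 0),
      (forall w, {within `[0, +oo[, continuous (fun t => B t w)}) &
      (forall (k : nat) (ts : nat -> R) (A : nat -> 'I_m -> set R),
         0 <= ts 0%N -> (forall j, (j < k)%N -> ts j < ts j.+1) ->
         (forall j i, measurable (A j i)) ->
         P (\bigcap_(j in `I_k) \bigcap_(i in [set: 'I_m])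
              [set w | A j i (B (ts j.+1) w 0 i - B (ts j) w 0 i)]) =
         (\prod_(j < k) \prod_(i < m)
              fine (normal_prob 0 (Num.sqrt (ts j.+1 - ts j)) (A j i)))%:E)].

Definition proc_sigma m (X : R -> T -> 'rV[R]_m) : set (set T) :=
  <<s [set E | exists t (i : 'I_m) (A : set R),
          [/\ 0 <= t, measurable A & E = (fun w => X t w 0 i) @^-1` A]] >>.

Definition indep3 m1 m2 m3 (X1 : R -> T -> 'rV[R]_m1)
    (X2 : R -> T -> 'rV[R]_m2) (X3 : R -> T -> 'rV[R]_m3) :=
  forall E1 E2 E3, proc_sigma X1 E1 -> proc_sigma X2 E2 -> proc_sigma X3 E3 ->
    P (E1 `&` E2 `&` E3) = (P E1 * P E2 * P E3)%E.

Definition two_sided n (Xp Xm : R -> T -> 'rV[R]_n) (s : R) (w : T) :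
  'rV[R]_n := if 0 <= s then Xp s w else Xm (- s) w.

Definition iterated_bm n (Xp Xm : R -> T -> 'rV[R]_n) (Y : R -> T -> 'rV[R]_1)
    (z : 'rV[R]_n) (t : R) (w : T) : 'rV[R]_n :=
  z + two_sided Xp Xm (Y t w 0 0) w.

End brownian.

Definition exit_time {R : realType} n (D : set 'rV[R]_n) (W : R -> 'rV[R]_n) :
  \bar R := ereal_inf [set s%:E | s in [set s | 0 <= s /\ ~ D (W s)]].

Definition survival {R : realType} {d : measure_display} {T : measurableType d}
    (P : probability T R) n (D : set 'rV[R]_n) (W : R -> T -> 'rV[R]_n) (t : R) : R :=
  fine (P [set w | (t%:E < exit_time D (fun s => W s w))%E]).

(* Main.v *)
Require Import Defs.
From HB Require Import structures.
From mathcomp Require Import all_boot all_order all_algebra.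
From mathcomp Require Import all_classical all_reals all_analysis.
From mathcomp Require Import measurable_realfun ring lra.

(* Up to time t the path of Y covers exactly [-I, S], with S and I the maxima of Y
   and -Y, so Z survives iff Xp survives up to S and Xm up to I. Conditioning on Y
   (through a fine grid of cells for (S, I)) and using f(u) ~ A exp (- lam u) for the
   probability f(u) that z + Xp stays in D up to u, the survival probability is A^2 E
   exp (- lam (S + I)) up to edge terms where S or I is bounded. That expectation is
   an integral over a of lam^2 exp (- lam a) times the integral over v in [0, a] of
   P(-v <= Y <= a - v on [0, t]). The latter lies between (2 a / pi) exp (- pi^2 t /
   (2 a^2)) (sine subsolution) and a exp (- pi^2 t / (2 a^2)) (operator norm of the
   killed kernel on L^2(0, a), by Schur's test): this ratio 2 / pi is the gap between
   the two constants. Both are obtained for the Gaussian walk Y(j t / N) and N -> oo.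
   Laplace's method then gives the asymptotics, the edge terms being smaller by one
   power of a. *)

Set Implicit Arguments.
Unset Strict Implicit.
Unset Printing Implicit Defensive.

Import Order.TTheory GRing.Theory Num.Def Num.Theory.
Import numFieldNormedType.Exports.

Local Open Scope classical_set_scope.
Local Open Scope ring_scope.

(** * Lebesgue integrals and hyperbolic functions *)

(** One killed step of variance s^2 = t / N moves the sine arch away from a multiple of itself, by
    the mass near the ends and by the expansion of the eigenvalue. Both errors are kept at order
    s^4, so that N steps cost O(1 / N). A pointwise supersolution must be positive at the ends of
    the interval, which costs a factor 1 / sin (m e) that blows up as the margin e tends to 0.
    Schur's test sees only quotients of the supersolution, so this factor is absent from the L^2
    bound and e may tend to 0. The pointwise bound remains good enough for the edge terms, where e
    stays fixed. The number 2 / pi is the mean of sin (pi v / a) over [0, a]. Three further points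
    shape the proof. The sign of lam is not among the hypotheses: lam < 0 is refuted by the positive
    limit, and lam = 0 is treated apart. The integral of psi has to be shown positive and finite
    although it is an iterated integral whose slices are not known to be measurable. Events about
    all times are reduced to dyadic times and closed sets. *)

Lemma measurable_sublevel {R : realType} d (T : measurableType d) (f : T -> R) a :
  measurable_fun setT f -> measurable [set w | f w <= a].
Proof.
move=> mf; have := mf measurableT _ (measurable_itv `]-oo, a]); rewrite setTI.
by congr measurable; apply/seteqP; split => w /=; rewrite in_itv.
Qed.

Definition image_measure d d' (T1 : measurableType d) (T2 : measurableType d')
    (R : realType) (m : {measure set T1 -> \bar R}) (f : T1 -> T2)
    (mf : measurable_fun setT f) : {measure set T2 -> \bar R} :=
  measure_function_pushforward__canonical__measure_function_Measure m mf.

Section lebesgue_affine.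
Context {R : realType}.
Notation mu := (@lebesgue_measure R).
Variables (c s : R).
Hypothesis s0 : s != 0.

Let aff (y : R) : measurableTypeR R := c + s * y.

Let maff : measurable_fun setT (aff : measurableTypeR R -> _).
Proof.
apply: continuous_measurable_fun => x; apply: continuousD; first exact: cst_continuous.
by apply: continuousM; [exact: cst_continuous|exact: cvg_id].
Qed.

Let mpush : {measure set (measurableTypeR R) -> \bar R} :=
  image_measure mu maff.
Let k : {nonneg R} := NngNum (normr_ge0 s).

Let lebesgue_affE (A : set R) : measurable A ->
  mu A = mscale k mpush A.
Proof.
move=> mA; apply: lebesgue_measure_unique => //= _ [[a b]] _ <-.
rewrite /mscale/= /pushforward.
have [s_gt0|s_le0] := ltP 0 s.
  rewrite (_ : aff @^-1` _ = [set` `](a - c) / s, (b - c) / s]]); last first.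
    apply/seteqP; split => y /=; rewrite /aff !in_itv/= ltr_pdivrMr// ler_pdivlMr//.
    by rewrite ltrBlDl lerBrDl ![s * y]mulrC.
    by rewrite ltrBlDl lerBrDl ![s * y]mulrC.
  rewrite !lebesgue_measure_itv/= !lte_fin ltr_pM2r ?invr_gt0// ltrD2r.
  case: ifPn => _; last by rewrite mule0.
  by rewrite -!EFinB -EFinM gtr0_norm//; congr EFin; field; rewrite gt_eqF.
have s_lt0 : s < 0 by rewrite lt_neqAle s0.
rewrite (_ : aff @^-1` _ = [set` `[(b - c) / s, (a - c) / s[]); last first.
  apply/seteqP; split => y /=; rewrite /aff !in_itv/= ltr_ndivlMr// ler_ndivrMr//.
  by rewrite ltrBlDl lerBrDl ![s * y]mulrC andbC.
  by rewrite ltrBlDl lerBrDl ![s * y]mulrC andbC.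
rewrite !lebesgue_measure_itv/= !lte_fin ltr_nM2r ?invr_lt0// ltrD2r.
case: ifPn => _; last by rewrite mule0.
by rewrite -!EFinB -EFinM ltr0_norm//; congr EFin; field; rewrite lt_eqF.
Qed.

(** By uniqueness of Lebesgue measure: its scaled image under the affine map agrees with it on
    half-open intervals; for negative [s] only the closed end changes sides. Used for reflections,
    translations and the rescaling about the saddle point. *)
Lemma ge0_integral_affine (f : R -> \bar R) : measurable_fun setT f ->
  (forall x, 0 <= f x)%E ->
  (\int[mu]_x f x = `|s|%:E * \int[mu]_y f (c + s * y)%R)%E.
Proof.
move=> mf f0.
transitivity (\int[mscale k mpush]_x f x)%E.
  by apply: eq_measure_integral => A mA _; exact: lebesgue_affE.
by rewrite ge0_integral_mscale// ge0_integral_pushforward.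
Qed.
End lebesgue_affine.
Import HBNNSimple.

(** Monotone limit of simple functions. The density is specified by the values of [nu] on measurable
    sets, so the lemma covers both the normal law and a measure restricted to an event. *)
Lemma ge0_integral_density d (T : measurableType d) (R : realType)
    (m nu : {measure set T -> \bar R}) (p : T -> R) (f : T -> \bar R) :
  measurable_fun setT p -> (forall x, 0 <= p x) ->
  (forall A, measurable A -> nu A = \int[m]_(x in A) (p x)%:E)%E ->
  measurable_fun setT f -> (forall x, 0 <= f x)%E ->
  (\int[nu]_x f x = \int[m]_x ((p x)%:E * f x))%E.
Proof.
move=> mp p0 nuE mf f0.
pose h := nnsfun_approx measurableT mf.
have hf x : (h n x)%:E @[n --> \oo] --> f x by apply: cvg_nnsfun_approx.
have hnd x : nondecreasing_seq (fun n => h n x).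
  by move=> a b ab; exact/lefP/nd_nnsfun_approx.
have h0 n x : 0 <= h n x by exact: fun_ge0.
transitivity (limn (fun n => \int[nu]_x (h n x)%:E))%E.
  rewrite -monotone_convergence//.
  - by apply: eq_integral => x _; apply/esym/cvg_lim => //; exact: hf.
  - by move=> n; exact/measurable_EFinP.
  - by move=> n x _; rewrite lee_fin.
  - by move=> x _ a b ab; rewrite lee_fin hnd.
transitivity (limn (fun n => \int[m]_x ((p x)%:E * (h n x)%:E)))%E; last first.
  rewrite -monotone_convergence//.
  - apply: eq_integral => x _; apply/cvg_lim => //; apply: cvgeZl => //; exact: hf.
  - by move=> n; apply: emeasurable_funM; exact/measurable_EFinP.
  - by move=> n x _; rewrite lee_fin mulr_ge0.
  - by move=> x _ a b ab; rewrite lee_fin ler_wpM2l// hnd.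
congr (limn _); apply/funext => n.
have mI r : measurable_fun setT (fun x => (r * \1_(h n @^-1` [set r]) x)%:E).
  by apply/measurable_EFinP/measurable_funM => //; exact: measurable_indic.
transitivity (\sum_(r \in range (h n))
    \int[nu]_x (r * \1_(h n @^-1` [set r]) x)%:E)%E.
  under eq_integral do rewrite fimfunE -fsumEFin//.
  by rewrite ge0_integral_fsum// => r x _; rewrite nnfun_muleindic_ge0.
transitivity (\sum_(r \in range (h n))
    \int[m]_x ((p x)%:E * (r * \1_(h n @^-1` [set r]) x)%:E))%E; last first.
  rewrite -ge0_integral_fsum//.
  - apply: eq_integral => x _; rewrite -ge0_mule_fsumr; last first.
      by move=> r; rewrite nnfun_muleindic_ge0.
    by rewrite fsumEFin// -fimfunE.
  - by move=> r; apply: emeasurable_funM => //; exact/measurable_EFinP.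
  - move=> r x _; apply: mule_ge0; first by rewrite lee_fin.
    by rewrite EFinM nnfun_muleindic_ge0.
apply: eq_fsbigr => r rh.
have r0 : 0 <= r by move: rh; rewrite inE => -[x _ <-].
rewrite integralZl_indic_nnsfun// integral_indic// setIT nuE//.
transitivity (\int[m]_x (r%:E * ((p x)%:E * (\1_(h n @^-1` [set r]) x)%:E)))%E.
  rewrite ge0_integralZl//; last 2 first.
  - apply: emeasurable_funM; first exact/measurable_EFinP.
    by apply/measurable_EFinP; exact: measurable_indic.
  - by move=> x _; rewrite mule_ge0// lee_fin.
  - congr (_ * _)%E; rewrite integral_mkcond; apply: eq_integral => x _.
    rewrite patchE indicE; case: ifPn => _; first by rewrite mule1.
    by rewrite mule0.
by apply: eq_integral => x _; rewrite EFinM muleCA.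
Qed.
Section cosh_cos.
Context {R : realType}.
Implicit Types (f g : R -> R) (u w U : R).

(** Mean value theorem on [0, x], in a form that can be iterated: each conclusion is the hypothesis
    on the derivative at the next stage. *)
Lemma ge0_of_derive_ge0 f g U : (forall x : R, is_derive x (1 : R) f (g x)) -> f 0 = 0 ->
  (forall x, 0 <= x <= U -> 0 <= g x) -> forall x, 0 <= x <= U -> 0 <= f x.
Proof.
move=> fg f0 g0 x /andP[x0 xU].
have cf : {within `[0, x], continuous f}.
  apply: derivable_within_continuous => y _; exact: ex_derive.
have [c /[!in_itv]/= /andP[c0 cx]] := MVT_segment x0 (fun y _ => fg y) cf.
rewrite f0 !subr0 => ->; rewrite mulr_ge0// g0// c0/=; exact: le_trans xU.
Qed.

Definition cosh (u : R) : R := (expR u + expR (- u)) / 2.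
Definition sinh (u : R) : R := (expR u - expR (- u)) / 2.

Global Instance is_derive_cosh u : is_derive u (1 : R) cosh (sinh u).
Proof.
rewrite /cosh /sinh; apply: is_derive_eq.
by rewrite /GRing.scale/=; ring.
Qed.

Global Instance is_derive_sinh u : is_derive u (1 : R) sinh (cosh u).
Proof.
rewrite /cosh /sinh; apply: is_derive_eq.
by rewrite /GRing.scale/=; ring.
Qed.

Lemma cosh_ge1 u : 1 <= cosh u.
Proof.
have e0 := expR_gt0 u.
rewrite /cosh ler_pdivlMr// mul1r expRN -subr_ge0.
rewrite (_ : _ - _ = (expR u - 1) ^+ 2 / expR u).
  by rewrite divr_ge0// ?sqr_ge0// ltW.
by field; rewrite gt_eqF.
Qed.

Lemma cosh_even u : cosh `|u| = cosh u.
Proof. by case: ger0P => // _; rewrite /cosh opprK addrC. Qed.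

Lemma cos_norm u : cos `|u| = cos u.
Proof. by case: ger0P => // _; rewrite cosN. Qed.

Let sinh0 : sinh 0 = 0. Proof. by rewrite /sinh oppr0 subrr mul0r. Qed.
Let cosh0 : cosh 0 = 1. Proof. by rewrite /cosh oppr0 expR0; field. Qed.

(* Both bounds integrate the fourth derivative cosh + cos, which lies between
   0 and 2 e^u, four times from 0. *)
Lemma cosh_cos_ge2 u : 2 <= cosh u + cos u.
Proof.
rewrite -cosh_even -cos_norm; move: `|u| (normr_ge0 u) => {}u u0.
have D4 x : 0 <= x <= u -> 0 <= cosh x + cos x.
  by move=> _; have := cosh_ge1 x; have := cos_geN1 x; lra.
have D3 x : 0 <= x <= u -> 0 <= sinh x + sin x.
  move: x; apply: (ge0_of_derive_ge0 _ _ D4) => //; last by rewrite sinh0 sin0 addr0.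
have D2 x : 0 <= x <= u -> 0 <= cosh x - cos x.
  move: x; apply: (ge0_of_derive_ge0 _ _ D3) => [x|].
    by apply: is_derive_eq; rewrite opprK.
  by rewrite cosh0 cos0 subrr.
have D1 x : 0 <= x <= u -> 0 <= sinh x - sin x.
  by move: x; apply: (ge0_of_derive_ge0 _ _ D2) => //; rewrite sinh0 sin0 subrr.
have D0 : 0 <= cosh u + cos u - 2.
  apply: (ge0_of_derive_ge0 _ _ D1 (f := fun x => cosh x + cos x - 2)) => [x||].
  - by apply: is_derive_eq; rewrite subr0.
  - by rewrite cosh0 cos0; ring.
  - by rewrite u0 lexx.
by rewrite -subr_ge0.
Qed.

Lemma cosh_cos_le u : cosh u + cos u <= 2 + u ^+ 4 * expR `|u|.
Proof.
rewrite -cosh_even -cos_norm -(@ger0_norm _ (u ^+ 4)); last first.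
  by rewrite (_ : 4 = 2 * 2)%N// exprM sqr_ge0.
rewrite normrX; move: `|u| (normr_ge0 u) => {}u u0.
set K := expR u.
have K0 : 0 < K := expR_gt0 u.
have D4 x : 0 <= x <= u -> 0 <= 2 * K - (cosh x + cos x).
  move=> /andP[x0 xu]; have := cos_le1 x; rewrite /cosh.
  have : expR x <= K by rewrite ler_expR.
  have : expR (- x) <= expR x by rewrite ler_expR; lra.
  have : 1 <= expR x by rewrite -expR0 ler_expR.
  lra.
have D3 x : 0 <= x <= u -> 0 <= 2 * K * x - (sinh x + sin x).
  move: x; apply: (ge0_of_derive_ge0 _ _ D4) => [x|].
    by apply: is_derive_eq; rewrite /GRing.scale/= !mulr1.
  by rewrite sinh0 sin0; ring.
have D2 x : 0 <= x <= u -> 0 <= K * x ^+ 2 - (cosh x - cos x).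
  move: x; apply: (ge0_of_derive_ge0 _ _ D3) => [x|].
    by apply: is_derive_eq; rewrite /GRing.scale/=; ring.
  by rewrite cosh0 cos0; ring.
have D1 x : 0 <= x <= u -> 0 <= K / 3 * x ^+ 3 - (sinh x - sin x).
  move: x; apply: (ge0_of_derive_ge0 _ _ D2) => [x|].
    by apply: is_derive_eq; rewrite /GRing.scale/=; field.
  by rewrite sinh0 sin0; ring.
have D0 x : 0 <= x <= u -> 0 <= K / 12 * x ^+ 4 - (cosh x + cos x - 2).
  move: x; apply: (ge0_of_derive_ge0 _ _ D1) => [x|].
    by apply: is_derive_eq; rewrite /GRing.scale/=; field.
  by rewrite cosh0 cos0; ring.
have := D0 u; rewrite u0 lexx => /(_ isT).
have : 0 <= u ^+ 4 * K by rewrite mulr_ge0// ?exprn_ge0// ltW.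
by rewrite (_ : K / 12 * u ^+ 4 = u ^+ 4 * K / 12); [lra|ring].
Qed.

(** Fourth power of |u| / 4 <= exp (|u| / 4). It trades fourth moments for exponential ones, which a
    Gaussian integrates in closed form. *)
Lemma pow4_le_expR u : u ^+ 4 <= 4 ^+ 4 * expR `|u|.
Proof.
rewrite -(@ger0_norm _ (u ^+ 4)); last first.
  by rewrite (_ : 4 = 2 * 2)%N// exprM sqr_ge0.
rewrite normrX; move: `|u| (normr_ge0 u) => {}u u0.
rewrite (_ : expR u = expR (u / 4) ^+ 4); last first.
  by rewrite -expRM_natl; congr expR; field.
rewrite -exprMn -{1}(@divfK _ 4 _ u)// mulrC.
rewrite lerXn2r// ?nnegrE ?mulr_ge0 ?divr_ge0 ?expR_ge0// ler_pM2l//.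
by apply: le_trans (expR_ge1Dx _); rewrite lerDr.
Qed.

(** Separates the small parameter from the Gaussian variable: the error is th^4 times a function of
    [w] alone. As |th| <= 1, exp |th w| is at most exp |w|, and together with the exponential
    bounding w^4 it gives exp (2 |w|) <= 2 cosh (2 w). *)
Lemma cos_scaled_le (th w : R) : `|th| <= 1 ->
  cos (th * w) <= 2 - cosh (th * w) + 2 * 4 ^+ 4 * th ^+ 4 * cosh (2 * w).
Proof.
move=> th1; have := cosh_cos_le (th * w).
suff : (th * w) ^+ 4 * expR `|th * w| <= 2 * 4 ^+ 4 * th ^+ 4 * cosh (2 * w) by lra.
have t4 : 0 <= th ^+ 4 by rewrite (_ : 4 = 2 * 2)%N// exprM sqr_ge0.
set e := expR `|th * w|; set K : R := 4 ^+ 4.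
rewrite (_ : (th * w) ^+ 4 * e = th ^+ 4 * (w ^+ 4 * e)); last by ring.
rewrite (_ : 2 * K * _ * _ = th ^+ 4 * (2 * K * cosh (2 * w))); last by ring.
apply: ler_wpM2l => //.
have w4 : 0 <= w ^+ 4 by rewrite (_ : 4 = 2 * 2)%N// exprM sqr_ge0.
apply: (@le_trans _ _ (K * expR `|w| * expR `|w|)).
  rewrite ler_pM ?expR_ge0// ?pow4_le_expR//.
  by rewrite ler_expR normrM ler_piMl.
rewrite -mulrA -expRD (mulrC 2) -[leRHS]mulrA ler_wpM2l ?exprn_ge0//.
rewrite -cosh_even normrM ger0_norm// (_ : `|w| + `|w| = 2 * `|w|); last by ring.
by rewrite /cosh [leRHS]mulrC divfK// lerDl expR_ge0.
Qed.
End cosh_cos.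

(** * Gaussian integrals of exponentials and sines *)

Section gauss.
Context {R : realType}.
Notation mu := (@lebesgue_measure R).
Implicit Types (x y b c : R).

Lemma normal_pdf_expE (s : R) x y : s != 0 -> normal_pdf x s y =
  normal_peak s * expR (- (y - x) ^+ 2 / (s ^+ 2 *+ 2)).
Proof. by move=> s0; rewrite normal_pdfE. Qed.

Lemma normal_pdfC (s : R) x y : s != 0 -> normal_pdf x s y = normal_pdf y s x.
Proof.
move=> s0; rewrite !normal_pdf_expE//.
by rewrite (_ : (y - x) ^+ 2 = (x - y) ^+ 2)//; ring.
Qed.

Lemma normal_pdf_shift (s : R) x y : s != 0 ->
  normal_pdf x s (x + y) = normal_pdf 0 s y.
Proof. by move=> s0; rewrite !normal_pdf_expE// addrAC subrr add0r subr0. Qed.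

Lemma normal_pdf_reflect (s : R) x y : s != 0 ->
  normal_pdf x s (2 * x - y) = normal_pdf x s y.
Proof.
move=> s0; rewrite !normal_pdf_expE//.
by rewrite (_ : (2 * x - y - x) ^+ 2 = (y - x) ^+ 2)//; ring.
Qed.

(** Completing the square: an exponential tilt shifts the mean by b s^2, so every exponential moment
    follows from the total mass of a normal density. *)
Lemma normal_pdf_expR (s : R) b x y : s != 0 ->
  normal_pdf x s y * expR (b * (y - x)) =
  expR (b ^+ 2 * s ^+ 2 / 2) * normal_pdf (x + b * s ^+ 2) s y.
Proof.
move=> s0; rewrite !normal_pdf_expE// [RHS]mulrCA -[LHS]mulrA -!expRD.
congr (normal_peak s * _); congr expR; rewrite -mulr_natr; field.
by rewrite s0.
Qed.

Lemma measurable_normal_pdf2 (s : R) : s != 0 ->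
  measurable_fun setT (fun p : R * R => normal_pdf p.1 s p.2).
Proof.
move=> s0; under eq_fun do rewrite normal_pdf_expE//.
apply: measurable_funM => //; apply: measurableT_comp => //.
apply: measurable_funM => //; apply: measurableT_comp => //.
apply: measurable_funX => //; apply: measurable_funB => //.
Qed.

Lemma measurable_cosh : measurable_fun setT (@cosh R).
Proof.
by apply: measurable_funM => //; apply: measurable_funD => //; exact: measurableT_comp.
Qed.

Section moments.
Variables (s : R) (s_gt0 : 0 < s) (x : R).
Let s0 : s != 0. Proof. by rewrite gt_eqF. Qed.
Let p y := normal_pdf x s y.

Lemma integral_normal_expR b :
  (\int[mu]_y (p y * expR (b * (y - x)))%:E = (expR (b ^+ 2 * s ^+ 2 / 2))%:E)%E.
Proof.
under eq_integral do rewrite /p normal_pdf_expR// EFinM.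
rewrite ge0_integralZl//; first by rewrite integral_normal_pdf mule1.
- by apply/measurable_EFinP; exact: measurable_normal_pdf.
- by move=> y _; rewrite lee_fin normal_pdf_ge0.
Qed.

Lemma integrable_normal_expR b :
  mu.-integrable setT (EFin \o (fun y => p y * expR (b * (y - x)))).
Proof.
apply/integrableP; split.
  apply/measurable_EFinP/measurable_funM; first exact: measurable_normal_pdf.
  apply: measurableT_comp => //; apply: measurable_funM => //.
  exact: measurable_funB.
under eq_integral do rewrite /= ger0_norm ?mulr_ge0 ?normal_pdf_ge0 ?expR_ge0//.
by rewrite integral_normal_expR ltry.
Qed.

Lemma integrable_normal_bounded (f : R -> R) (M : R) : measurable_fun setT f ->
  (forall y, `|f y| <= M) -> mu.-integrable setT (EFin \o (fun y => p y * f y)).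
Proof.
move=> mf fM.
apply: (le_integrable _ _ _ (integrableZl measurableT M (integrable_normal_pdf x s))) => //.
  by apply/measurable_EFinP/measurable_funM => //; exact: measurable_normal_pdf.
move=> y _ /=; rewrite lee_fin !normrM mulrC.
have -> : `|M| = M by rewrite ger0_norm// (le_trans _ (fM y)).
by rewrite ler_wpM2r.
Qed.

Lemma integral_normal_cosh b :
  (\int[mu]_y (p y * cosh (b * (y - x)))%:E = (expR (b ^+ 2 * s ^+ 2 / 2))%:E)%E.
Proof.
have E y : (p y * cosh (b * (y - x)))%:E = (2^-1%:E * ((p y * expR (b * (y - x)))%:E +
   (p y * expR (- b * (y - x)))%:E))%E.
  by rewrite -EFinD -EFinM /cosh mulNr; congr EFin; ring.
under eq_integral do rewrite E.
rewrite integralZl//; last by apply: integrableD => //; exact: integrable_normal_expR.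
rewrite integralD//; do ?exact: integrable_normal_expR.
rewrite !integral_normal_expR sqrrN -EFinD -EFinM; congr EFin.
by field.
Qed.

Lemma integrable_normal_cosh b :
  mu.-integrable setT (EFin \o (fun y => p y * cosh (b * (y - x)))).
Proof.
apply/integrableP; split.
  apply/measurable_EFinP/measurable_funM; first exact: measurable_normal_pdf.
  apply: measurableT_comp; first exact: measurable_cosh.
  by apply: measurable_funM => //; exact: measurable_funB.
have c0 y : 0 <= p y * cosh (b * (y - x)).
  by rewrite mulr_ge0 ?normal_pdf_ge0// (le_trans _ (cosh_ge1 _)).
under eq_integral do rewrite /= ger0_norm//.
by rewrite integral_normal_cosh ltry.
Qed.

Let E (f : R -> R) : R := \int[mu]_y (p y * f y).

Let E1 : E (cst 1) = 1.
Proof.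
rewrite /E /Rintegral; under eq_integral do rewrite mulr1.
by rewrite integral_normal_pdf.
Qed.

Let EE (f : R -> R) : mu.-integrable setT (EFin \o (fun y => p y * f y)) ->
  (\int[mu]_y (p y * f y)%:E = (E f)%:E)%E.
Proof.
move=> fi; rewrite /E /Rintegral fineK//.
exact: (integrable_fin_num measurableT fi).
Qed.

Let integrable_cos m : mu.-integrable setT (EFin \o (fun y => p y * cos (m * (y - x)))).
Proof.
apply: (@integrable_normal_bounded (fun y => cos (m * (y - x))) 1) => [|y]; last exact: cos_max.
apply: measurableT_comp; first exact: continuous_measurable_fun (@continuous_cos R).
by apply: measurable_funM => //; exact: measurable_funB.
Qed.

Let integrable_sin m : mu.-integrable setT (EFin \o (fun y => p y * sin (m * (y - x)))).
Proof.
apply: (@integrable_normal_bounded (fun y => sin (m * (y - x))) 1) => [|y]; last exact: sin_max.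
apply: measurableT_comp; first exact: continuous_measurable_fun (@continuous_sin R).
by apply: measurable_funM => //; exact: measurable_funB.
Qed.

(** Oddness about [x], through the reflection y -> 2 x - y. The change of variables is applied to 1
    + sin because it is available for nonnegative functions. *)
Let E_sin m : E (fun y => sin (m * (y - x))) = 0.
Proof.
have h : (\int[mu]_y (p y * (1 + sin (m * (y - x))))%:E =
          \int[mu]_y (p y * (1 + sin (- m * (y - x))))%:E)%E.
  rewrite (@ge0_integral_affine _ (2 * x) (- 1))//.
  - rewrite normrN normr1 mul1e; apply: eq_integral => y _.
    rewrite mulN1r /p normal_pdf_reflect//; congr (_ * (1 + sin _))%:E.
    ring.
  - apply/measurable_EFinP/measurable_funM; first exact: measurable_normal_pdf.
    apply: measurable_funD => //.
    apply: measurableT_comp; first exact: continuous_measurable_fun (@continuous_sin R).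
    by apply: measurable_funM => //; exact: measurable_funB.
  - by move=> y; rewrite lee_fin mulr_ge0 ?normal_pdf_ge0//; have := sin_geN1 (m * (y - x)); lra.
have F b : (\int[mu]_y (p y * (1 + sin (b * (y - x))))%:E =
    1 + \int[mu]_y (p y * sin (b * (y - x)))%:E)%E.
  rewrite -(integral_normal_pdf x s) -integralD//.
  - by apply: eq_integral => y _; rewrite mulrDr mulr1.
  - exact: integrable_normal_pdf.
  - exact: integrable_sin.
move: h; rewrite !F !EE; [|exact: integrable_sin..].
rewrite -!EFinD => -[] /addrI.
have -> : E (fun y => sin (- m * (y - x))) = - E (fun y => sin (m * (y - x))).
  rewrite /E -[RHS]mulN1r -(RintegralZl (- 1) measurableT (integrable_sin m)).
  by apply: eq_Rintegral => y _; rewrite mulNr sinN; ring.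
move=> h; apply: (@mulfI _ 2) => //; rewrite mulr0 mulr_natl mulr2n {1}h; exact: addNr.
Qed.

(** With w = th^2 / 2 this places 2 - exp w between exp (- w) - th^4 and exp (- w). The upper bound
    uses exp w <= 1 / (1 - w) and exp (- w) <= 1 / (1 + w). *)
Lemma expR_half_sum (w : R) : 0 <= w <= 1 / 2 -> 2 <= expR w + expR (- w) <= 2 + 4 * w ^+ 2.
Proof.
move=> /andP[w0 w1]; apply/andP; split.
  by have := cosh_ge1 w; rewrite /cosh; lra.
have e1 : expR (- w) <= 1 / (1 + w).
  rewrite expRN div1r lef_pV2 ?posrE ?expR_gt0 ?expR_ge1Dx//; lra.
have e2 : expR w <= 1 / (1 - w).
  rewrite -[w in leLHS]opprK expRN div1r lef_pV2 ?posrE ?expR_gt0 ?expR_ge1Dx//; lra.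
apply: le_trans (lerD e2 e1) _.
rewrite (_ : _ + _ = 2 / (1 - w ^+ 2)); last by field; nra.
have q0 : 0 <= w ^+ 2 by rewrite sqr_ge0.
have q1 : w ^+ 2 <= 1 / 4 by nra.
move: (w ^+ 2) q0 q1 => q q0 q1; rewrite ler_pdivrMr; last by lra.
nra.
Qed.

(* The expectation of cos agrees with 2 - E cosh = 2 - exp (th ^ 2 / 2) up to
   O(th ^ 4), and 2 - e^w = e^(-w) + O(w^2). *)
Lemma normal_sin_moment m c : `|m * s| <= 1 ->
  exists k, `|k - expR (- (m * s) ^+ 2 / 2)| <= (1 + 2 * 4 ^+ 4 * expR 2) * (m * s) ^+ 4 /\
  (\int[mu]_y (p y * (1 + sin (m * y + c)))%:E = (1 + k * sin (m * x + c))%:E)%E.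
Proof.
(* By the addition formula about [x] the sine part has mean zero, so the Gaussian mean of sin (m y +
   c) is sin (m x + c) times this [k]. *)
move=> th1; pose k := E (fun y => cos (m * (y - x))).
exists k; split; last first.
  have -> : (\int[mu]_y (p y * (1 + sin (m * y + c)))%:E =
     \int[mu]_y ((p y)%:E + ((sin (m * x + c))%:E * (p y * cos (m * (y - x)))%:E +
       (cos (m * x + c))%:E * (p y * sin (m * (y - x)))%:E)))%E.
    apply: eq_integral => y _; rewrite -!EFinM -!EFinD; congr EFin.
    rewrite (_ : m * y + c = (m * x + c) + m * (y - x)); last by ring.
    by rewrite sinD; ring.
  have i1 := integrableZl measurableT (sin (m * x + c)) (integrable_cos m).
  have i2 := integrableZl measurableT (cos (m * x + c)) (integrable_sin m).
  rewrite integralD//; [|exact: integrable_normal_pdf|exact: integrableD].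
  rewrite integralD// integral_normal_pdf.
  rewrite (integralZl measurableT (integrable_cos m)) (integralZl measurableT (integrable_sin m)).
  rewrite (EE (integrable_cos m)) (EE (integrable_sin m)) E_sin.
  by rewrite -!EFinM -!EFinD mulr0 addr0 mulrC.
set th := m * s.
have Ecosh b : E (fun y => cosh (b * (y - x))) = expR (b ^+ 2 * s ^+ 2 / 2).
  by rewrite /E /Rintegral integral_normal_cosh.
have iC b := integrable_normal_cosh b.
have i1 := integrable_normal_pdf x s.
have Esub b : \int[mu]_y (p y * (2 - cosh (b * (y - x)))) = 2 - expR (b ^+ 2 * s ^+ 2 / 2).
  have i3 : mu.-integrable setT (EFin \o (fun y => p y * cst 1 y)).
    by apply: eq_integrable i1 => // y _ /=; rewrite mulr1.
  have -> : 2 - expR (b ^+ 2 * s ^+ 2 / 2) = 2 * E (cst 1) - E (fun y => cosh (b * (y - x))).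
    by rewrite E1 Ecosh mulr1.
  rewrite -(RintegralZl 2 measurableT i3) -RintegralB//; last exact: (integrableZl measurableT 2 i3).
  by apply: eq_Rintegral => y _ /=; ring.
have i2 b : mu.-integrable setT (EFin \o (fun y => p y * (2 - cosh (b * (y - x))))).
  apply: eq_integrable (integrableB measurableT (integrableZl measurableT 2 i1) (iC b)) => //.
  by move=> y _ /=; rewrite -EFinM -EFinB /p [in RHS]mulrBr (mulrC 2).
have klo : 2 - expR (th ^+ 2 / 2) <= k.
  rewrite /th exprMn -Esub; apply: le_Rintegral => // y _.
  rewrite ler_wpM2l ?normal_pdf_ge0// lerBlDr.
  by have := cosh_cos_ge2 (m * (y - x)); lra.
have khi : k <= 2 - expR (th ^+ 2 / 2) + 2 * 4 ^+ 4 * th ^+ 4 * expR 2.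
  (* Frequency 2 / s makes the exponential moment exp ((2 / s)^2 s^2 / 2) = exp 2, which is the
     constant in the error bound. *)
  have -> : expR 2 = E (fun y => cosh (2 / s * (y - x))).
    by rewrite Ecosh; congr expR; field.
  rewrite {1}/th exprMn -Esub -(RintegralZl _ measurableT (iC _)) -RintegralD//; last first.
    exact: (integrableZl measurableT _ (iC _)).
  apply: le_Rintegral => //.
    exact: (integrableD measurableT (i2 m) (integrableZl measurableT (2 * 4 ^+ 4 * th ^+ 4) (iC (2 / s)))).
  move=> y _; have := @cos_scaled_le _ th ((y - x) / s) th1.
  rewrite (_ : th * ((y - x) / s) = m * (y - x)); last by rewrite /th; field.
  rewrite (_ : 2 * ((y - x) / s) = 2 / s * (y - x)); last by field.
  move=> /(ler_wpM2l (normal_pdf_ge0 x s y)); rewrite -/(p y) => h.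
  apply: le_trans h _; rewrite le_eqVlt; apply/orP; left; apply/eqP; ring.
have t2 : 0 <= th ^+ 2 <= 1.
  by rewrite sqr_ge0/= -(ger0_norm (sqr_ge0 _)) normrX exprn_ile1.
have := @expR_half_sum (th ^+ 2 / 2).
rewrite (_ : - th ^+ 2 / 2 = - (th ^+ 2 / 2)); last by ring.
rewrite (_ : 4 * (th ^+ 2 / 2) ^+ 2 = th ^+ 4); last by field.
have /[swap]/[apply] : 0 <= th ^+ 2 / 2 <= 1 / 2 by move/andP: t2 => [? ?]; lra.
move=> /andP[h1 h2].
have e2 : 0 <= 2 * 4 ^+ 4 * th ^+ 4 * expR 2.
  have t4 : 0 <= th ^+ 4 by rewrite exprn_even_ge0.
  apply: mulr_ge0; last exact: expR_ge0.
  by apply: mulr_ge0 => //; rewrite mulr_ge0 ?exprn_ge0.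
rewrite mulrDl mul1r ler_norml.
rewrite (_ : 2 * 4 ^+ 4 * expR 2 * th ^+ 4 = 2 * 4 ^+ 4 * th ^+ 4 * expR 2); last by ring.
by apply/andP; split; lra.
Qed.
End moments.
End gauss.

(** * The killed Gaussian walk *)

Section killed_walk.
Context {R : realType}.
Notation mu := (@lebesgue_measure R).
Variables (s a : R).
Hypotheses (s_gt0 : 0 < s) (a_gt0 : 0 < a).
Let s0 : s != 0. Proof. by rewrite gt_eqF. Qed.

(** Only the end point of a step is restricted to [0, a]; iteration from a point of [0, a] then
    restricts every position of the walk. *)
Definition killed_density (x y : R) : R := normal_pdf x s y * \1_`[0, a] y.

Definition killed (h : R -> \bar R) (x : R) : \bar R :=
  (\int[mu]_y ((killed_density x y)%:E * h y))%E.

Let kd_ge0 x y : 0 <= killed_density x y.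
Proof. by rewrite mulr_ge0 ?normal_pdf_ge0. Qed.

Let ind_in (y : R) : 0 <= y <= a -> \1_`[0, a] y = 1 :> R.
Proof. by move=> ya; rewrite indicE mem_set//= in_itv. Qed.

Let ind_out (y : R) : ~~ (0 <= y <= a) -> \1_`[0, a] y = 0 :> R.
Proof. by move=> ya; rewrite indicE memNset//= in_itv/=; exact/negP. Qed.

Let measurable_kd x : measurable_fun setT (killed_density x).
Proof. by apply: measurable_funM; [exact: measurable_normal_pdf|exact: measurable_indic]. Qed.

Lemma measurable_killed_density :
  measurable_fun setT (fun z : R * R => killed_density z.1 z.2).
Proof.
apply: measurable_funM; first exact: measurable_normal_pdf2.
by apply: (@measurableT_comp _ _ _ _ _ _ (\1_`[0, a] : R -> R)) => //; exact: measurable_indic.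
Qed.

Lemma killed_ge0 h x : (forall y, 0 <= h y)%E -> (0 <= killed h x)%E.
Proof. by move=> h0; apply: integral_ge0 => y _; rewrite mule_ge0// lee_fin. Qed.

Lemma measurable_killed h : measurable_fun setT h -> (forall y, 0 <= h y)%E ->
  measurable_fun setT (killed h).
Proof.
move=> mh h0.
pose f (z : R * R) := ((killed_density z.1 z.2)%:E * h z.2)%E.
apply: (@measurable_fun_fubini_tonelli_F _ _ _ _ _ mu f) => [|z].
  apply: emeasurable_funM; last exact: measurableT_comp.
  apply/measurable_EFinP; exact: measurable_killed_density.
by rewrite mule_ge0// lee_fin.
Qed.

Let mkh h x : measurable_fun setT h ->
  measurable_fun setT (fun y => (killed_density x y)%:E * h y)%E.
Proof. by move=> mh; apply: emeasurable_funM => //; exact/measurable_EFinP. Qed.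

Lemma le_killed h1 h2 x : measurable_fun setT h1 -> measurable_fun setT h2 ->
  (forall y, 0 <= h1 y)%E -> (forall y, 0 <= h2 y)%E ->
  (forall y, 0 <= y <= a -> (h1 y <= h2 y)%E) -> (killed h1 x <= killed h2 x)%E.
Proof.
move=> m1 m2 p1 p2 h12; apply: ge0_le_integral => //.
- by move=> y _; rewrite mule_ge0// lee_fin.
- exact: mkh.
- exact: mkh.
- move=> y _; have [ya|ya] := boolP (0 <= y <= a).
    by rewrite lee_wpmul2l ?lee_fin// h12.
  by rewrite /killed_density ind_out// mulr0 !mul0e.
Qed.

Lemma killedZ h c x : measurable_fun setT h -> (forall y, 0 <= h y)%E ->
  0 <= c -> killed (fun y => c%:E * h y)%E x = (c%:E * killed h x)%E.
Proof.
move=> mh h0 c0; rewrite /killed -ge0_integralZl//.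
- by apply: eq_integral => y _; rewrite muleCA.
- exact: mkh.
- by move=> y _; rewrite mule_ge0// lee_fin.
Qed.

Lemma killedD h1 h2 x : measurable_fun setT h1 -> measurable_fun setT h2 ->
  (forall y, 0 <= h1 y)%E -> (forall y, 0 <= h2 y)%E ->
  killed (fun y => h1 y + h2 y)%E x = (killed h1 x + killed h2 x)%E.
Proof.
move=> m1 m2 p1 p2; rewrite /killed -ge0_integralD//.
- by apply: eq_integral => y _; rewrite ge0_muleDr.
- by move=> y _; rewrite mule_ge0// lee_fin.
- exact: mkh.
- by move=> y _; rewrite mule_ge0// lee_fin.
- exact: mkh.
Qed.

Lemma killed_cst_le c x : 0 <= c -> (killed (cst c%:E) x <= c%:E)%E.
Proof.
move=> c0; rewrite -[leRHS]mule1 -(integral_normal_pdf x s) -ge0_integralZl//.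
- apply: ge0_le_integral => //.
  + by move=> y _; rewrite mule_ge0// lee_fin.
  + exact: mkh.
  + by apply: emeasurable_funM => //; apply/measurable_EFinP; exact: measurable_normal_pdf.
  + move=> y _; rewrite muleC lee_wpmul2l ?lee_fin// /killed_density.
    rewrite -[leRHS]mulr1 ler_wpM2l ?normal_pdf_ge0// indicE; exact: lern1.
- by apply/measurable_EFinP; exact: measurable_normal_pdf.
- by move=> y _; rewrite lee_fin normal_pdf_ge0.
Qed.

Definition killed_iter N h := iter N killed h.

Lemma killed_iter_ge0 N h : (forall y, 0 <= h y)%E -> forall x, (0 <= killed_iter N h x)%E.
Proof. by move=> h0; elim: N => //= N IH x; exact: killed_ge0. Qed.

Lemma measurable_killed_iter N h : measurable_fun setT h -> (forall y, 0 <= h y)%E ->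
  measurable_fun setT (killed_iter N h).
Proof.
by move=> mh h0; elim: N => //= N IH; apply: measurable_killed => //; exact: killed_iter_ge0.
Qed.

Lemma killed_iter_le1 N x : (killed_iter N (cst 1%E) x <= 1)%E.
Proof.
elim: N x => //= N IH x; apply: le_trans (killed_cst_le x ler01).
apply: le_killed => //; last exact: killed_iter_ge0.
exact: measurable_killed_iter.
Qed.

Section supersolution.
Variables (phi : R -> R) (r m : R).
Hypotheses (mphi : measurable_fun setT phi) (phi0 : forall y, 0 <= phi y)
  (m_gt0 : 0 < m) (phim : forall y : R, 0 <= y <= a -> m <= phi y) (r0 : 0 <= r)
  (phir : forall x : R, 0 <= x <= a -> (killed (EFin \o phi) x <= (r * phi x)%:E)%E).

(** Starts from 1 <= phi / m on [0, a] and iterates. The factor 1 / m degenerates when [phi] is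
    small at the ends, so this bound serves the edge terms, not the sharp constant. *)
Lemma killed_iter_supersolution N x : 0 <= x <= a ->
  (killed_iter N (cst 1%E) x <= (r ^+ N * phi x / m)%:E)%E.
Proof.
elim: N x => [|N IH] x xa /=.
  by rewrite expr0 mul1r lee_fin ler_pdivlMr// mul1r phim.
have mE : measurable_fun setT (EFin \o phi) by exact/measurable_EFinP.
have E0 : forall y, (0 <= (EFin \o phi) y)%E by move=> y; rewrite lee_fin.
apply: (@le_trans _ _ (killed (fun y => (r ^+ N / m)%:E * (EFin \o phi) y)%E x)).
  apply: le_killed => //.
  - exact: measurable_killed_iter.
  - by apply: emeasurable_funM.
  - exact: killed_iter_ge0.
  - by move=> y; rewrite mule_ge0// lee_fin divr_ge0 ?exprn_ge0// ltW.
  - by move=> y ya; apply: le_trans (IH y ya) _; rewrite -EFinM lee_fin mulrAC.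
rewrite killedZ//; last by rewrite divr_ge0 ?exprn_ge0// ltW.
apply: (@le_trans _ _ ((r ^+ N / m)%:E * (r * phi x)%:E)%E).
  by rewrite lee_wpmul2l// ?phir// lee_fin divr_ge0 ?exprn_ge0// ltW.
by rewrite -EFinM lee_fin exprS le_eqVlt; apply/orP; left; apply/eqP; ring.
Qed.

(** The indicator of the starting point makes the kernel symmetric, so that the form [D] can
    exchange its two arguments. *)
Let Z (f g : R -> R) (z : R * R) : R :=
  \1_`[0, a] z.1 * killed_density z.1 z.2 * f z.1 * g z.2.

Let mZ (f g : R -> R) : measurable_fun setT f -> measurable_fun setT g ->
  measurable_fun setT (Z f g).
Proof.
move=> mf mg; rewrite /Z.
apply: measurable_funM; last exact: measurableT_comp.
apply: measurable_funM; last exact: measurableT_comp.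
apply: measurable_funM; last exact: measurable_killed_density.
by apply: (@measurableT_comp _ _ _ _ _ _ (\1_`[0, a] : R -> R)) => //; exact: measurable_indic.
Qed.

Let Z_ge0 (f g : R -> R) : (forall x, 0 <= f x) -> (forall x, 0 <= g x) -> forall z, 0 <= Z f g z.
Proof. by move=> f0 g0 z; do 3 apply: mulr_ge0 => //. Qed.

Let D f g : \bar R := (\int[mu \x mu]_z (Z f g z)%:E)%E.

Let DE (f g : R -> R) : measurable_fun setT f -> measurable_fun setT g ->
  (forall x, 0 <= f x) -> (forall x, 0 <= g x) ->
  D f g = (\int[mu]_x ((\1_`[0, a] x * f x)%:E * killed (EFin \o g) x))%E.
Proof.
move=> mf mg f0 g0; rewrite /D fubini_tonelli1//=; last 2 first.
  by apply/measurable_EFinP; exact: mZ.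
  by move=> z; rewrite lee_fin Z_ge0.
apply: eq_integral => x _; rewrite /killed -ge0_integralZl//.
- by apply: eq_integral => y _; rewrite /Z -!EFinM; congr EFin => /=; ring.
- by apply: mkh; exact/measurable_EFinP.
- by move=> y _; rewrite mule_ge0// lee_fin.
- by rewrite lee_fin mulr_ge0.
Qed.

Let DC (f g : R -> R) : measurable_fun setT f -> measurable_fun setT g ->
  (forall x, 0 <= f x) -> (forall x, 0 <= g x) -> D f g = D g f.
Proof.
move=> mf mg f0 g0; rewrite /D fubini_tonelli1//=; last 2 first.
  by apply/measurable_EFinP; exact: mZ.
  by move=> z; rewrite lee_fin Z_ge0.
rewrite fubini_tonelli2//=; last 2 first.
  by apply/measurable_EFinP; exact: mZ.
  by move=> z; rewrite lee_fin Z_ge0.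
apply: eq_integral => x _; apply: eq_integral => y _.
rewrite /Z /killed_density/= (normal_pdfC y x)//; congr EFin; ring.
Qed.

Let D_phi (f : R -> R) : measurable_fun setT f -> (forall x, 0 <= f x) ->
  (D f phi <= r%:E * \int[mu]_x (\1_`[0, a] x * f x * phi x)%:E)%E.
Proof.
move=> mf f0.
have mI : measurable_fun setT (\1_`[0, a] : R -> R) by exact: measurable_indic.
rewrite DE// -ge0_integralZl//; last 2 first.
  by apply/measurable_EFinP; do 2 apply: measurable_funM => //.
  by move=> x _; rewrite lee_fin !mulr_ge0.
apply: ge0_le_integral => //.
- by move=> x _; rewrite mule_ge0 ?killed_ge0 ?lee_fin ?mulr_ge0// => y; rewrite lee_fin.
- apply: emeasurable_funM; first by apply/measurable_EFinP/measurable_funM.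
  by apply: measurable_killed => [|y]; [exact/measurable_EFinP|rewrite lee_fin].
- apply: emeasurable_funM => //; apply/measurable_EFinP.
  by do 2 apply: measurable_funM => //.
- move=> x _; have [xa|xa] := boolP (0 <= x <= a); last first.
    by rewrite ind_out// !mul0r mul0e mule0.
  rewrite ind_in// !mul1r.
  apply: (@le_trans _ _ ((f x)%:E * (r * phi x)%:E)%E).
    by rewrite lee_wpmul2l ?lee_fin// phir.
  by rewrite -!EFinM mulrCA.
Qed.

(* Schur test: [phi] certifies the operator norm bound [r] on L^2(0, a), by
   AM-GM in the form [u v <= (c u^2 phi' / phi + v^2 phi / (c phi')) / 2]. *)
Lemma killed_schur (u v : R -> R) c : 0 < c ->
  measurable_fun setT u -> measurable_fun setT v ->
  (forall x, 0 <= u x) -> (forall x, 0 <= v x) ->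
  (\int[mu]_x ((\1_`[0, a] x * u x)%:E * killed (EFin \o v) x) <=
   (r / 2 * c)%:E * \int[mu]_x (\1_`[0, a] x * u x ^+ 2)%:E +
   (r / 2 / c)%:E * \int[mu]_x (\1_`[0, a] x * v x ^+ 2)%:E)%E.
Proof.
move=> c0 mu' mv u0 v0; rewrite -DE//.
(* Dividing u^2 and v^2 by [phi] turns both terms of AM-GM into forms against [phi], where the
   supersolution inequality applies. Zeros of [phi] can only lie outside [0, a], where the
   indicators vanish. *)
pose q x := (phi x)^-1.
have mq : measurable_fun setT q.
  rewrite (_ : q = fun x => phi x `^ (- 1)).
    by apply: (@measurableT_comp _ _ _ _ _ _ (fun y : R => y `^ (- 1))) => //; exact: measurable_powR.
  by apply/funext => x; rewrite powR_inv1.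
have q0 x : 0 <= q x by rewrite invr_ge0.
pose u2 x := u x ^+ 2 * q x; pose v2 x := v x ^+ 2 * q x.
have mu2 : measurable_fun setT u2 by apply: measurable_funM => //; exact: measurable_funX.
have mv2 : measurable_fun setT v2 by apply: measurable_funM => //; exact: measurable_funX.
have u20 x : 0 <= u2 x by rewrite mulr_ge0 ?sqr_ge0.
have v20 x : 0 <= v2 x by rewrite mulr_ge0 ?sqr_ge0.
have c1 : 0 <= 2^-1 * c by rewrite mulr_ge0// ltW.
have c2 : 0 <= 2^-1 / c by rewrite divr_ge0// ltW.
apply: (@le_trans _ _ ((2^-1 * c)%:E * D u2 phi + (2^-1 / c)%:E * D v2 phi)%E).
  rewrite (DC mv2)// /D -!ge0_integralZl//; last first.
  - by move=> z _; rewrite lee_fin Z_ge0.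
  - by apply/measurable_EFinP; exact: mZ.
  - by move=> z _; rewrite lee_fin Z_ge0.
  - by apply/measurable_EFinP; exact: mZ.
  rewrite -ge0_integralD//; last first.
  - by apply: emeasurable_funM => //; by apply/measurable_EFinP; exact: mZ.
  - by move=> z _; rewrite mule_ge0 ?lee_fin ?Z_ge0.
  - by apply: emeasurable_funM => //; by apply/measurable_EFinP; exact: mZ.
  - by move=> z _; rewrite mule_ge0 ?lee_fin ?Z_ge0.
  apply: ge0_le_integral => //.
  - by move=> z _; rewrite lee_fin Z_ge0.
  - by apply/measurable_EFinP; exact: mZ.
  - by apply: emeasurable_funD; apply: emeasurable_funM => //; by apply/measurable_EFinP; exact: mZ.
  - move=> [x y] _; rewrite -!EFinM -EFinD lee_fin /Z/=.
    have [xa|xa] := boolP (0 <= x <= a); last first.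
      by rewrite ind_out// !mul0r !mulr0 addr0.
    have [ya|ya] := boolP (0 <= y <= a); last first.
      by rewrite /killed_density ind_out// !(mulr0, mul0r) addr0.
    rewrite ind_in// mul1r.
    have px : 0 < phi x by apply: lt_le_trans (phim xa).
    have py : 0 < phi y by apply: lt_le_trans (phim ya).
    rewrite (_ : 2^-1 * c * _ + _ = killed_density x y *
       (2^-1 * c * (u2 x * phi y) + 2^-1 / c * (phi x * v2 y))); last by ring.
    rewrite -mulrA ler_wpM2l// -subr_ge0.
    rewrite (_ : _ - _ = 2^-1 / (c * phi x * phi y) * (c * u x * phi y - v y * phi x) ^+ 2).
      by rewrite mulr_ge0 ?sqr_ge0// divr_ge0// !mulr_ge0// ltW.
    rewrite /u2 /v2 /q; field; by rewrite !gt_eqF.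
have key (w : R -> R) (w0 : forall x, 0 <= w x) : measurable_fun setT w ->
  (D (fun x => (w x ^+ 2 * q x)%R) phi <= r%:E * \int[mu]_x (\1_`[0, a] x * w x ^+ 2)%:E)%E.
  move=> mw; apply: le_trans (D_phi _ _) _.
  - by apply: measurable_funM => //; exact: measurable_funX.
  - by move=> x; rewrite mulr_ge0 ?sqr_ge0.
  - rewrite le_eqVlt; apply/orP; left; apply/eqP; congr (_ * _)%E.
    apply: eq_integral => x _; congr EFin.
    have [xa|xa] := boolP (0 <= x <= a); last by rewrite ind_out// !mul0r.
    rewrite -!mulrA /q mulVf ?mulr1// gt_eqF//; exact: lt_le_trans (phim xa).
apply: leeD.
- apply: (@le_trans _ _ ((2^-1 * c)%:E * (r%:E * \int[mu]_x (\1_`[0, a] x * u x ^+ 2)%:E))%E).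
    by rewrite lee_wpmul2l ?lee_fin ?key.
  by rewrite muleA -EFinM (_ : 2^-1 * c * r = r / 2 * c)//; ring.
- apply: (@le_trans _ _ ((2^-1 / c)%:E * (r%:E * \int[mu]_x (\1_`[0, a] x * v x ^+ 2)%:E))%E).
    by rewrite lee_wpmul2l ?lee_fin ?key.
  by rewrite muleA -EFinM (_ : 2^-1 / c * r = r / 2 / c)//; ring.
Qed.

Let gr k x : R := fine (killed_iter k (cst 1%E) x).

Let grE k x : killed_iter k (cst 1%E) x = (gr k x)%:E.
Proof.
rewrite /gr fineK// ge0_fin_numE ?killed_iter_ge0//.
exact: le_lt_trans (killed_iter_le1 k x) (ltry _).
Qed.

Let gr_ge0 k x : 0 <= gr k x.
Proof. by rewrite fine_ge0// killed_iter_ge0. Qed.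

Let gr_le1 k x : gr k x <= 1.
Proof. by rewrite -lee_fin -grE killed_iter_le1. Qed.

Let mgr k : measurable_fun setT (gr k).
Proof.
apply/measurable_EFinP; rewrite (_ : _ \o _ = killed_iter k (cst 1%E)).
  exact: measurable_killed_iter.
by apply/funext => x; rewrite grE.
Qed.

Let mA : measurable_fun setT (\1_`[0, a] : R -> R).
Proof. exact: measurable_indic. Qed.

Let Igr k : \bar R := (\int[mu]_x (\1_`[0, a] x * gr k x ^+ 2)%:E)%E.

Let int_indA : (\int[mu]_x (\1_`[0, a] x)%:E = a%:E :> \bar R)%E.
Proof. by rewrite integral_indic//= setIT lebesgue_measure_itv/= lte_fin a_gt0 oppr0 adde0. Qed.

Let mIgr k : measurable_fun setT (fun x => (\1_`[0, a] x * gr k x ^+ 2)%:E).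
Proof. by apply/measurable_EFinP/measurable_funM => //; exact: measurable_funX. Qed.

Let Igr_ge0 k : (0 <= Igr k)%E.
Proof. by apply: integral_ge0 => x _; rewrite lee_fin mulr_ge0// sqr_ge0. Qed.

Let Igr_le k : (Igr k <= a%:E)%E.
Proof.
rewrite -int_indA; apply: ge0_le_integral => //.
- by move=> x _; rewrite lee_fin mulr_ge0// sqr_ge0.
- exact: mIgr.
- exact/measurable_EFinP.
- by move=> x _; rewrite lee_fin ler_piMr// exprn_ile1.
Qed.

Let Igr_fin k : Igr k \is a fin_num.
Proof. by rewrite ge0_fin_numE//; exact: le_lt_trans (Igr_le k) (ltry _). Qed.

Hypothesis r_gt0 : 0 < r.

(** Schur's test for the iterates k + 1 and k with c = 1 / r: the left side is [Igr k.+1], and half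
    of it reappears on the right and is absorbed. *)
Let Igr_step k : (Igr k.+1 <= (r ^+ 2)%:E * Igr k)%E.
Proof.
have rV : 0 < r^-1 by rewrite invr_gt0.
have := killed_schur rV (mgr k.+1) (mgr k) (gr_ge0 k.+1) (gr_ge0 k).
rewrite -/(Igr k) -/(Igr k.+1).
rewrite [X in (X <= _)%E](_ : _ = Igr k.+1); last first.
  apply: eq_integral => x _; rewrite (_ : EFin \o gr k = killed_iter k (cst 1%E)).
    by rewrite -[killed _ x]/(killed_iter k.+1 (cst 1%E) x) grE -EFinM -mulrA.
  by apply/funext => y; rewrite grE.
have := Igr_fin k; have := Igr_fin k.+1.
case: (Igr k.+1) => [u| |]// _; case: (Igr k) => [v| |]// _.
rewrite -!EFinM -EFinD !lee_fin invrK (_ : r / 2 / r = 1 / 2); last by field; rewrite gt_eqF.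
by rewrite (_ : r / 2 * r * v = r ^+ 2 * v / 2); [lra|field].
Qed.

(** From L^2 back to L^1 by 2 g <= r^N + g^2 / r^N, which is Cauchy-Schwarz optimised in advance.
    The bound does not contain [m], so [phi] may degenerate at the ends in a later limit. *)
Lemma integral_killed_iter_le N :
  (\int[mu]_x ((\1_`[0, a] x)%:E * killed_iter N (cst 1%E) x) <= (r ^+ N * a)%:E)%E.
Proof.
have IN k : (Igr k <= (r ^+ (2 * k) * a)%:E)%E.
  elim: k => [|k IH]; first by rewrite muln0 mul1r Igr_le.
  apply: le_trans (Igr_step k) _.
  apply: (@le_trans _ _ ((r ^+ 2)%:E * (r ^+ (2 * k) * a)%:E)%E).
    by rewrite lee_wpmul2l// lee_fin exprn_ge0.
  by rewrite -EFinM lee_fin mulrA -exprD mulnS.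
have rN : 0 < r ^+ N by rewrite exprn_gt0.
apply: (@le_trans _ _ ((r ^+ N / 2)%:E * \int[mu]_x (\1_`[0, a] x)%:E +
   (2^-1 / r ^+ N)%:E * Igr N)%E).
  rewrite (_ : _%:E * _ = \int[mu]_x ((r ^+ N / 2)%:E * (\1_`[0, a] x)%:E))%E; last first.
    rewrite ge0_integralZl//; do ?[exact/measurable_EFinP];
      by rewrite lee_fin divr_ge0// ltW.
  rewrite (_ : _%:E * Igr N = \int[mu]_x ((2^-1 / r ^+ N)%:E * (\1_`[0, a] x * gr N x ^+ 2)%:E))%E; last first.
    rewrite ge0_integralZl//; do ?[exact: mIgr|by move=> x _; rewrite lee_fin mulr_ge0// sqr_ge0].
    by rewrite lee_fin divr_ge0// ltW.
  rewrite -ge0_integralD//; last first.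
  - by apply: emeasurable_funM => //; exact: mIgr.
  - move=> x _; rewrite mule_ge0// ?lee_fin ?mulr_ge0 ?sqr_ge0 ?invr_ge0 ?divr_ge0//; exact: ltW.
  - by apply: emeasurable_funM => //; exact/measurable_EFinP.
  - by move=> x _; rewrite mule_ge0 ?lee_fin ?divr_ge0// ltW.
  apply: ge0_le_integral => //.
  - by move=> x _; rewrite mule_ge0 ?lee_fin ?killed_iter_ge0.
  - apply: emeasurable_funM; first exact/measurable_EFinP.
    exact: measurable_killed_iter.
  - apply: emeasurable_funD; apply: emeasurable_funM => //; first exact/measurable_EFinP.
    exact: mIgr.
  - move=> x _; rewrite grE -!EFinM -EFinD lee_fin.
    rewrite [leRHS](_ : _ = \1_`[0, a] x * ((r ^+ N + gr N x ^+ 2 / r ^+ N) / 2)); last first.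
      by field; rewrite gt_eqF.
    rewrite ler_wpM2l// -subr_ge0.
    rewrite (_ : _ - _ = (r ^+ N - gr N x) ^+ 2 / (2 * r ^+ N)).
      by rewrite divr_ge0 ?sqr_ge0// mulr_ge0// ltW.
    by field; rewrite gt_eqF.
apply: (@le_trans _ _ ((r ^+ N / 2)%:E * a%:E + (2^-1 / r ^+ N)%:E * (r ^+ (2 * N) * a)%:E)%E).
  by rewrite int_indA leeD2l// lee_wpmul2l// lee_fin divr_ge0// ltW.
rewrite -!EFinM -EFinD lee_fin mul2n -addnn exprD le_eqVlt; apply/orP; left; apply/eqP.
by field; rewrite gt_eqF.
Qed.
End supersolution.

(** The error [tau] is additive because a subsolution vanishing at the ends cannot absorb it as a
    factor. The errors simply add up, since killing does not increase constants and r <= 1. *)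
Lemma killed_iter_subsolution (v : R -> R) (r tau : R) : measurable_fun setT v ->
  (forall y, 0 <= v y <= 1) -> 0 <= r <= 1 -> 0 <= tau ->
  (forall x : R, 0 <= x <= a -> ((r * v x)%:E <= killed (EFin \o v) x + tau%:E)%E) ->
  forall N (x : R), 0 <= x <= a ->
    ((r ^+ N * v x)%:E <= killed_iter N (cst 1%E) x + (N%:R * tau)%:E)%E.
Proof.
move=> mv v01 /andP[r0 r1] t0 vr; elim => [|N IH] x xa /=.
  by rewrite expr0 mul1r mul0r adde0 lee_fin; case/andP: (v01 x).
have v0 y : (0 <= (EFin \o v) y)%E by rewrite lee_fin; case/andP: (v01 y).
have mE : measurable_fun setT (EFin \o v) by exact/measurable_EFinP.
have rN : 0 <= r ^+ N by rewrite exprn_ge0.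
apply: (@le_trans _ _ (killed (fun y => (r ^+ N)%:E * (EFin \o v) y)%E x + tau%:E)%E).
  rewrite killedZ//.
  apply: (@le_trans _ _ ((r ^+ N)%:E * (killed (EFin \o v) x + tau%:E))%E).
    rewrite exprSr -mulrA EFinM lee_wpmul2l//; exact: vr.
  rewrite ge0_muleDr ?killed_ge0// leeD2l// -EFinM lee_fin ler_piMl//.
  by rewrite exprn_ile1.
rewrite -natr1 mulrDl mul1r EFinD addeA leeD2r//.
apply: (@le_trans _ _ (killed (fun y => killed_iter N (cst 1%E) y + (cst (N%:R * tau)%:E : R -> \bar R) y)%E x)).
  apply: le_killed => //.
  - by apply: emeasurable_funM.
  - by apply: emeasurable_funD => //; exact: measurable_killed_iter.
  - by move=> y; rewrite mule_ge0.
  - by move=> y; rewrite adde_ge0 ?killed_iter_ge0//= lee_fin mulr_ge0.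
rewrite killedD//.
- by rewrite leeD2l//; apply: killed_cst_le; rewrite mulr_ge0.
- exact: measurable_killed_iter.
- exact: killed_iter_ge0.
- by move=> y; rewrite lee_fin mulr_ge0.
Qed.
End killed_walk.

(** * One killed step applied to a sine arch *)

Section killed_gauss.
Context {R : realType}.
Notation mu := (@lebesgue_measure R).

Lemma cosh_ge0 (u : R) : 0 <= cosh u.
Proof. exact: le_trans (cosh_ge1 u). Qed.

(** A Chebyshev bound: the indicator of |z| >= e is below a multiple of (s / e)^4 cosh (z / s),
    whose mean under a normal law of deviation s has the fixed factor exp (1 / 2). Mass beyond
    distance e is thus O(s^4). *)
Lemma one_le_tail (s e z : R) : 0 < s -> 0 < e -> e <= `|z| ->
  1 <= 2 * 4 ^+ 4 * (s / e) ^+ 4 * cosh (s^-1 * z).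
Proof.
move=> s0 e0 ez.
have h : (s^-1 * z) ^+ 4 <= 4 ^+ 4 * (2 * cosh (s^-1 * z)).
  apply: le_trans (pow4_le_expR _) _; rewrite ler_wpM2l ?exprn_ge0//.
  by rewrite -cosh_even /cosh [leRHS]mulrC divfK// lerDl expR_ge0.
have se : 0 <= (s / e) ^+ 4 by rewrite exprn_even_ge0.
have := ler_wpM2l se h; rewrite -exprMn.
rewrite (_ : s / e * (s^-1 * z) = z / e); last by field; rewrite !gt_eqF.
rewrite (_ : (s / e) ^+ 4 * _ = 2 * 4 ^+ 4 * (s / e) ^+ 4 * cosh (s^-1 * z)); last by ring.
apply: le_trans; rewrite -[leRHS]ger0_norm ?exprn_even_ge0// normrX.
by rewrite exprn_ege1// normrM normfV (gtr0_norm e0) ler_pdivlMr// mul1r.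
Qed.

Lemma sin_ge_center (th z : R) : 0 <= th -> th <= z <= pi - th -> sin th <= sin z.
Proof.
move=> th0 /andP[h1 h2].
have p0 := pi_gt0 R.
set u := (z + th) / 2; set v := (z - th) / 2.
have zE : u + v = z by rewrite /u /v; field.
have tE : u - v = th by rewrite /u /v; field.
rewrite -subr_ge0 -zE -tE sinD sinB (_ : _ - _ = 2 * (cos u * sin v)); last by ring.
by rewrite !mulr_ge0// ?cos_ge0_pihalf ?sin_ge0_pi// /u /v; lra.
Qed.

Lemma sin_le0_neg (z : R) : - pi <= z <= 0 -> sin z <= 0.
Proof.
by move=> z0; rewrite -[z]opprK sinN oppr_le0 sin_ge0_pi//; lra.
Qed.

Lemma sin_le0_pi2pi (z : R) : pi <= z <= 2 * pi -> sin z <= 0.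
Proof.
move=> z0; rewrite -[z](subrK pi) sinDpi oppr_le0 sin_ge0_pi//; lra.
Qed.

Section one_step.
Variables (s a : R).
Hypotheses (s_gt0 : 0 < s) (a_gt0 : 0 < a).
Let A : set R := `[0, a].
Notation killed := (killed s a).

Let measurable_sin_affine (m c : R) : measurable_fun setT (fun y : R => sin (m * y + c)).
Proof.
apply: measurableT_comp; first exact: continuous_measurable_fun (@continuous_sin R).
by apply: measurable_funD => //; exact: measurable_funM.
Qed.

Let mcosh (x : R) : measurable_fun setT (fun y : R => cosh (s^-1 * (y - x))).
Proof.
apply: measurableT_comp; first exact: measurable_cosh.
by apply: measurable_funM => //; exact: measurable_funB.
Qed.

Let int_cosh (x q : R) : 0 <= q ->
  (\int[mu]_y (normal_pdf x s y * (q * cosh (s^-1 * (y - x))))%:E = (q * expR (1 / 2))%:E)%E.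
Proof.
move=> q0.
transitivity (\int[mu]_y (q%:E * (normal_pdf x s y * cosh (s^-1 * (y - x)))%:E))%E.
  by apply: eq_integral => y _; rewrite -EFinM mulrCA.
rewrite ge0_integralZl//.
- rewrite (integral_normal_cosh s_gt0) -EFinM; congr (_ * expR _)%:E.
  by field; rewrite gt_eqF.
- by apply/measurable_EFinP; apply: measurable_funM; [exact: measurable_normal_pdf|exact: mcosh].
- by move=> y _; rewrite lee_fin mulr_ge0 ?normal_pdf_ge0 ?cosh_ge0.
Qed.

Let mp (x : R) : measurable_fun setT (normal_pdf x s).
Proof. exact: measurable_normal_pdf. Qed.

Let mpf (x : R) (f : R -> R) : measurable_fun setT f ->
  measurable_fun setT (fun y : R => (normal_pdf x s y * f y)%:E).
Proof. by move=> mf; apply/measurable_EFinP; apply: measurable_funM. Qed.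

Let p0 (x y : R) : 0 <= normal_pdf x s y. Proof. exact: normal_pdf_ge0. Qed.

Let sin1 (z : R) : 0 <= 1 + sin z. Proof. by have := sin_geN1 z; lra. Qed.

Let killedE (h : R -> R) (x : R) : killed (EFin \o h) x =
  (\int[mu]_y (normal_pdf x s y * (\1_`[0, a] y * h y))%:E)%E.
Proof. by apply: eq_integral => y _; rewrite /killed_density -EFinM mulrA. Qed.

Let mh (h : R -> R) : measurable_fun setT h -> measurable_fun setT (fun y => \1_`[0, a] y * h y : R).
Proof. by move=> ?; apply: measurable_funM => //; exact: measurable_indic. Qed.

(** The pointwise comparison is integrated against the density. The cosh term contributes q exp (1 /
    2), and the density is added to both sides so that the nonnegative 1 + sin replaces the sine. *)
Lemma killed_le_sin (h : R -> R) (m c q x : R) : `|m * s| <= 1 -> 0 <= q ->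
  measurable_fun setT h -> (forall y, 0 <= h y) ->
  (forall y, \1_`[0, a] y * h y <= sin (m * y + c) + q * cosh (s^-1 * (y - x))) ->
  exists k, `|k - expR (- (m * s) ^+ 2 / 2)| <= (1 + 2 * 4 ^+ 4 * expR 2) * (m * s) ^+ 4 /\
    (killed (EFin \o h) x <= (k * sin (m * x + c) + q * expR (1 / 2))%:E)%E.
Proof.
move=> ms q0 mh0 h0 hle; have [k [kE intk]] := normal_sin_moment s_gt0 x c ms.
exists k; split=> //.
rewrite -(@leeD2rE _ 1%E)//.
rewrite -[X in (_ + X <= _)%E](integral_normal_pdf x s) killedE -ge0_integralD//; last first.
- by apply/measurable_EFinP; exact: mp.
- by move=> y _; rewrite lee_fin.
- by apply: mpf; exact: mh.
- by move=> y _; rewrite lee_fin mulr_ge0// mulr_ge0.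
rewrite -EFinD addrAC (addrC (k * _) 1) EFinD -intk -(int_cosh x q0) -ge0_integralD//; last first.
- by apply: mpf; exact: measurable_funM.
- by move=> y _; rewrite lee_fin !mulr_ge0// cosh_ge0.
- by apply: mpf; exact: measurable_funD.
- by move=> y _; rewrite lee_fin mulr_ge0.
apply: ge0_le_integral => //.
- by move=> y _; apply: adde_ge0; rewrite lee_fin// mulr_ge0// mulr_ge0.
- apply: emeasurable_funD; last by apply/measurable_EFinP; exact: mp.
  by apply: mpf; exact: mh.
- apply: emeasurable_funD; apply: mpf.
    exact: measurable_funD.
  exact: measurable_funM.
- move=> y _; rewrite -!EFinD lee_fin -[X in _ + X <= _]mulr1 -!mulrDr ler_wpM2l//.
  by have := hle y; lra.
Qed.

Lemma killed_ge_sin (h : R -> R) (m c q x : R) : `|m * s| <= 1 -> 0 <= q ->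
  measurable_fun setT h -> (forall y, 0 <= h y) ->
  (forall y, sin (m * y + c) <= \1_`[0, a] y * h y + q * cosh (s^-1 * (y - x))) ->
  exists k, `|k - expR (- (m * s) ^+ 2 / 2)| <= (1 + 2 * 4 ^+ 4 * expR 2) * (m * s) ^+ 4 /\
    ((k * sin (m * x + c))%:E <= killed (EFin \o h) x + (q * expR (1 / 2))%:E)%E.
Proof.
move=> ms q0 mh0 h0 hle; have [k [kE intk]] := normal_sin_moment s_gt0 x c ms.
exists k; split=> //.
rewrite -(@leeD2lE _ 1%E)// -EFinD -intk.
rewrite -[X in (_ <= X + _)%E](integral_normal_pdf x s) killedE -(int_cosh x q0).
have m1 : measurable_fun setT (fun y : R => (normal_pdf x s y)%:E) by apply/measurable_EFinP; exact: mp.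
have m2 : measurable_fun setT (fun y : R => (normal_pdf x s y * (\1_`[0, a] y * h y))%:E).
  by apply: mpf; exact: mh.
have m3 : measurable_fun setT (fun y : R => (normal_pdf x s y * (q * cosh (s^-1 * (y - x))))%:E).
  by apply: mpf; exact: measurable_funM.
have n2 y : (0 <= (normal_pdf x s y * (\1_`[0, a] y * h y))%:E)%E.
  by rewrite lee_fin mulr_ge0// mulr_ge0.
have n3 y : (0 <= (normal_pdf x s y * (q * cosh (s^-1 * (y - x))))%:E)%E.
  by rewrite lee_fin !mulr_ge0// cosh_ge0.
have <- : (\int[mu]_y ((normal_pdf x s y * (\1_`[0, a] y * h y))%:E +
    (normal_pdf x s y * (q * cosh (s^-1 * (y - x))))%:E) =
   \int[mu]_y (normal_pdf x s y * (\1_`[0, a] y * h y))%:E +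
   \int[mu]_y (normal_pdf x s y * (q * cosh (s^-1 * (y - x))))%:E)%E.
  by rewrite ge0_integralD.
rewrite -ge0_integralD//; last first.
- exact: emeasurable_funD.
- by move=> y _; rewrite adde_ge0.
- by move=> y _; rewrite lee_fin.
apply: ge0_le_integral => //.
- by move=> y _; rewrite lee_fin mulr_ge0.
- by apply: mpf; exact: measurable_funD.
- by apply: emeasurable_funD => //; exact: emeasurable_funD.
- move=> y _; rewrite -!EFinD lee_fin -[X in _ <= X + _]mulr1 -!mulrDr ler_wpM2l//.
  by have := hle y; lra.
Qed.

(** The positive part is taken because the killed operator is handled on functions nonnegative on
    the whole line; on the arch nothing changes. *)
Definition sin_pos (m c y : R) : R := maxr 0 (sin (m * y + c)).

Lemma sin_pos_ge0 m c y : 0 <= sin_pos m c y.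
Proof. by rewrite le_max lexx. Qed.

Lemma sin_pos_le1 m c y : sin_pos m c y <= 1.
Proof. by rewrite ge_max ler01 sin_le1. Qed.

Lemma measurable_sin_pos m c : measurable_fun setT (sin_pos m c).
Proof. exact: measurable_maxr. Qed.

Lemma sin_posE m c y : 0 <= m * y + c <= pi -> sin_pos m c y = sin (m * y + c).
Proof. by move=> h; apply/max_r/sin_ge0_pi. Qed.

Let ind_in (y : R) : 0 <= y <= a -> \1_`[0, a] y = 1 :> R.
Proof. by move=> ya; rewrite indicE mem_set//= in_itv. Qed.

Let ind_out (y : R) : ~~ (0 <= y <= a) -> \1_`[0, a] y = 0 :> R.
Proof. by move=> ya; rewrite indicE memNset//= in_itv/=; exact/negP. Qed.

(* The sine arch of the slightly wider interval [-e, a + e] stays positive at the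
   ends of [0, a], so it dominates the mass its negative part would contribute. *)
Lemma killed_sin_supersolution (e : R) : 0 < e -> let m := pi / (a + 2 * e) in
  `|m * s| <= 1 -> forall x, 0 <= x <= a ->
  (killed (EFin \o sin_pos m (m * e)) x <=
   ((expR (- (m * s) ^+ 2 / 2) + ((1 + 2 * 4 ^+ 4 * expR 2) * m ^+ 4 +
      2 * 4 ^+ 4 * expR (1 / 2) / e ^+ 4 / sin (m * e)) * s ^+ 4) *
     sin_pos m (m * e) x)%:E)%E.
Proof.
move=> e0 m ms x /andP[x0 xa].
have pi0 := pi_gt0 R.
have a2 : 0 < a + 2 * e by lra.
have m0 : 0 < m by rewrite divr_gt0.
have mpi : m * (a + 2 * e) = pi by rewrite /m divfK// gt_eqF.
have range y : - e <= y <= a + e -> 0 <= m * y + m * e <= pi.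
  move=> /andP[y1 y2]; rewrite -mulrDr; apply/andP; split.
    by rewrite pmulr_rge0//; lra.
  by rewrite -mpi ler_pM2l//; lra.
set q := 2 * 4 ^+ 4 * (s / e) ^+ 4.
have q0 : 0 <= q.
  by apply: mulr_ge0; [rewrite mulr_ge0 ?exprn_ge0|rewrite exprn_even_ge0].
have [|k [kE]] := @killed_le_sin (sin_pos m (m * e)) m (m * e) q x ms q0
    (measurable_sin_pos _ _) (sin_pos_ge0 _ _).
  move=> y; have c0 := cosh_ge0 (s^-1 * (y - x)).
  have [ya|ya] := boolP (0 <= y <= a).
    rewrite ind_in// mul1r sin_posE; last by apply: range; lra.
    by rewrite lerDl mulr_ge0.
  rewrite ind_out// mul0r; have [ye|ye] := leP e `|y - x|.
    have := one_le_tail s_gt0 e0 ye; rewrite -/q.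
    by have := sin_geN1 (m * y + m * e); lra.
  apply: addr_ge0; last by rewrite mulr_ge0.
  apply: sin_ge0_pi; apply: range.
  by move: ye; rewrite ltr_norml => /andP[? ?]; lra.
move=> /le_trans; apply; rewrite lee_fin sin_posE; last by apply: range; lra.
have th_gt0 : 0 < sin (m * e).
  rewrite sin_gt0_pi// mulr_gt0//= -mpi ltr_pM2l//; lra.
have th_le : sin (m * e) <= sin (m * x + m * e).
  apply: sin_ge_center; first by rewrite mulr_ge0// ltW.
  rewrite -mpi -mulrDr -mulrBr !ler_pM2l//; lra.
have sx0 : 0 < sin (m * x + m * e) by apply: lt_le_trans th_le.
(* The tail error, additive so far, becomes multiplicative through the factor sin (m x + m e) / sin
   (m e), which is at least 1 on [0, a]. *)
rewrite [leRHS](_ : _ = (expR (- (m * s) ^+ 2 / 2) + (1 + 2 * 4 ^+ 4 * expR 2) * (m * s) ^+ 4) *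
   sin (m * x + m * e) + (q * expR (1 / 2)) * (sin (m * x + m * e) / sin (m * e))); last first.
  rewrite /q; move: (expR 2) (expR (1 / 2)) (4 ^+ 4) => E2 E1 K.
  by field; rewrite !gt_eqF.
apply: lerD.
  rewrite ler_wpM2r ?(ltW sx0)//; move: kE; rewrite ler_norml => /andP[_].
  by rewrite lerBlDl.
have K1 : 0 <= q * expR (1 / 2) by apply: mulr_ge0 => //; exact: expR_ge0.
by rewrite ler_peMr// ler_pdivlMr// mul1r.
Qed.

(** The arch now fits [0, a] exactly. A point outside [0, a] but within distance [a] of [x] lies in
    [-a, 0] or [a, 2 a], where the sine is at most 0, so killing there only helps; farther points
    belong to the tail. *)
Lemma killed_sin_subsolution : let m := pi / a in
  `|m * s| <= 1 -> forall x, 0 <= x <= a ->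
  ((expR (- (m * s) ^+ 2 / 2) * sin_pos m 0 x)%:E <=
   killed (EFin \o sin_pos m 0) x +
   (((1 + 2 * 4 ^+ 4 * expR 2) * m ^+ 4 + 2 * 4 ^+ 4 * expR (1 / 2) / a ^+ 4) * s ^+ 4)%:E)%E.
Proof.
move=> m ms x /andP[x0 xa].
have pi0 := pi_gt0 R.
have m0 : 0 < m by rewrite divr_gt0.
have mpi : m * a = pi by rewrite /m divfK// gt_eqF.
have range y : 0 <= y <= a -> 0 <= m * y + 0 <= pi.
  move=> /andP[y1 y2]; rewrite addr0; apply/andP; split; first by rewrite pmulr_rge0.
  by rewrite -mpi ler_pM2l.
set q := 2 * 4 ^+ 4 * (s / a) ^+ 4.
have q0 : 0 <= q.
  by apply: mulr_ge0; [rewrite mulr_ge0 ?exprn_ge0|rewrite exprn_even_ge0].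
have [|k [kE]] := @killed_ge_sin (sin_pos m 0) m 0 q x ms q0
    (measurable_sin_pos _ _) (sin_pos_ge0 _ _).
  move=> y; have c0 := cosh_ge0 (s^-1 * (y - x)).
  have [ya|ya] := boolP (0 <= y <= a).
    by rewrite ind_in// mul1r sin_posE ?range// lerDl mulr_ge0.
  rewrite ind_out// mul0r add0r; have [ye|ye] := leP a `|y - x|.
    have := one_le_tail s_gt0 a_gt0 ye; rewrite -/q.
    by have := sin_le1 (m * y + 0); lra.
  apply: le_trans (_ : 0 <= _); last by rewrite mulr_ge0.
  move: ye; rewrite ltr_norml => /andP[y1 y2]; rewrite addr0.
  move: ya; rewrite negb_and -!ltNge => /orP[ya|ya].
    apply: sin_le0_neg; rewrite -mpi -mulrN ler_pM2l// pmulr_rle0//.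
    by apply/andP; split; lra.
  apply: sin_le0_pi2pi; rewrite -mpi mulrCA !ler_pM2l//.
  by apply/andP; split; lra.
move=> h; have v0 := sin_pos_ge0 m 0 x; have v1 := sin_pos_le1 m 0 x.
rewrite -(@leeD2rE _ (q * expR (1 / 2))%:E)//.
apply: (@le_trans _ _ ((k * sin (m * x + 0))%:E +
  ((1 + 2 * 4 ^+ 4 * expR 2) * (m * s) ^+ 4 + q * expR (1 / 2))%:E)%E).
  rewrite -!EFinD lee_fin -sin_posE ?range ?x0// addrA lerD2r.
  rewrite -lerBlDl -mulrBl.
  have K0 : 0 <= (1 + 2 * 4 ^+ 4 * expR 2) * (m * s) ^+ 4.
    by rewrite (le_trans _ kE).
  apply: (@le_trans _ _ ((1 + 2 * 4 ^+ 4 * expR 2) * (m * s) ^+ 4 * sin_pos m 0 x)).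
    rewrite ler_wpM2r//; move: kE; rewrite ler_norml => /andP[+ _]; lra.
  by rewrite ler_piMr.
apply: (@le_trans _ _ (killed (EFin \o sin_pos m 0) x + (q * expR (1 / 2))%:E +
  ((1 + 2 * 4 ^+ 4 * expR 2) * (m * s) ^+ 4 + q * expR (1 / 2))%:E)%E).
  by rewrite leeD2r.
rewrite -[leLHS]addeA -[leRHS]addeA; apply: leeD2l.
rewrite -!EFinD lee_fin le_eqVlt; apply/orP; left; apply/eqP.
rewrite /q; move: (expR 2) (expR (1 / 2)) (4 ^+ 4) => E2 E1 K.
by field; rewrite !gt_eqF.
Qed.
End one_step.
End killed_gauss.

(** * N killed steps of variance t / N *)

Section walk_limit.
Context {R : realType}.
Notation mu := (@lebesgue_measure R).
Variables (a t : R).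
Hypotheses (a_gt0 : 0 < a) (t_gt0 : 0 < t).

Definition mesh (N : nat) : R := Num.sqrt (t / N%:R).

Let mesh_gt0 N : (0 < N)%N -> 0 < mesh N.
Proof. by move=> N0; rewrite sqrtr_gt0 divr_gt0// ltr0n. Qed.

Let mesh2 N : mesh N ^+ 2 = t / N%:R.
Proof. by rewrite sqr_sqrtr// divr_ge0// ltW. Qed.

Let mesh4 N : mesh N ^+ 4 = t ^+ 2 / N%:R ^+ 2.
Proof. by rewrite (exprM _ 2 2) mesh2 expr_div_n. Qed.

Let small (m : R) N : (0 < N)%N -> m ^+ 2 * t <= N%:R -> `|m * mesh N| <= 1.
Proof.
move=> N0 mN; rewrite -(@ler_pXn2r _ 2)// ?nnegrE// expr1n -normrX ger0_norm ?sqr_ge0//.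
by rewrite exprMn mesh2 mulrA ler_pdivrMr ?ltr0n// mul1r.
Qed.

(** Each step costs at most exp (- (m s)^2 / 2) + O(s^4) with s^4 = t^2 / N^2, whence C / N in the
    exponent after N steps. The first conclusion comes from Schur's test, the second from the
    pointwise supersolution; m^2 t <= N says |m s| <= 1. *)
Lemma walk_upper (e : R) : 0 < e -> let m := pi / (a + 2 * e) in
  exists C, forall N, (0 < N)%N -> m ^+ 2 * t <= N%:R ->
  (\int[mu]_x ((\1_`[0, a] x)%:E * killed_iter (mesh N) a N (cst 1%E) x) <=
     (expR (- (m ^+ 2 * t) / 2 + C / N%:R) * a)%:E)%E /\
  forall x : R, 0 <= x <= a -> (killed_iter (mesh N) a N (cst 1%E) x <=
     (expR (- (m ^+ 2 * t) / 2 + C / N%:R) * (sin (m * x + m * e) / sin (m * e)))%:E)%E.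
Proof.
move=> e0 m.
have a0 := a_gt0; have a2 : 0 < a + 2 * e by lra.
have m0 : 0 < m by rewrite divr_gt0// pi_gt0.
have mpi : m * (a + 2 * e) = pi by rewrite /m divfK// gt_eqF.
have th_gt0 : 0 < sin (m * e).
  rewrite sin_gt0_pi// mulr_gt0//= -mpi ltr_pM2l//; lra.
have range y : 0 <= y <= a -> 0 <= m * y + m * e <= pi.
  move=> /andP[y1 y2]; rewrite -mulrDr; apply/andP; split.
    by rewrite pmulr_rge0//; lra.
  by rewrite -mpi ler_pM2l//; lra.
have min y : 0 <= y <= a -> sin (m * e) <= sin_pos m (m * e) y.
  move=> ya; rewrite sin_posE ?range//; case/andP: ya => y1 y2.
  apply: sin_ge_center; first by rewrite mulr_ge0// ltW.
  by rewrite -mpi -mulrDr -mulrBr !ler_pM2l//; apply/andP; split; lra.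
pose C1 := (1 + 2 * 4 ^+ 4 * expR 2) * m ^+ 4 +
      2 * 4 ^+ 4 * expR (1 / 2) / e ^+ 4 / sin (m * e).
have C10 : 0 <= C1.
  apply: addr_ge0.
    by apply: mulr_ge0; rewrite ?exprn_even_ge0// addr_ge0// mulr_ge0 ?expR_ge0// mulr_ge0 ?exprn_ge0.
  rewrite divr_ge0 ?(ltW th_gt0)// divr_ge0 ?exprn_even_ge0// mulr_ge0 ?expR_ge0//.
exists (C1 * expR (1 / 2) * t ^+ 2) => N N0 mN.
have s0 := mesh_gt0 N0; have ms := small N0 mN.
set s := mesh N in s0 ms *.
pose w := (m * s) ^+ 2 / 2.
have w1 : 0 <= w <= 1 / 2.
  rewrite /w divr_ge0 ?sqr_ge0//= ler_pM2r// -(ger0_norm (sqr_ge0 _)) normrX.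
  by rewrite exprn_ile1.
pose r := expR (- w + C1 * expR (1 / 2) * s ^+ 4).
have s4 : 0 <= s ^+ 4 by rewrite exprn_even_ge0.
(* Since w <= 1 / 2, the factor exp (1 / 2) compensates exp (- w) and lets the additive error enter
   the exponent. *)
have rge : expR (- w) + C1 * s ^+ 4 <= r.
  rewrite /r expRD; apply: (@le_trans _ _ (expR (- w) * (1 + C1 * expR (1 / 2) * s ^+ 4))).
    rewrite mulrDr mulr1 lerD2l.
    rewrite (_ : expR (- w) * _ = expR (- w) * expR (1 / 2) * (C1 * s ^+ 4)); last by ring.
    have Cs : 0 <= C1 * s ^+ 4 by exact: mulr_ge0.
    by rewrite ler_peMl// -expRD -[leLHS]expR0 ler_expR; case/andP: w1 => _; lra.
  by rewrite ler_wpM2l ?expR_ge0// expR_ge1Dx.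
have r0 : 0 < r by exact: expR_gt0.
have rN : r ^+ N = expR (- (m ^+ 2 * t) / 2 + C1 * expR (1 / 2) * t ^+ 2 / N%:R).
  rewrite /r -expRM_natl /w exprMn mesh2 mesh4; congr expR.
  by field; rewrite pnatr_eq0 -lt0n.
have phir (x : R) : 0 <= x <= a ->
    (killed s a (EFin \o sin_pos m (m * e)) x <= (r * sin_pos m (m * e) x)%:E)%E.
  move=> xa; apply: le_trans (killed_sin_supersolution s0 e0 ms xa) _.
  rewrite lee_fin ler_wpM2r ?sin_pos_ge0//; apply: le_trans rge.
  by rewrite lerD2r ler_expR /w mulNr.
split.
  rewrite -rN; apply: (integral_killed_iter_le s0 a_gt0 (measurable_sin_pos _ _)
    (sin_pos_ge0 _ _) th_gt0 min (ltW r0) phir r0 N).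
move=> x xa; rewrite -rN mulrA -(sin_posE (range _ xa)).
exact: (killed_iter_supersolution s0 (measurable_sin_pos _ _)
    (sin_pos_ge0 _ _) th_gt0 min (ltW r0) phir N xa).
Qed.

(** Here the error stays additive: N steps, each with an error of order s^4 = t^2 / N^2, give C /
    N. *)
Lemma walk_lower : let m := pi / a in
  exists C, forall N, (0 < N)%N -> m ^+ 2 * t <= N%:R ->
  forall x : R, 0 <= x <= a -> ((expR (- (m ^+ 2 * t) / 2) * sin (m * x))%:E <=
    killed_iter (mesh N) a N (cst 1%E) x + (C / N%:R)%:E)%E.
Proof.
move=> m; have a0 := a_gt0.
have m0 : 0 < m by rewrite divr_gt0// pi_gt0.
have mpi : m * a = pi by rewrite /m divfK// gt_eqF.
pose C1 := (1 + 2 * 4 ^+ 4 * expR 2) * m ^+ 4 + 2 * 4 ^+ 4 * expR (1 / 2) / a ^+ 4.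
have C10 : 0 <= C1.
  apply: addr_ge0.
    by apply: mulr_ge0; rewrite ?exprn_even_ge0// addr_ge0// mulr_ge0 ?expR_ge0// mulr_ge0 ?exprn_ge0.
  rewrite divr_ge0 ?exprn_even_ge0// mulr_ge0 ?expR_ge0//.
exists (C1 * t ^+ 2) => N N0 mN x xa.
have s0 := mesh_gt0 N0; have ms := small N0 mN.
set s := mesh N in s0 ms *.
have s4 : 0 <= s ^+ 4 by rewrite exprn_even_ge0.
have xr : 0 <= m * x + 0 <= pi.
  case/andP: xa => x1 x2; rewrite addr0 -mpi ler_pM2l// x2 andbT.
  by rewrite pmulr_rge0.
have := @killed_iter_subsolution R s a s0 (sin_pos m 0) (expR (- (m * s) ^+ 2 / 2)) (C1 * s ^+ 4)
  (measurable_sin_pos _ _) _ _ (mulr_ge0 C10 s4) (killed_sin_subsolution s0 a_gt0 ms) N x xa.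
rewrite sin_posE// addr0 -expRM_natl exprMn mesh2 mesh4.
rewrite (_ : N%:R * _ = - (m ^+ 2 * t) / 2); last by field; rewrite pnatr_eq0 -lt0n.
rewrite (_ : N%:R * _ = C1 * t ^+ 2 / N%:R); last by field; rewrite pnatr_eq0 -lt0n.
apply.
- by move=> y; rewrite sin_pos_ge0 sin_pos_le1.
- rewrite expR_ge0/= -[leRHS]expR0 ler_expR mulNr oppr_le0 divr_ge0//.
  by rewrite mulr_ge0 ?sqr_ge0// divr_ge0// ltW.
Qed.
End walk_limit.

Lemma lee_expR_div (R : realType) (y : \bar R) (b C X : R) (N0 : nat) : 0 <= X ->
  (forall N, (N0 <= N)%N -> y <= (expR (b + C / N%:R) * X)%:E)%E -> (y <= (expR b * X)%:E)%E.
Proof.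
move=> X0 H.
have cv : (expR (b + C / N%:R) * X)%:E @[N --> \oo] --> (expR b * X)%:E.
  apply/cvg_EFin; first by near=> N.
  apply: cvgMl; apply: (@continuous_cvg _ _ _ _ _ _ expR); first exact: continuous_expR.
  rewrite -[X in _ --> X]addr0; apply: cvgD; first exact: cvg_cst.
  rewrite -[X in _ --> X](mulr0 C); apply: cvgM; first exact: cvg_cst.
  apply/gtr0_cvgV0; last exact: cvgr_idn.
  by near=> n; rewrite ltr0n; near: n; exact: nbhs_infty_gt.
apply: (cvge_to_ge cv); near=> N; apply: H; near: N; exact: nbhs_infty_ge.
Unshelve. all: by end_near. Qed.

(** * Random walks and finite-dimensional laws *)

Section cylinder_law.
Context {R : realType} (I : finType).

Definition cylinders : set (set (I -> R)) :=
  [set B | exists A : I -> set R, (forall i, measurable (A i)) /\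
                                  B = [set f | forall i, A i (f i)]].

Let path_space := g_sigma_algebraType cylinders.

Lemma measurable_coord (i : I) : measurable_fun [set: path_space] (fun f : path_space => (f : I -> R) i).
Proof.
move=> _ B mB; rewrite setTI; apply: sub_sigma_algebra.
exists (fun j => if j == i then B else setT); split.
  by move=> j; case: ifP.
apply/seteqP; split => f /=.
  by move=> Bf j; case: eqP => // ->.
by move=> /(_ i); rewrite eqxx.
Qed.

Lemma measurable_path d (T : measurableType d) (F : T -> path_space) :
  (forall i, measurable_fun setT (fun w => (F w : I -> R) i)) -> measurable_fun setT F.
Proof.
move=> mF; apply: (measurability (rT := path_space) cylinders) => //.
move=> _ [_ [A [mA ->]] <-]; rewrite setTI.
rewrite (_ : _ @^-1` _ = \bigcap_(i in [set: I]) ((fun w => (F w : I -> R) i) @^-1` A i)).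
  apply: fin_bigcap_measurable => // i _.
  by rewrite -[X in measurable X]setTI; exact: mF.
by apply/seteqP; split => w /= h i; have := h i; [|apply].
Qed.

Lemma cylinders_setI : setI_closed cylinders.
Proof.
move=> _ _ [A [mA ->]] [B [mB ->]]; exists (fun i => A i `&` B i); split.
  by move=> i; exact: measurableI.
by apply/seteqP; split => f /= h; [move=> i; case: h|split=> i; case: (h i)].
Qed.

(** Dynkin's pi-lambda theorem for boxes. It compares finite measures, possibly on different spaces:
    equality of laws is one instance, and independence another, by comparing a restricted measure
    with a scaled one. *)
Lemma cylinder_law_unique d1 (T1 : measurableType d1) d2 (T2 : measurableType d2)
    (m1 : {measure set T1 -> \bar R}) (m2 : {measure set T2 -> \bar R})
    (F1 : T1 -> I -> R) (F2 : T2 -> I -> R) :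
  (forall i, measurable_fun setT (fun w => F1 w i)) ->
  (forall i, measurable_fun setT (fun w => F2 w i)) ->
  (m1 setT < +oo)%E ->
  (forall A : I -> set R, (forall i, measurable (A i)) ->
    m1 [set w | forall i, A i (F1 w i)] = m2 [set w | forall i, A i (F2 w i)]) ->
  forall H, <<s cylinders>> H -> m1 (F1 @^-1` H) = m2 (F2 @^-1` H).
Proof.
move=> mF1 mF2 m1oo m12 H sH.
have mG1 : measurable_fun setT (F1 : T1 -> path_space) by exact: measurable_path.
have mG2 : measurable_fun setT (F2 : T2 -> path_space) by exact: measurable_path.
apply: (@measure_unique _ R path_space cylinders (fun _ => setT) _ cylinders_setI _ _
  (image_measure m1 mG1) (image_measure m2 mG2)) => //.
- by move=> _; exists (fun _ => setT); split => //; apply/seteqP; split.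
- by rewrite bigcup_const.
- by move=> _ [A [mA ->]]; exact: m12.
Qed.
End cylinder_law.

Section independent_pair.
Context {R : realType} d (T : measurableType d) (P : probability T R).
Context d1 (T1 : measurableType d1) d2 (T2 : measurableType d2).
Variables (E : set T) (mE : measurable E) (U : T -> T1) (mU : measurable_fun setT U).

Let PE : {measure set T -> \bar R} := mrestr P mE.

Let PEE (f : T -> \bar R) : measurable_fun setT f -> (forall w, 0 <= f w)%E ->
  (\int[P]_(w in E) f w = \int[PE]_w f w)%E.
Proof.
move=> mf f0; rewrite (@ge0_integral_density _ _ _ P PE \1_E f)//.
- rewrite [LHS]integral_mkcond; apply: eq_integral => w _.
  by rewrite patchE indicE; case: ifPn => _; rewrite ?mul1e ?mul0e.
- by move=> A mA; rewrite integral_indic// setIC.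
Qed.

Let m1 : set T1 -> \bar R := pushforward PE U.
Let M1 := image_measure PE mU.
HB.instance Definition _ := isMeasure.Build _ _ _ m1
  (measure0 M1) (measure_ge0 M1) (@measure_semi_sigma_additive _ _ _ M1).

Let finm1 : fin_num_fun m1.
Proof.
move=> A mA; have mUA : measurable (U @^-1` A) by have := mU measurableT mA; rewrite setTI.
rewrite ge0_fin_numE// (@le_lt_trans _ _ 1%E) ?ltry//.
by apply: probability_le1; exact: measurableI.
Qed.
HB.instance Definition _ := Measure_isFinite.Build _ _ _ m1 finm1.

(** On the event [E] the pair (U, V) has a product law under the restricted measure, so Tonelli
    integrates [V] out with [U] frozen. *)
Lemma integral_indep (V : T -> T2) (nu : probability T2 R) (k : T1 * T2 -> \bar R) :
  measurable_fun setT V ->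
  (forall B C, measurable B -> measurable C ->
    P (E `&` (U @^-1` B `&` V @^-1` C)) = (P (E `&` U @^-1` B) * nu C)%E) ->
  measurable_fun setT k -> (forall z, 0 <= k z)%E ->
  (\int[P]_(w in E) k (U w, V w) = \int[P]_(w in E) \int[nu]_y k (U w, y))%E.
Proof.
move=> mV ind mk k0.
have mUV : measurable_fun setT (fun w => (U w, V w)) by exact: measurable_fun_pair.
have mk2 : measurable_fun setT (fun x => \int[nu]_y k (x, y))%E.
  exact: measurable_fun_fubini_tonelli_F.
have k20 x : (0 <= \int[nu]_y k (x, y))%E by exact: integral_ge0.
rewrite PEE//; last exact: (measurableT_comp mk).
rewrite [RHS]PEE//; last exact: (measurableT_comp mk2).
transitivity (\int[image_measure PE mUV]_z k z)%E.
  by rewrite ge0_integral_pushforward.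
transitivity (\int[m1 \x nu]_z k z)%E.
  apply: eq_measure_integral => A mA _; apply/esym; apply: product_measure_unique => // B C mB mC.
  by have := ind B C mB mC; rewrite !(setIC E).
by rewrite fubini_tonelli1// /fubini_F ge0_integral_pushforward.
Qed.
End independent_pair.

Section gaussian_walk.
Context {R : realType} d (T : measurableType d) (P : probability T R).
Notation mu := (@lebesgue_measure R).
Variables (s a : R) (xi : nat -> T -> R).
Hypotheses (s_gt0 : 0 < s) (mxi : forall j, measurable_fun setT (xi j)).
Hypothesis xi_law : forall N (A : nat -> set R), (forall j, measurable (A j)) ->
  P [set w | forall j, (j < N)%N -> A j (xi j w)] =
  (\prod_(j < N) fine (normal_prob 0 s (A j)))%:E.

Let s0 : s != 0. Proof. by rewrite gt_eqF. Qed.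
Let nu : probability (measurableTypeR R) R := normal_prob 0 s.

Let nu_fin A : measurable A -> nu A = (fine (nu A))%:E.
Proof. by move=> mA; rewrite fineK// fin_num_measure. Qed.

Definition walk (x : R) (N : nat) (w : T) : R := x + \sum_(j < N) xi j w.

Definition walk_stays (x : R) (N : nat) : set T :=
  [set w | forall j, (j <= N)%N -> 0 <= walk x j w <= a].

Lemma measurable_walk x N : measurable_fun setT (walk x N).
Proof.
apply: measurable_funD => //.
by apply: measurable_sum => j; exact: mxi.
Qed.

Let measurable_stays_at x j : measurable [set w | 0 <= walk x j w <= a].
Proof.
have := measurable_walk x j measurableT (measurable_itv `[0, a]); rewrite setTI.
by congr measurable; apply/seteqP; split => w /=; rewrite in_itv.
Qed.

Lemma measurable_walk_stays x N : measurable (walk_stays x N).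
Proof.
rewrite (_ : walk_stays x N = \bigcap_(j in `I_N.+1) [set w | 0 <= walk x j w <= a]).
  by apply: fin_bigcap_measurable => // j _; exact: measurable_stays_at.
by apply/seteqP; split => w h j; have := h j.
Qed.

(** [cylinder_law_unique] applied to P restricted to the event of step N and to P scaled by
    [nu C]. *)
Lemma walk_past_indep N (H : set ('I_N -> R)) C : <<s @cylinders R 'I_N >> H -> measurable C ->
  P ((fun w (i : 'I_N) => xi i w) @^-1` H `&` xi N @^-1` C) =
  (P ((fun w (i : 'I_N) => xi i w) @^-1` H) * nu C)%E.
Proof.
move=> cH mC.
have mxC : measurable (xi N @^-1` C) by have := mxi N measurableT mC; rewrite setTI.
pose c : {nonneg R} := NngNum (fine_ge0 (measure_ge0 nu C)).
transitivity (mrestr P mxC ((fun w (i : 'I_N) => xi i w) @^-1` H)) => //.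
transitivity (mscale c P ((fun w (i : 'I_N) => xi i w) @^-1` H)); last first.
  by rewrite /mscale/= -nu_fin// muleC.
apply: cylinder_law_unique cH => //.
- by rewrite (@le_lt_trans _ _ 1%E) ?ltry//; apply: probability_le1; exact: measurableI.
move=> A mA.
(* The default branch of [insub] puts [C] at index N, so the joint event becomes a box for the first
   N + 1 steps. *)
pose A' j : set R := if insub j is Some i then A i else C.
have mA' j : measurable (A' j) by rewrite /A'; case: insubP.
have A'E (i : 'I_N) : A' i = A i by rewrite /A' valK.
have A'N : A' N = C by rewrite /A' insubF// ltnn.
have E1 : [set w | forall i : 'I_N, A i (xi i w)] =
    [set w | forall j, (j < N)%N -> A' j (xi j w)].
  apply/seteqP; split => w /= h.
    by move=> j jN; rewrite -[j]/(val (Ordinal jN)) A'E; exact: h.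
  by move=> i; rewrite -A'E; apply: h.
rewrite E1; change (P ([set w | forall j, (j < N)%N -> A' j (xi j w)] `&` xi N @^-1` C) =
  ((fine (nu C))%:E * P [set w | forall j, (j < N)%N -> A' j (xi j w)])%E).
rewrite xi_law// -nu_fin//.
rewrite (_ : _ `&` _ = [set w | forall j, (j < N.+1)%N -> A' j (xi j w)]).
  by rewrite xi_law// big_ord_recr/= A'N [in RHS]nu_fin// -EFinM mulrC.
apply/seteqP; split => w /=.
  move=> [h1 h2] j; rewrite ltnS leq_eqVlt => /orP[/eqP ->|/h1//].
  by rewrite A'N.
move=> h; split; first by move=> j jN; apply: h; rewrite ltnS ltnW.
by have := h N (ltnSn N); rewrite A'N.
Qed.

Let walk_sum N (f : 'I_N -> R) (j : nat) := \sum_(i < N) (if (i < j)%N then f i else 0).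

Let walk_sumE x N j w : (j <= N)%N ->
  walk x j w = x + walk_sum (fun i : 'I_N => xi i w) j.
Proof. by move=> jN; rewrite /walk /walk_sum (big_ord_widen N (fun i => xi i w))// big_mkcond. Qed.

(** Induction on N for all [h] at once: the last step is independent of the past, and integrating it
    out replaces [h] by [killed s a h]. *)
Lemma integral_walk N (h : R -> \bar R) x : measurable_fun setT h ->
  (forall y, 0 <= h y)%E -> 0 <= x <= a ->
  (\int[P]_(w in walk_stays x N) h (walk x N w) = killed_iter s a N h x)%E.
Proof.
elim: N h => [|N IH] h mh h0 xa.
  rewrite (_ : walk_stays x 0 = setT); last first.
    apply/seteqP; split => // w _ j; rewrite leqn0 => /eqP ->.
    by rewrite /walk big_ord0 addr0.
  under eq_integral do rewrite /walk big_ord0 addr0.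
  by rewrite integral_cst//= ?probability_setT ?mule1.
pose k (z : R * R) : \bar R := ((\1_`[0, a] (z.1 + z.2) : R)%:E * h (z.1 + z.2)%R)%E.
have mk : measurable_fun setT k.
  have mD : measurable_fun setT (fun z : R * R => z.1 + z.2) by exact: measurable_funD.
  apply: emeasurable_funM; last exact: (measurableT_comp mh mD).
  apply/measurable_EFinP; apply: (@measurableT_comp _ _ _ _ _ _ (\1_`[0, a] : R -> R)) mD.
  exact: measurable_indic.
have k0 z : (0 <= k z)%E by rewrite mule_ge0// lee_fin.
transitivity (\int[P]_(w in walk_stays x N) k (walk x N w, xi N w))%E.
  rewrite [LHS]integral_mkcond [RHS]integral_mkcond; apply: eq_integral => w _.
  have wS : walk x N.+1 w = walk x N w + xi N w by rewrite /walk big_ord_recr/= addrA.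
  rewrite !patchE /k/= -wS indicE; case: ifPn => [|nst].
    rewrite inE => st; rewrite ifT; last by rewrite inE => j jN; apply: st; exact: leqW.
    by rewrite mem_set ?mul1e//=; rewrite in_itv; exact: st.
  case: ifPn => //; rewrite inE => st; rewrite memNset ?mul0e//= in_itv/= => sN.
  move: nst; rewrite notin_setE; apply => j; rewrite leq_eqVlt => /orP[/eqP ->//|].
  by rewrite ltnS => /st.
rewrite (@integral_indep _ _ _ P _ _ _ (measurableTypeR R) _ (measurable_walk_stays x N)
    _ (measurable_walk x N) (xi N) nu k (mxi N) _ mk k0); last first.
  move=> B C mB mC.
  pose H : set ('I_N -> R) := [set f | (forall j, (j <= N)%N -> 0 <= x + walk_sum f j <= a) /\
                                      B (x + walk_sum f N)].
  rewrite setIA (_ : walk_stays x N `&` walk x N @^-1` B = (fun w (i : 'I_N) => xi i w) @^-1` H).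
    apply: walk_past_indep => //.
    have mws j : measurable_fun [set: g_sigma_algebraType (@cylinders R 'I_N)]
        (fun f : g_sigma_algebraType (@cylinders R 'I_N) => x + walk_sum (f : 'I_N -> R) j).
      apply: measurable_funD => //; rewrite /walk_sum.
      apply: measurable_sum => i; case: (i < j)%N => //; exact: measurable_coord.
    rewrite (_ : H = (\bigcap_(j in `I_N.+1)
         [set f | 0 <= x + walk_sum f j <= a]) `&` [set f | B (x + walk_sum f N)]).
      apply: (@measurableI _ (g_sigma_algebraType (@cylinders R 'I_N))).
        apply: (@fin_bigcap_measurable _ (g_sigma_algebraType (@cylinders R 'I_N))) => // j _.
        have := mws j measurableT _ (measurable_itv `[0, a]); rewrite setTI.
        by congr measurable; apply/seteqP; split => w /=; rewrite in_itv.
      by have := mws N measurableT _ mB; rewrite setTI.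
    by apply/seteqP; split => f /= [h1 h2]; split => // j; exact: h1.
  apply/seteqP; split => w /=.
    by move=> [st Bw]; split; [move=> j jN; rewrite -walk_sumE//; exact: st|rewrite -walk_sumE].
  by move=> [h1 h2]; split; [move=> j jN; rewrite (walk_sumE _ _ jN); exact: h1|rewrite (walk_sumE _ _ (leqnn N))].
transitivity (\int[P]_(w in walk_stays x N) killed s a h (walk x N w))%E.
  apply: eq_integral => w _.
  rewrite (@ge0_integral_density _ _ _ mu nu (normal_pdf 0 s))//; last 3 first.
  - exact: measurable_normal_pdf.
  - by move=> y; exact: normal_pdf_ge0.
  - exact: (measurableT_comp mk (measurable_fun_pair _ _)).
  rewrite /killed (@ge0_integral_affine _ (walk x N w) 1)//; last 2 first.
  - apply: emeasurable_funM => //; apply/measurable_EFinP/measurable_funM.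
      exact: measurable_normal_pdf.
    exact: measurable_indic.
  - by move=> y; rewrite mule_ge0// lee_fin mulr_ge0// normal_pdf_ge0.
  rewrite normr1 mul1e; apply: eq_integral => y _.
  by rewrite /k /killed_density/= mul1r normal_pdf_shift// EFinM muleA.
rewrite /killed_iter iterSr; apply: IH => //.
- exact: measurable_killed.
- by move=> y; exact: killed_ge0.
Qed.

Lemma walk_stays_prob N x : 0 <= x <= a ->
  P (walk_stays x N) = killed_iter s a N (cst 1%E) x.
Proof.
move=> xa; rewrite -integral_walk//.
by rewrite integral_cst ?mul1e//; exact: measurable_walk_stays.
Qed.
End gaussian_walk.

(** * Range of a one-dimensional Brownian motion *)

Section paths.
Context {R : realType}.

(** Paths are continuous only within [0, +oo[; clamping the time makes them continuous on the line
    and keeps their values at nonnegative times. *)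
Lemma continuous_clamp (V : topologicalType) (f : R -> V) :
  {within `[0, +oo[, continuous f} -> continuous (fun u : R => f (maxr 0 u)).
Proof.
move=> cf u.
have Am (v : R) : `[0, +oo[%classic (maxr 0 v : R) by rewrite /= in_itv/= andbT le_max lexx.
have h : (fun x : R => maxr 0 x) x @[x --> u] --> (maxr 0 u : subspace `[0, +oo[%classic).
  apply/subspace_cvgP => //; first exact: fmap_filter.
  have cm : (fun x : R => maxr 0 x) x @[x --> u] --> (maxr 0 u : R).
    by apply: (@continuous_max _ _ (cst 0) id u); [exact: cst_continuous|exact: cvg_id].
  move=> B /= [e e0 eB].
  have [d d0 dB] := cm _ (nbhsx_ballx (maxr 0 u) _ e0).
  by exists d => // v /dB /eB; apply.
have c2 := cf (maxr 0 u : subspace `[0, +oo[%classic).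
exact: (@cvg_comp _ _ _ (fun x : R => maxr 0 x) f _ _ _ h c2).
Qed.

(** Each [s] is the limit of its dyadic approximations from below. This reduces a condition at all
    times to countably many, for measurability as well as for the passage from walk to path. *)
Lemma dyadic_closed (V : topologicalType) (g : R -> V) (C : set V) (t : R) : 0 <= t ->
  continuous g -> closed C ->
  (forall k j, (j <= 2 ^ k)%N -> C (g (j%:R * (t / (2 ^ k)%:R)))) ->
  forall s : R, 0 <= s <= t -> C (g s).
Proof.
move=> t0 cg cC gC s /andP[s0 st].
have [t_gt0|t_le0] := ltP 0 t; last first.
  rewrite (_ : s = 0%:R * (t / (2 ^ 0)%:R)); first exact: gC.
  by rewrite mul0r; apply/eqP; rewrite eq_le s0 (le_trans st).
pose h k : R := t / (2 ^ k)%:R.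
have h0 k : 0 < h k by rewrite divr_gt0// ltr0n expn_gt0.
pose j k := Num.truncn (s / h k).
have js k : (j k)%:R * h k <= s < (j k)%:R * h k + h k.
  have := truncn_itv (divr_ge0 s0 (ltW (h0 k))).
  rewrite -/(j k) ler_pdivlMr// ltr_pdivrMr// => /andP[-> /=].
  by rewrite -natr1 mulrDl mul1r.
have jle k : (j k <= 2 ^ k)%N.
  rewrite -(ler_nat R) -(ler_pM2r (h0 k)) (le_trans (proj1 (andP (js k))))//.
  by rewrite /h mulrC divfK// pnatr_eq0 -lt0n expn_gt0.
have hcv : h k @[k --> \oo] --> 0.
  rewrite (_ : h = geometric t (2^-1)).
    by apply: cvg_geometric; rewrite ger0_norm//; lra.
  by apply/funext => k; rewrite /h /geometric/= natrX exprVn.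
have ucv : (j k)%:R * h k @[k --> \oo] --> s.
  apply: (@squeeze_cvgr _ _ _ _ (fun k => s - h k) (cst s)).
  - by apply: nearW => k; case/andP: (js k) => -> /ltW; rewrite lerBlDr andbT.
  - by rewrite -[X in _ --> X]subr0; apply: cvgB => //; exact: cvg_cst.
  - exact: cvg_cst.
apply: (@closed_cvg _ _ \oo _ (fun k => g ((j k)%:R * h k)) C cC).
  by apply: nearW => k; exact: gC.
exact: (@cvg_comp _ _ _ _ g _ _ _ ucv (cg s)).
Qed.

Definition running_max (g : R -> R) (t : R) : R := sup [set g s | s in `[0, t]].

Section running_max.
Variables (g : R -> R) (t : R).
Hypotheses (cg : continuous g) (t0 : 0 <= t).

Lemma running_max_attained : exists2 c, 0 <= c <= t &
  running_max g t = g c /\ forall s, 0 <= s <= t -> g s <= g c.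
Proof.
have [c /[!in_itv]/= c0t cmax] := EVT_max t0 (continuous_subspaceT cg).
exists c => //.
have cm s : 0 <= s <= t -> g s <= g c by move=> st; apply: cmax; rewrite in_itv.
split=> //; apply/eqP; rewrite eq_le; apply/andP; split.
  apply: ge_sup; first by exists (g c); exists c => //=; rewrite in_itv.
  by move=> _ [s /= + <-]; rewrite in_itv/= => /cm.
apply: ub_le_sup.
  by exists (g c) => _ [s /= + <-]; rewrite in_itv/= => /cm.
by exists c => //=; rewrite in_itv.
Qed.

Lemma running_max_le u : (running_max g t <= u) <-> (forall s, 0 <= s <= t -> g s <= u).
Proof.
have [c ct [-> cm]] := running_max_attained.
by split=> [gu s /cm /le_trans|]; [apply|exact].
Qed.

Lemma running_max_ge s : 0 <= s <= t -> g s <= running_max g t.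
Proof. by apply/(running_max_le _).1. Qed.
End running_max.

(** The strict inequality comes from openness: a path in [D] at time t remains there up to some t +
    d, which bounds the infimum from below. *)
Lemma exit_time_gtP n (D : set 'rV[R]_n) (W : R -> 'rV[R]_n) (t : R) : open D ->
  {within `[0, +oo[, continuous W} -> 0 <= t ->
  (t%:E < exit_time D W)%E <-> (forall s, 0 <= s <= t -> D (W s)).
Proof.
move=> oD cW t0; split=> [tD s /andP[s0 st]|H].
  apply: contrapT => nD; move: tD; apply/negP; rewrite -leNgt.
  apply: ge_ereal_inf; exists s%:E; last by rewrite lee_fin.
  by exists s.
have Dt : D (W (maxr 0 t)) by rewrite max_r//; apply: H; rewrite t0 lexx.
have [d /= d0 dD] := continuous_clamp cW (open_nbhs_nbhs (conj oD Dt)).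
apply: (@lt_le_trans _ _ (t + d)%:E); first by rewrite lte_fin ltrDl.
apply: le_ereal_inf_tmp => _ [s [s0 nD] <-]; rewrite lee_fin leNgt; apply/negP => std.
apply: nD; have [st|ts] := leP s t; first by apply: H; rewrite s0.
have /= := dD s; rewrite max_r//; apply; rewrite /= distrC.
by rewrite ger0_norm; lra.
Qed.
End paths.

Section process_sigma_algebra.
Context {R : realType} d (T : measurableType d) (P : probability T R) (m : nat).

Definition proc_gen (X : R -> T -> 'rV[R]_m) := [set E | exists t (i : 'I_m) (A : set R),
          [/\ 0 <= t, measurable A & E = (fun w => X t w 0 i) @^-1` A]].

Lemma proc_sigma_measurable (X : R -> T -> 'rV[R]_m) (E : set T) : brownian_motion P X -> proc_sigma X E -> measurable E.
Proof.
move=> [mX _ _ _]; move: E; apply: smallest_sub; first exact: sigma_algebra_measurable.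
move=> _ [s [i [A [s0 mA ->]]]].
by have := mX s i s0 measurableT A mA; rewrite setTI.
Qed.
End process_sigma_algebra.

Section brownian_range.
Context {R : realType} d (T : measurableType d) (P : probability T R).
Notation mu := (@lebesgue_measure R).
Variables (Y : R -> T -> 'rV[R]_1) (bmY : brownian_motion P Y).

Definition coord_path (s : R) (w : T) : R := Y (maxr 0 s) w 0 0.
Local Notation y := coord_path.

Definition rise (t : R) (w : T) : R := running_max (y^~ w) t.
Definition fall (t : R) (w : T) : R := running_max (fun s => - y s w) t.
(** With u = a - v this is the event that v + Y stays in [0, a] up to time t. *)
Definition confined (t u v : R) : set T := [set w | rise t w <= u /\ fall t w <= v].

Lemma coord_path_continuous w : continuous (y^~ w).
Proof.
have [_ _ cY _] := bmY.
move=> s; apply: (@continuous_comp _ _ _ (fun u : R => Y (maxr 0 u) w) (fun M : 'rV[R]_1 => M 0 0)).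
  exact: (continuous_clamp (cY w)).
exact: coord_continuous.
Qed.

Lemma coord_path_opp_continuous w : continuous (fun s => - y s w).
Proof. by move=> s; apply: continuousN; exact: coord_path_continuous. Qed.

Lemma coord_path0 w : y 0 w = 0.
Proof. by have [_ Y0 _ _] := bmY; rewrite /y maxxx Y0 mxE. Qed.

Lemma coord_pathE s w : 0 <= s -> y s w = Y s w 0 0.
Proof. by move=> s0; rewrite /y max_r. Qed.

Lemma confinedP t u v w : 0 <= t ->
  confined t u v w <-> (forall s, 0 <= s <= t -> - v <= y s w <= u).
Proof.
move=> t0; have cy := @coord_path_continuous w; have cNy := @coord_path_opp_continuous w.
split=> [[/(running_max_le cy t0) h1 /(running_max_le cNy t0) h2] s st|h].
  by rewrite h1// andbT lerNl h2.
split; [apply/(running_max_le cy t0) => s /h /andP[]//|].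
by apply/(running_max_le cNy t0) => s /h /andP[]; rewrite lerNl.
Qed.

Lemma rise_ge0 t w : 0 <= t -> 0 <= rise t w.
Proof.
move=> t0; rewrite -(coord_path0 w); apply: (running_max_ge (@coord_path_continuous w) t0).
by rewrite lexx t0.
Qed.

Lemma fall_ge0 t w : 0 <= t -> 0 <= fall t w.
Proof.
move=> t0; rewrite -oppr0 -(coord_path0 w).
apply: (running_max_ge (@coord_path_opp_continuous w) t0).
by rewrite lexx t0.
Qed.

(** The sample space with the sigma-algebra generated by [Y] alone: independence from the other two
    motions requires the rise and the fall to be measurable there. *)
Local Notation TY := (g_sigma_algebraType (proc_gen Y)).

Lemma measurable_coord_path s : measurable_fun [set: TY] (y s : TY -> R).
Proof.
move=> _ B mB; rewrite setTI; apply: sub_sigma_algebra.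
by exists (maxr 0 s), 0, B; split => //; rewrite le_max lexx.
Qed.

Let measurable_running_max (g : R -> TY -> R) t : 0 <= t ->
  (forall w, continuous (g^~ w)) -> (forall s, measurable_fun setT (g s)) ->
  measurable_fun [set: TY] (fun w => running_max (g^~ w) t).
Proof.
move=> t0 cg mg; apply: (measurability _ (RGenOInfty.measurableE R)) => //.
move=> _ [_ [u ->] <-]; rewrite setTI.
rewrite (_ : _ @^-1` _ = ~` (\bigcap_k \bigcap_(j in `I_(2 ^ k).+1)
   [set w | g (j%:R * (t / (2 ^ k)%:R)) w <= u])).
  apply: measurableC; apply: bigcap_measurable => [|k _]; first by exists 0%N.
  apply: fin_bigcap_measurable => // j _.
  by apply: measurable_sublevel; exact: mg.
apply/seteqP; split => w /=.
  rewrite in_itv/= andbT => ug H; move: ug; apply/negP; rewrite -leNgt.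
  apply/(running_max_le (cg w) t0) => s st.
  apply: (@dyadic_closed _ _ (g^~ w) [set z | z <= u] t t0 (cg w) (@closed_le _ u) _ s st).
  by move=> k j jk; apply: (H k) => //=; rewrite ltnS.
move=> H; rewrite in_itv/= andbT ltNge; apply/negP => /(running_max_le (cg w) t0) gu.
apply: H => k _ j /= jk; apply: gu.
have p : (0 : R) < (2 ^ k)%:R by rewrite ltr0n expn_gt0.
apply/andP; split; first by rewrite mulr_ge0// divr_ge0// ltW.
rewrite mulrCA ler_piMr//.
by rewrite ler_pdivrMr// mul1r ler_nat -ltnS.
Qed.

Lemma measurable_rise t : 0 <= t -> measurable_fun [set: TY] (rise t : TY -> R).
Proof.
move=> t0; apply: measurable_running_max => //.
- exact: coord_path_continuous.
- exact: measurable_coord_path.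
Qed.

Lemma measurable_fall t : 0 <= t -> measurable_fun [set: TY] (fall t : TY -> R).
Proof.
move=> t0; apply: (@measurable_running_max (fun s w => - y s w)) => //.
- exact: coord_path_opp_continuous.
- by move=> s; apply: measurableT_comp => //; exact: measurable_coord_path.
Qed.

Lemma measurable_rise_fall t : 0 <= t ->
  measurable_fun setT (rise t) /\ measurable_fun setT (fall t).
Proof.
move=> t0; split=> _ B mB; apply: (proc_sigma_measurable bmY).
  exact: measurable_rise.
exact: measurable_fall.
Qed.

Lemma measurable_confined t u v : 0 <= t -> measurable (confined t u v).
Proof.
move=> t0; have [m1 m2] := measurable_rise_fall t0.
by apply: (@measurableI _ _ [set w | rise t w <= u]); exact: measurable_sublevel.
Qed.

Section grid.
Variables (t : R) (t_gt0 : 0 < t) (N : nat) (N_gt0 : (0 < N)%N).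
Let dt : R := t / N%:R.
Let dt_gt0 : 0 < dt. Proof. by rewrite divr_gt0// ltr0n. Qed.

Definition increment (j : nat) (w : T) : R := y (j.+1%:R * dt) w - y (j%:R * dt) w.

Lemma measurable_increment j : measurable_fun setT (increment j).
Proof.
have my s : measurable_fun setT (y s).
  by move=> _ B mB; apply: (proc_sigma_measurable bmY); exact: measurable_coord_path.
exact: measurable_funB.
Qed.

Lemma increment_law k (A : nat -> set R) : (forall j, measurable (A j)) ->
  P [set w | forall j, (j < k)%N -> A j (increment j w)] =
  (\prod_(j < k) fine (normal_prob 0 (mesh t N) (A j)))%:E.
Proof.
move=> mA; have [_ _ _ lawY] := bmY.
have dt0 j : 0 <= j%:R * dt by rewrite mulr_ge0// ltW.
have := lawY k (fun j => j%:R * dt) (fun j _ => A j) (dt0 0%N) _ (fun j _ => mA j).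
rewrite (_ : \bigcap_(j in `I_k) _ = [set w | forall j, (j < k)%N -> A j (increment j w)]).
  move=> ->; last by move=> j _; rewrite ltr_pM2r// ltr_nat.
  have dE (j : nat) : j.+1%:R * dt - j%:R * dt = t / N%:R.
    by rewrite -natr1 mulrDl mul1r addrAC subrr add0r.
  by congr EFin; apply: eq_bigr => j _; rewrite big_ord1 dE.
apply/seteqP; split => w /= h j jk.
  by have := h j jk 0 I; rewrite /increment !coord_pathE.
by move=> i _ /=; have := h j jk; rewrite /increment !coord_pathE// (ord1 i).
Qed.

Lemma walk_incrementE x j w : walk increment x j w = x + y (j%:R * dt) w.
Proof.
rewrite /walk; congr (_ + _); elim: j => [|j IH].
  by rewrite big_ord0 mul0r coord_path0.
by rewrite big_ord_recr/= IH /increment addrC subrK.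
Qed.

Lemma walk_stays_grid a x : 0 <= x <= a -> P (walk_stays a increment x N) =
  killed_iter (mesh t N) a N (cst 1%E) x.
Proof.
apply: walk_stays_prob.
- by rewrite sqrtr_gt0.
- exact: measurable_increment.
- exact: increment_law.
Qed.

Lemma confined_sub_grid a v : confined t (a - v) v `<=` walk_stays a increment v N.
Proof.
move=> w /(confinedP _ _ _ (ltW t_gt0)) h j jN.
have /h : 0 <= j%:R * dt <= t.
  apply/andP; split; first by rewrite mulr_ge0// ltW.
  rewrite /dt mulrCA ler_piMr ?(ltW t_gt0)//.
  by rewrite ler_pdivrMr ?ltr0n// mul1r ler_nat.
by rewrite walk_incrementE; lra.
Qed.

Lemma confined_le_grid a v : 0 <= v <= a ->
  (P (confined t (a - v) v) <= killed_iter (mesh t N) a N (cst 1%E) v)%E.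
Proof.
move=> va; rewrite -walk_stays_grid//; apply: le_measure; rewrite ?inE.
- by apply: measurable_confined; exact: ltW.
- apply: measurable_walk_stays; exact: measurable_increment.
- exact: confined_sub_grid.
Qed.
End grid.
End brownian_range.

(** * Confinement probabilities, from grid to path *)

Section confined_bounds.
Context {R : realType} d (T : measurableType d) (P : probability T R).
Notation mu := (@lebesgue_measure R).
Variables (Y : R -> T -> 'rV[R]_1) (bmY : brownian_motion P Y).
Variables (t : R) (t_gt0 : 0 < t).
Let t0 : 0 <= t. Proof. exact: ltW. Qed.
Notation confined := (confined Y t).

Definition decay (a : R) : R := expR (- ((pi / a) ^+ 2 * t) / 2).

Let confined_le1 u v : (P (confined u v) <= 1)%E.
Proof. by apply: probability_le1; exact: (measurable_confined bmY). Qed.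

(** Dyadic grids are nested, so the grid events decrease to confinement of the whole path, and
    [walk_lower] passes to the limit along N = 2^k. *)
Lemma confined_lower a v : 0 < a -> 0 <= v <= a ->
  ((decay a * sin (pi / a * v))%:E <= P (confined (a - v) v))%E.
Proof.
move=> a0 va.
pose F k : set T := [set w | forall j, (j <= 2 ^ k)%N ->
  0 <= v + coord_path Y (j%:R * (t / (2 ^ k)%:R)) w <= a].
have N0 k : (0 < 2 ^ k)%N by rewrite expn_gt0.
have FE k : F k = walk_stays a (increment Y t (2 ^ k)) v (2 ^ k).
  by apply/seteqP; split => w /= h j /h; rewrite (walk_incrementE bmY).
have mF k : measurable (F k).
  rewrite FE; apply: measurable_walk_stays; exact: (measurable_increment bmY).
have Fcap : \bigcap_k F k = confined (a - v) v.
  apply/seteqP; split => w.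
    move=> h; apply/(confinedP bmY _ _ _ t0) => s st.
    have cg : continuous (fun s => v + coord_path Y s w).
      move=> r; apply: cvgD; first exact: cvg_cst.
      exact: (coord_path_continuous bmY).
    have cC : closed [set z : R | 0 <= z <= a].
      rewrite (_ : [set z | _] = `[0, a]%classic); first exact: interval_closed.
      by apply/seteqP; split => z /=; rewrite in_itv.
    have := @dyadic_closed _ _ _ _ t t0 cg cC (fun k j => h k I j) s st.
    by move=> /= /andP[? ?]; apply/andP; split; lra.
  move=> h k _; rewrite FE; exact: (confined_sub_grid bmY t_gt0 (N0 k) h).
have FS k : F k.+1 `<=` F k.
  move=> w h j jk; have := h (2 * j)%N.
  rewrite expnS leq_pmul2l// => /(_ jk).
  rewrite (_ : (2 * j)%:R * _ = j%:R * (t / (2 ^ k)%:R))//.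
  by rewrite !natrM; field; rewrite pnatr_eq0 -lt0n N0.
have cvF : P (F k) @[k --> \oo] --> P (confined (a - v) v).
  rewrite -Fcap; apply: nonincreasing_cvg_mu => //.
  - by rewrite (le_lt_trans (probability_le1 _ _))// ltry.
  - exact: bigcap_measurable.
  - by apply/nonincreasing_seqP => k; apply/subsetPset; exact: FS.
have [C HC] := walk_lower a0 t_gt0.
have cvC : ((C / (2 ^ k)%:R)%:E : \bar R) @[k --> \oo] --> 0%E.
  apply/cvg_EFin; first by near=> k.
  rewrite (_ : _ \o _ = geometric C (2^-1)).
    by apply: cvg_geometric; rewrite ger0_norm//; lra.
  by apply/funext => k; rewrite /geometric/= natrX exprVn.
have cvFC : (P (F k) + (C / (2 ^ k)%:R)%:E)%E @[k --> \oo] --> P (confined (a - v) v).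
  rewrite -[X in _ --> X]adde0; apply: cvgeD => //.
  by rewrite fin_num_adde_defl.
apply: (cvge_to_ge cvFC); near=> k.
rewrite FE (walk_stays_grid bmY t_gt0 (N0 k))//; apply: HC => //.
apply: (@le_trans _ _ k%:R); first by near: k; exact: nbhs_infty_ger.
by rewrite ler_nat ltnW// ltn_expl.
Unshelve. all: by end_near. Qed.

(** The event is a section of a measurable subset of the product, so its probability depends
    measurably on the two levels, as Tonelli requires. *)
Lemma measurable_confined_prob : measurable_fun setT (fun z : R * R => P (confined z.1 z.2)).
Proof.
have [mr mf] := measurable_rise_fall bmY t0.
pose A : set ((R * R) * T) := [set z | rise Y t z.2 <= z.1.1 /\ fall Y t z.2 <= z.1.2].
have mA : measurable A.
  rewrite (_ : A = ((fun z : (R * R) * T => rise Y t z.2 <= z.1.1) @^-1` [set true]) `&`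
                   ((fun z : (R * R) * T => fall Y t z.2 <= z.1.2) @^-1` [set true])).
    apply: measurableI; rewrite -[X in measurable X]setTI.
    - apply: (measurable_fun_ler (D := setT)) => //; first exact: measurableT_comp.
      by apply: measurableT_comp => //; exact: measurableT_comp.
    - apply: (measurable_fun_ler (D := setT)) => //; first exact: measurableT_comp.
      by apply: measurableT_comp => //; exact: measurableT_comp.
  by apply/seteqP; split => z /=.
rewrite (_ : (fun z => _) = P \o xsection A); first exact: measurable_fun_xsection.
apply/funext => -[u v] /=; congr (P _).
by apply/seteqP; split => w; rewrite /xsection/= inE.
Qed.

Lemma measurable_confined_prob_slice a :
  measurable_fun setT (fun v : R => P (confined (a - v) v)).
Proof.
apply: (@measurableT_comp _ _ _ _ _ _ _ _ (fun v : R => (a - v, v)) measurable_confined_prob).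
by apply: measurable_fun_pair => //; exact: measurable_funB.
Qed.

Lemma confined_out a v : ~~ (0 <= v <= a) -> P (confined (a - v) v) = 0%E.
Proof.
move=> va; rewrite (_ : confined _ _ = set0) ?measure0//.
apply/seteqP; split => // w [r f]; move: va.
have := rise_ge0 bmY w t0; have := fall_ge0 bmY w t0.
by move=> f0 r0; apply/negP; rewrite negbK; apply/andP; split; lra.
Qed.

Let confined_indic a v :
  P (confined (a - v) v) = ((\1_`[0, a] v)%:E * P (confined (a - v) v))%E.
Proof.
rewrite indicE; case: (boolP (0 <= v <= a)) => va.
  by rewrite mem_set ?mul1e//= in_itv.
by rewrite confined_out// mule0.
Qed.

Let mind a : measurable_fun setT (fun x : R => (\1_`[0, a] x : R)%:E).
Proof. by apply/measurable_EFinP; exact: measurable_indic. Qed.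

(** A path confined at all times is confined on every grid. First N tends to infinity with the
    margin [e] fixed, then [e] tends to 0. *)
Lemma confined_int_le a : 0 < a ->
  (\int[mu]_v P (confined (a - v) v) <= (decay a * a)%:E)%E.
Proof.
move=> a0.
have step e : 0 < e -> (\int[mu]_v P (confined (a - v) v) <=
    (expR (- ((pi / (a + 2 * e)) ^+ 2 * t) / 2) * a)%:E)%E.
  move=> e0; have [C HC] := walk_upper a0 t_gt0 e0.
  pose m := pi / (a + 2 * e).
  apply: (@lee_expR_div _ _ _ C a (Num.truncn (m ^+ 2 * t)).+1) => [|N HN]; first exact: ltW.
  have N0 : (0 < N)%N by apply: leq_trans HN.
  have mN : m ^+ 2 * t <= N%:R.
    rewrite ltW//; apply: lt_le_trans (_ : (Num.truncn (m ^+ 2 * t)).+1%:R <= _); last by rewrite ler_nat.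
    by case/andP: (truncn_itv (mulr_ge0 (sqr_ge0 m) t0)).
  apply: le_trans (HC N N0 mN).1.
  under eq_integral do rewrite confined_indic.
  apply: ge0_le_integral => //.
  - by move=> v _; rewrite mule_ge0// lee_fin.
  - by apply: emeasurable_funM; [exact: mind|exact: measurable_confined_prob_slice].
  - apply: emeasurable_funM; [exact: mind|apply: measurable_killed_iter => //].
    by rewrite sqrtr_gt0 divr_gt0// ltr0n.
  - move=> v _; rewrite indicE; case: (boolP (v \in _)) => [|_]; last by rewrite !mul0e.
    by rewrite inE/= in_itv/= !mul1e => va; exact: (confined_le_grid bmY t_gt0 N0).
have cv : ((expR (- ((pi / (a + 2 * e)) ^+ 2 * t) / 2) * a)%:E : \bar R) @[e --> 0^'+] --> (decay a * a)%:E.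
  apply/cvg_EFin; first by near=> e.
  have -> : decay a = expR (- ((pi / (a + 2 * 0)) ^+ 2 * t) / 2) by rewrite mulr0 addr0.
  apply: cvg_at_right_filter; apply: cvgMl.
  apply: (@continuous_cvg _ _ _ _ _ _ expR); first exact: continuous_expR.
  apply: cvgMl; apply: cvgN; apply: cvgMl.
  have c1 : pi / (a + 2 * e) @[e --> (0 : R)] --> pi / (a + 2 * 0).
    apply: cvgM; first exact: cvg_cst.
    apply: cvgV; first by rewrite mulr0 addr0 gt_eqF.
    apply: cvgD; first exact: cvg_cst.
    by apply: cvgM; [exact: cvg_cst|exact: cvg_id].
  exact: (cvgM c1 c1).
apply: (cvge_to_ge cv); near=> e; apply: step; near: e; exact: nbhs_right_gt.
Unshelve. all: by end_near. Qed.

Lemma confined_int_le0 a : a <= 0 -> (\int[mu]_v P (confined (a - v) v) = 0)%E.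
Proof.
move=> a0; apply/eqP; rewrite eq_le integral_ge0// andbT.
rewrite [leRHS](_ : _ = \int[mu]_v (\1_`[0, a] v)%:E)%E; last first.
  rewrite integral_indic//= setIT lebesgue_measure_itv/= lte_fin ltNge a0//.
under eq_integral do rewrite confined_indic.
apply: ge0_le_integral => //.
- by move=> v _; rewrite mule_ge0// lee_fin.
- by apply: emeasurable_funM; [exact: mind|exact: measurable_confined_prob_slice].
- exact: mind.
- by move=> v _; rewrite -[leRHS]mule1 lee_wpmul2l// lee_fin.
Qed.

(** Integrates the sine subsolution; 2 a / pi is the integral of sin (pi v / a) over [0, a]. *)
Lemma confined_int_ge a : 0 < a ->
  ((decay a * (2 / pi * a))%:E <= \int[mu]_v P (confined (a - v) v))%E.
Proof.
move=> a0; have pi0 := pi_gt0 R.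
have int_sin : (\int[mu]_(v in `[0%R, a]) (sin (pi / a * v))%:E = (2 / pi * a)%:E)%E.
  have D (v : R) : is_derive v (1 : R) (fun v : R => - (a / pi) * cos (pi / a * v)) (sin (pi / a * v)).
    apply: is_derive_eq; rewrite /GRing.scale/= mulr1 !mulNr mulrN opprK mulrCA.
    have -> : a / pi * (pi / a) = 1 by rewrite mulrA divfK ?divff// gt_eqF.
    by rewrite mulr1.
  rewrite (@continuous_FTC2 _ _ (fun v => - (a / pi) * cos (pi / a * v)) 0 a)//.
  - rewrite mulr0 cos0 divfK ?gt_eqF// cospi -EFinB; congr EFin.
    by ring.
  - apply: continuous_subspaceT => v.
    apply: (@continuous_comp _ _ _ (fun v : R => pi / a * v) sin); last exact: continuous_sin.
    by apply: continuousM; [exact: cst_continuous|exact: cvg_id].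
  - have cc : continuous (fun v : R => - (a / pi) * cos (pi / a * v)).
      by move=> v; apply/differentiable_continuous/derivable1_diffP; exact: ex_derive.
    split; [by move=> v _; exact: ex_derive|..].
      by apply: cvg_at_right_filter; exact: cc.
    by apply: cvg_at_left_filter; exact: cc.
  - by move=> v _; rewrite derive1E; apply: derive_val.
have pa0 : 0 < pi / a by rewrite divr_gt0.
have sge v : 0 <= v <= a -> 0 <= sin (pi / a * v).
  move=> /andP[v0 va]; rewrite sin_ge0_pi// pmulr_rge0// v0/= mulrAC ler_pdivrMr//.
  by rewrite ler_pM2l.
have ms : measurable_fun `[0, a] (fun v : R => (sin (pi / a * v))%:E).
  apply/measurable_EFinP/measurable_funTS.
  apply: measurableT_comp; first exact: continuous_measurable_fun (@continuous_sin R).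
  exact: measurable_funM.
rewrite EFinM -int_sin -ge0_integralZl//; last first.
  by rewrite lee_fin expR_ge0.
rewrite integral_mkcond; apply: ge0_le_integral => //.
- move=> v _; rewrite patchE; case: ifPn => //; rewrite inE/= in_itv/= => va.
  by rewrite mule_ge0// lee_fin ?expR_ge0 ?sge.
- by apply/(measurable_restrictT _ _).1 => //; apply: emeasurable_funM.
- exact: measurable_confined_prob_slice.
- move=> v _; rewrite patchE; case: ifPn => [|_]; last exact: measure_ge0.
  rewrite inE/= in_itv/= => va; by rewrite -EFinM confined_lower.
Qed.

(** The walk starts at distance M from an end of [0, a + M]. With margin e = M the arch has length a
    + 3 M, and at the start its ratio to its value at the ends is sin (2 m M) / sin (m M) = 2 cos (m
    M) <= 2. The bound has no factor [a]: this is the power gained on edge terms. *)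
Lemma confined_edge M x : 0 < M -> forall a, 0 <= a -> (x = M) \/ (x = a) ->
  (P (confined (a + M - x) x) <= (decay (a + 3 * M) * 2)%:E)%E.
Proof.
move=> M0 a a0 xE; have pi0 := pi_gt0 R.
have aM : 0 < a + M by lra.
have [C HC] := walk_upper aM t_gt0 M0.
have E3 : a + M + 2 * M = a + 3 * M by ring.
set m := pi / (a + M + 2 * M) in HC.
have m0 : 0 < m by rewrite divr_gt0// E3; lra.
have mpi : m * (a + 3 * M) = pi by rewrite /m E3 divfK// gt_eqF//; lra.
have xa : 0 <= x <= a + M by case: xE => ->; apply/andP; split; lra.
have s0 : 0 < sin (m * M).
  by rewrite sin_gt0_pi// mulr_gt0//= -mpi ltr_pM2l//; lra.
have ratio : sin (m * x + m * M) / sin (m * M) <= 2.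
  have -> : sin (m * x + m * M) = sin (m * M + m * M).
    case: xE => -> //; rewrite (_ : m * a + m * M = pi - (m * M + m * M)); last first.
      by rewrite -mpi; ring.
    by rewrite sinB sinpi cospi; ring.
  rewrite sinD ler_pdivrMr//; have := cos_le1 (m * M); nra.
apply: (@lee_expR_div _ _ _ C 2 (Num.truncn (m ^+ 2 * t)).+1) => // N HN.
have N0 : (0 < N)%N by apply: leq_trans HN.
have mN : m ^+ 2 * t <= N%:R.
  rewrite ltW//; apply: lt_le_trans (_ : (Num.truncn (m ^+ 2 * t)).+1%:R <= _); last by rewrite ler_nat.
  by case/andP: (truncn_itv (mulr_ge0 (sqr_ge0 m) t0)).
apply: le_trans (confined_le_grid bmY t_gt0 N0 xa) _.
apply: le_trans ((HC N N0 mN).2 x xa) _.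
by rewrite -E3 -/m lee_fin ler_wpM2l ?expR_ge0.
Qed.
End confined_bounds.

(** * Exponential functional of the range *)

Section exponential_range.
Context {R : realType}.
Notation mu := (@lebesgue_measure R).

Lemma measurable_inv : measurable_fun setT (fun x : R => x^-1).
Proof.
rewrite (_ : (fun x => _) = (fun x : R => x * (x ^+ 2) `^ (- 1))).
  apply: measurable_funM => //.
  apply: (@measurableT_comp _ _ _ _ _ _ (fun y : R => y `^ (- 1))); first exact: measurable_powR.
  exact: measurable_funX.
apply/funext => x; rewrite powR_inv1 ?sqr_ge0//.
have [->|x0] := eqVneq x 0; first by rewrite invr0 mul0r.
by rewrite expr2 invfM mulrA divff// mul1r.
Qed.

Lemma measurable_decay t : measurable_fun setT (@decay R t).
Proof.
apply: measurableT_comp => //; apply: measurable_funM => //.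
apply: measurableT_comp => //; apply: measurable_funM => //.
apply: measurable_funX; apply: measurable_funM => //; exact: measurable_inv.
Qed.

Definition step_ge0 (x : R) : R := \1_`[0, +oo[ x.

Lemma step_ge0E x : step_ge0 x = (0 <= x)%R%:R.
Proof.
rewrite /step_ge0 indicE; congr (nat_of_bool _)%:R.
by apply/idP/idP => [|x0]; [rewrite inE/= in_itv/= andbT|rewrite inE/= in_itv/= x0].
Qed.

Lemma measurable_step : measurable_fun setT step_ge0.
Proof. exact: measurable_indic. Qed.

Lemma step_nneg x : 0 <= step_ge0 x.
Proof. by rewrite step_ge0E. Qed.

Section tail.
Variables (lam : R) (lam_gt0 : 0 < lam).

Lemma measurable_exp_weight : measurable_fun setT (fun a : R => expR (- lam * a)).
Proof. by apply: measurableT_comp => //; exact: measurable_funM. Qed.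

(** Read from right to left, it writes exp (- lam c) as a mixture of the thresholds c <= a, for [c]
    of either sign. *)
Lemma exp_tail (c : R) :
  (\int[mu]_a (lam * expR (- lam * a) * step_ge0 (a - c))%:E = (expR (- lam * c))%:E)%E.
Proof.
rewrite (@ge0_integral_affine _ c 1) ?oner_neq0//; last 2 first.
- apply/measurable_EFinP; apply: measurable_funM.
    by apply: measurable_funM => //; exact: measurable_exp_weight.
  by apply: (measurableT_comp measurable_step); exact: measurable_funB.
- by move=> a; rewrite lee_fin !mulr_ge0 ?expR_ge0 ?step_nneg// ltW.
rewrite normr1 mul1e.
transitivity (\int[mu]_a ((expR (- lam * c))%:E * (exponential_pdf lam a)%:E))%E.
  apply: eq_integral => a _; rewrite -EFinM; congr EFin.
  rewrite mul1r addrAC subrr add0r mulrDr expRD step_ge0E.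
  have [a0|a0] := leP 0 a; first by rewrite exponential_pdfE//=; ring.
  by rewrite lt0_exponential_pdf// !mulr0.
rewrite ge0_integralZl//.
- by rewrite integral_exponential_pdf// mule1.
- by apply/measurable_EFinP; exact: measurable_exponential_pdf.
- by move=> a _; rewrite lee_fin exponential_pdf_ge0// ltW.
Qed.

(** The exponent k = 1 gives the main term and k = 0 the edge terms. The indicator discards a = 0,
    where pi / a takes its default value and [decay] would be 1. *)
Definition laplace_fun (k : nat) (t a : R) : R :=
  \1_`]0, +oo[ a * (a ^+ k * expR (- lam * a) * decay t a).

Definition laplace_int (k : nat) (t : R) : \bar R := (\int[mu]_a (laplace_fun k t a)%:E)%E.

Lemma laplace_fun_ge0 k t a : 0 <= laplace_fun k t a.
Proof.
rewrite /laplace_fun indicE; case: (boolP (a \in _)) => [|_]; last by rewrite mul0r.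
by rewrite inE/= in_itv/= andbT => a0; rewrite mul1r !mulr_ge0 ?expR_ge0// exprn_ge0// ltW.
Qed.

Lemma measurable_laplace_fun k t : measurable_fun setT (laplace_fun k t).
Proof.
apply: measurable_funM; first exact: measurable_indic.
apply: measurable_funM; last exact: measurable_decay.
by apply: measurable_funM; [exact: measurable_funX|exact: measurable_exp_weight].
Qed.

Section range.
Context d (T : measurableType d) (P : probability T R).
Variables (Y : R -> T -> 'rV[R]_1) (bmY : brownian_motion P Y).
Variables (t : R) (t_gt0 : 0 < t).
Let t0 : 0 <= t. Proof. exact: ltW. Qed.
Local Notation S := (rise Y t).
Local Notation I := (fall Y t).

Let mS : measurable_fun setT S. Proof. by case: (measurable_rise_fall bmY t0). Qed.
Let mI : measurable_fun setT I. Proof. by case: (measurable_rise_fall bmY t0). Qed.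

Definition range_exp : \bar R := (\int[P]_w (expR (- lam * (S w + I w)))%:E)%E.

Let F (z : T * (R * R)) : R :=
  lam * step_ge0 (z.2.1 - I z.1) * (lam * expR (- lam * z.2.2) * step_ge0 (z.2.2 - (z.2.1 + S z.1))).

Let F0 z : 0 <= F z.
Proof. by rewrite /F !mulr_ge0 ?step_nneg ?expR_ge0// ltW. Qed.

Let mF : measurable_fun setT F.
Proof.
have m21 : measurable_fun setT (fun z : T * (R * R) => z.2.1) by exact: measurableT_comp.
have m22 : measurable_fun setT (fun z : T * (R * R) => z.2.2) by exact: measurableT_comp.
have m1S : measurable_fun setT (fun z : T * (R * R) => S z.1) by exact: measurableT_comp.
have m1I : measurable_fun setT (fun z : T * (R * R) => I z.1) by exact: measurableT_comp.
apply: measurable_funM.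
  apply: measurable_funM => //; apply: (measurableT_comp measurable_step).
  exact: measurable_funB.
apply: measurable_funM.
  by apply: measurable_funM => //; apply: (measurableT_comp measurable_exp_weight).
apply: (measurableT_comp measurable_step); apply: measurable_funB => //.
exact: measurable_funD.
Qed.

Let f1 (z : T * R) : R := lam * step_ge0 (z.2 - I z.1) * expR (- lam * (z.2 + S z.1)).

Let f1E w v : (\int[mu]_a (F (w, (v, a)))%:E = (f1 (w, v))%:E)%E.
Proof.
transitivity (\int[mu]_a ((lam * step_ge0 (v - I w))%:E *
   (lam * expR (- lam * a) * step_ge0 (a - (v + S w)))%:E))%E.
  by apply: eq_integral => a _; rewrite -EFinM.
rewrite ge0_integralZl//.
- by rewrite exp_tail -EFinM.
- apply/measurable_EFinP; apply: measurable_funM.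
    by apply: measurable_funM => //; exact: measurable_exp_weight.
  by apply: (measurableT_comp measurable_step); exact: measurable_funB.
- by move=> a _; rewrite lee_fin !mulr_ge0 ?expR_ge0 ?step_nneg// ltW.
- by rewrite lee_fin !mulr_ge0 ?step_nneg// ltW.
Qed.

Let f1_int w : (\int[mu]_v (f1 (w, v))%:E = (expR (- lam * (S w + I w)))%:E)%E.
Proof.
transitivity (\int[mu]_v ((expR (- lam * S w))%:E * (lam * expR (- lam * v) * step_ge0 (v - I w))%:E))%E.
  by apply: eq_integral => v _; rewrite /f1/= -EFinM mulrDr expRD; congr EFin; ring.
rewrite ge0_integralZl//.
- by rewrite exp_tail -EFinM -expRD mulrDr.
- apply/measurable_EFinP; apply: measurable_funM.
    by apply: measurable_funM => //; exact: measurable_exp_weight.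
  by apply: (measurableT_comp measurable_step); exact: measurable_funB.
- by move=> a _; rewrite lee_fin !mulr_ge0 ?expR_ge0 ?step_nneg// ltW.
Qed.

Let mf1 : measurable_fun setT f1.
Proof.
have m1S : measurable_fun setT (fun z : T * R => S z.1) by exact: measurableT_comp.
have m1I : measurable_fun setT (fun z : T * R => I z.1) by exact: measurableT_comp.
apply: measurable_funM.
  apply: measurable_funM => //; apply: (measurableT_comp measurable_step).
  exact: measurable_funB.
by apply: (measurableT_comp measurable_exp_weight); exact: measurable_funD.
Qed.

Let F_outer v a : (\int[P]_w (F (w, (v, a)))%:E =
  (lam ^+ 2 * expR (- lam * a))%:E * P (confined Y t (a - v) v))%E.
Proof.
rewrite (_ : P _ = \int[P]_w (\1_(confined Y t (a - v) v) w)%:E)%E; last first.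
  rewrite integral_indic ?setIT//; exact: (measurable_confined bmY).
rewrite -ge0_integralZl//; last first.
- by rewrite lee_fin !mulr_ge0 ?expR_ge0// ltW.
- by apply/measurable_EFinP/measurable_indic; exact: (measurable_confined bmY).
apply: eq_integral => w _; rewrite -EFinM; congr EFin; rewrite /F/= !step_ge0E.
rewrite !subr_ge0 indicE.
have -> : (w \in confined Y t (a - v) v) = (v + S w <= a) && (I w <= v).
  apply/idP/andP => [|[h1 h2]]; first by rewrite inE => -[h1 h2]; split => //; lra.
  by rewrite inE; split => //; lra.
by case: (_ + _ <= _); case: (I w <= v) => /=; ring.
Qed.

(* exp (- lam (S + I)) is the integral of lam ^ 2 exp (- lam a) over all (v, a)
   with I <= v and S <= a - v; Tonelli then exposes the confinement probabilities. *)
Lemma range_expE : range_exp = (\int[mu]_a ((lam ^+ 2 * expR (- lam * a))%:E *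
  \int[mu]_v P (confined Y t (a - v) v)))%E.
Proof.
transitivity (\int[P]_w \int[mu]_v (f1 (w, v))%:E)%E.
  by apply: eq_integral => w _; rewrite f1_int.
rewrite (fubini_tonelli (fun z : T * measurableTypeR R => (f1 z)%:E))//; last 2 first.
- exact/measurable_EFinP.
- by move=> z; rewrite lee_fin !mulr_ge0 ?expR_ge0 ?step_nneg// ltW.
pose g (z : R * R) := ((lam ^+ 2 * expR (- lam * z.2))%:E * P (confined Y t (z.2 - z.1) z.1))%E.
have mg : measurable_fun setT g.
  apply: emeasurable_funM.
    apply/measurable_EFinP; apply: measurable_funM => //.
    exact: (measurableT_comp measurable_exp_weight).
  apply: (@measurableT_comp _ _ _ _ _ _ _ _ (fun z : R * R => (z.2 - z.1, z.1))
    (measurable_confined_prob bmY t_gt0)).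
  by apply: measurable_fun_pair => //; exact: measurable_funB.
have g0 z : (0 <= g z)%E by rewrite mule_ge0// lee_fin mulr_ge0 ?sqr_ge0 ?expR_ge0.
transitivity (\int[mu]_v \int[mu]_a g (v, a))%E.
  apply: eq_integral => v _.
  transitivity (\int[P]_w \int[mu]_a (F (w, (v, a)))%:E)%E.
    by apply: eq_integral => w _; rewrite f1E.
  rewrite (fubini_tonelli (fun z : T * measurableTypeR R => (F (z.1, (v, z.2)))%:E))//.
  - by apply: eq_integral => a _; rewrite /= F_outer.
  - apply/measurable_EFinP; apply: (measurableT_comp mF).
    by apply: measurable_fun_pair => //; exact: measurable_fun_pair.
  - by move=> z; rewrite lee_fin.
rewrite (fubini_tonelli (g : measurableTypeR R * measurableTypeR R -> _))//; apply: eq_integral => a _; rewrite /g/=.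
rewrite ge0_integralZl//.
- exact: (measurable_confined_prob_slice bmY t_gt0).
- by rewrite lee_fin mulr_ge0 ?sqr_ge0 ?expR_ge0.
Qed.

Let measurable_slice_int :
  measurable_fun setT (fun a : R => \int[mu]_v P (confined Y t (a - v) v))%E.
Proof.
pose f (z : R * R) : \bar R := P (confined Y t (z.1 - z.2) z.2).
apply: (@measurable_fun_fubini_tonelli_F _ _ _ _ _ mu f) => //.
apply: (@measurableT_comp _ _ _ _ _ _ _ _ (fun z : R * R => (z.1 - z.2, z.2))
    (measurable_confined_prob bmY t_gt0)).
by apply: measurable_fun_pair => //; exact: measurable_funB.
Qed.

Let measurable_range_integrand : measurable_fun setT (fun a : R =>
  (lam ^+ 2 * expR (- lam * a))%:E * \int[mu]_v P (confined Y t (a - v) v))%E.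
Proof.
apply: emeasurable_funM => //; apply/measurable_EFinP; apply: measurable_funM => //.
exact: measurable_exp_weight.
Qed.

Lemma range_exp_le : (range_exp <= (lam ^+ 2)%:E * laplace_int 1 t)%E.
Proof.
rewrite range_expE /laplace_int -ge0_integralZl//; last 3 first.
- by apply/measurable_EFinP; exact: measurable_laplace_fun.
- by move=> a _; rewrite lee_fin laplace_fun_ge0.
- by rewrite lee_fin ?sqr_ge0.
apply: ge0_le_integral => //.
- move=> a _; rewrite mule_ge0 ?integral_ge0//.
  by rewrite lee_fin mulr_ge0 ?sqr_ge0 ?expR_ge0.
- apply: emeasurable_funM => //; apply/measurable_EFinP; exact: measurable_laplace_fun.
move=> a _; have [a0|a0] := leP a 0.
  rewrite (confined_int_le0 bmY t_gt0)// mule0 mule_ge0// lee_fin ?sqr_ge0//.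
  exact: laplace_fun_ge0.
apply: (@le_trans _ _ ((lam ^+ 2 * expR (- lam * a))%:E * (decay t a * a)%:E)%E).
  rewrite lee_wpmul2l ?(confined_int_le bmY)// lee_fin mulr_ge0 ?sqr_ge0 ?expR_ge0//.
rewrite -!EFinM lee_fin /laplace_fun indicE mem_set; last by rewrite /= in_itv/= a0.
by rewrite le_eqVlt; apply/orP; left; apply/eqP => /=; ring.
Qed.

Lemma range_exp_ge : ((lam ^+ 2 * (2 / pi))%:E * laplace_int 1 t <= range_exp)%E.
Proof.
have c0 : 0 <= lam ^+ 2 * (2 / pi) by rewrite mulr_ge0 ?sqr_ge0// divr_ge0// pi_ge0.
rewrite range_expE /laplace_int -ge0_integralZl//; last 2 first.
- by apply/measurable_EFinP; exact: measurable_laplace_fun.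
- by move=> a _; rewrite lee_fin laplace_fun_ge0.
apply: ge0_le_integral => //.
- by move=> a _; rewrite mule_ge0// lee_fin ?laplace_fun_ge0.
- apply: emeasurable_funM => //; apply/measurable_EFinP; exact: measurable_laplace_fun.
move=> a _; have w0 : (0 <= (lam ^+ 2 * expR (- lam * a))%:E)%E.
  by rewrite lee_fin mulr_ge0 ?sqr_ge0 ?expR_ge0.
have [a0|a0] := leP a 0.
  rewrite /laplace_fun indicE memNset; last by rewrite /= in_itv/= andbT; apply/negP; rewrite -leNgt.
  by rewrite mul0r mule0 mule_ge0// integral_ge0.
apply: (@le_trans _ _ ((lam ^+ 2 * expR (- lam * a))%:E * (decay t a * (2 / pi * a))%:E)%E).
  rewrite -!EFinM lee_fin /laplace_fun indicE mem_set; last by rewrite /= in_itv/= a0.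
  by rewrite le_eqVlt; apply/orP; left; apply/eqP => /=; ring.
by rewrite lee_wpmul2l ?(confined_int_ge bmY).
Qed.

(** The same mixture in one variable, with the threshold moved by 3 M so that the interval length in
    [decay] becomes exactly the integration variable. The shift costs exp (3 lam M). *)
Lemma exp_edge_le (E : set T) (f : T -> R) M : measurable E -> measurable_fun setT f ->
  (forall w, 0 <= f w) -> 0 < M ->
  (forall a, 0 <= a -> (P (E `&` [set w | (f w <= a)%R]) <= (decay t (a + 3 * M) * 2)%:E)%E) ->
  (\int[P]_(w in E) (expR (- lam * f w))%:E <=
   (2 * lam * expR (3 * lam * M))%:E * laplace_int 0 t)%E.
Proof.
move=> mE mf f0 M0 HE.
pose G (z : T * R) : R := \1_E z.1 * (lam * expR (- lam * z.2) * step_ge0 (z.2 - (f z.1 + 3 * M))).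
have G0 z : 0 <= G z by rewrite !mulr_ge0 ?expR_ge0 ?step_nneg// ltW.
have mG : measurable_fun setT G.
  apply: measurable_funM.
    by apply: (@measurableT_comp _ _ _ _ _ _ (\1_E : T -> R)) => //; exact: measurable_indic.
  apply: measurable_funM.
    by apply: measurable_funM => //; apply: (measurableT_comp measurable_exp_weight).
  apply: (measurableT_comp measurable_step); apply: measurable_funB => //.
  by apply: measurable_funD => //; exact: measurableT_comp.
have inner w : (\int[mu]_a (G (w, a))%:E =
    (\1_E w)%:E * ((expR (- (3 * lam * M)))%:E * (expR (- lam * f w))%:E))%E.
  rewrite -EFinM -expRD (_ : - (3 * lam * M) + - lam * f w = - lam * (f w + 3 * M)); last by ring.
  rewrite [RHS]EFinM -exp_tail -ge0_integralZl//.
  - apply/measurable_EFinP; apply: measurable_funM.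
      by apply: measurable_funM => //; exact: measurable_exp_weight.
    by apply: (measurableT_comp measurable_step); exact: measurable_funB.
  - by move=> a _; rewrite lee_fin !mulr_ge0 ?expR_ge0 ?step_nneg// ltW.
have outer a : (\int[P]_w (G (w, a))%:E =
    (lam * expR (- lam * a))%:E * P (E `&` [set w | (f w <= a - 3 * M)%R]))%E.
  have mEa : measurable (E `&` [set w | f w <= a - 3 * M]).
    by apply: measurableI => //; exact: measurable_sublevel.
  rewrite (_ : P _ = \int[P]_w (\1_(E `&` [set w | (f w <= a - 3 * M)%R]) w)%:E)%E; last first.
    by rewrite integral_indic ?setIT.
  rewrite -ge0_integralZl//; last first.
  - by rewrite lee_fin mulr_ge0 ?expR_ge0// ltW.
  - by apply/measurable_EFinP/measurable_indic.
  apply: eq_integral => w _; rewrite -EFinM; congr EFin; rewrite /G/= step_ge0E !indicE in_setI.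
  rewrite (_ : (w \in [set w | _]) = (0 <= a - (f w + 3 * M))).
    by case: (w \in E); case: (0 <= _) => /=; ring.
  by apply/idP/idP => [|h]; rewrite inE/=; lra.
have e1 : (\int[P]_(w in E) (expR (- lam * f w))%:E =
    (expR (3 * lam * M))%:E * \int[P]_w \int[mu]_a (G (w, a))%:E)%E.
  rewrite -ge0_integralZl//; last first.
  - by move=> w _; apply: integral_ge0 => a _; rewrite lee_fin.
  - apply: (@measurable_fun_fubini_tonelli_F _ _ _ _ _ mu (fun z => (G z)%:E)) => [|z].
      exact/measurable_EFinP.
    by rewrite lee_fin.
  rewrite [LHS]integral_mkcond; apply: eq_integral => w _; rewrite inner patchE indicE.
  case: ifPn => _; last by rewrite mul0e mule0.
  rewrite -!EFinM; congr EFin; rewrite mulrCA -!expRD -[LHS]mul1r; congr (_ * expR _); ring.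
rewrite e1 (fubini_tonelli (fun z : T * measurableTypeR R => (G z)%:E))//; last first.
  exact/measurable_EFinP.
rewrite (_ : 2 * lam * _ = expR (3 * lam * M) * (2 * lam)); last by ring.
rewrite [X in (_ <= X * _)%E]EFinM -muleA lee_wpmul2l//.
rewrite /laplace_int -ge0_integralZl//; last first.
- by rewrite lee_fin mulr_ge0// ltW.
- by move=> a _; rewrite lee_fin laplace_fun_ge0.
- by apply/measurable_EFinP; exact: measurable_laplace_fun.
apply: ge0_le_integral => //.
- by move=> a _; apply: integral_ge0 => w _; rewrite lee_fin.
- apply: (@measurable_fun_fubini_tonelli_G _ _ _ _ _ P (fun z => (G z)%:E)) => [|z].
    exact/measurable_EFinP.
  by rewrite lee_fin.
- apply: emeasurable_funM => //; apply/measurable_EFinP; exact: measurable_laplace_fun.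
move=> a _; rewrite outer; have [a3|a3] := ltP (a - 3 * M) 0.
  rewrite (_ : _ `&` _ = set0) ?measure0 ?mule0 ?mule_ge0// ?lee_fin ?laplace_fun_ge0//.
    by rewrite mulr_ge0// ltW.
  by apply/seteqP; split => // w [_ /=]; have := f0 w; lra.
have a0 : 0 < a by lra.
apply: (@le_trans _ _ ((lam * expR (- lam * a))%:E * (decay t a * 2)%:E)%E).
  rewrite lee_wpmul2l//; first by rewrite lee_fin mulr_ge0 ?expR_ge0// ltW.
  by have := HE _ a3; rewrite subrK.
rewrite -!EFinM lee_fin /laplace_fun indicE mem_set; last by rewrite /= in_itv/= a0.
by rewrite le_eqVlt; apply/orP; left; apply/eqP => /=; ring.
Qed.

(** Dropping the rise from the exponent leaves the fall alone; rise <= M and fall <= a is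
    confinement in [0, a + M] started at [a], at distance M from the upper end. *)
Lemma rise_edge_le M : 0 < M ->
  (\int[P]_(w in [set w | (S w <= M)%R]) (expR (- lam * (S w + I w)))%:E <=
   (2 * lam * expR (3 * lam * M))%:E * laplace_int 0 t)%E.
Proof.
move=> M0.
have mE : measurable [set w | S w <= M] by exact: measurable_sublevel.
apply: le_trans (@exp_edge_le [set w | S w <= M] I M mE mI _ M0 _).
- apply: ge0_le_integral => //.
  + apply/measurable_EFinP/measurable_funTS; apply: (measurableT_comp measurable_exp_weight).
    exact: measurable_funD.
  + apply/measurable_EFinP/measurable_funTS; exact: (measurableT_comp measurable_exp_weight).
  + move=> w _; rewrite lee_fin ler_expR mulrDr gerDr mulNr oppr_le0 mulr_ge0//.
      exact: ltW.
    exact: (rise_ge0 bmY).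
- by move=> w; exact: (fall_ge0 bmY).
- move=> a a0; have := confined_edge bmY t_gt0 M0 a0 (or_intror erefl).
  by rewrite (addrC a) addrK.
Qed.

Lemma fall_edge_le M : 0 < M ->
  (\int[P]_(w in [set w | (I w <= M)%R]) (expR (- lam * (S w + I w)))%:E <=
   (2 * lam * expR (3 * lam * M))%:E * laplace_int 0 t)%E.
Proof.
move=> M0.
have mE : measurable [set w | I w <= M] by exact: measurable_sublevel.
apply: le_trans (@exp_edge_le [set w | I w <= M] S M mE mS _ M0 _).
- apply: ge0_le_integral => //.
  + apply/measurable_EFinP/measurable_funTS; apply: (measurableT_comp measurable_exp_weight).
    exact: measurable_funD.
  + apply/measurable_EFinP/measurable_funTS; exact: (measurableT_comp measurable_exp_weight).
  + move=> w _; rewrite lee_fin ler_expR mulrDr gerDl mulNr oppr_le0 mulr_ge0//.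
      exact: ltW.
    exact: (fall_ge0 bmY).
- by move=> w; exact: (rise_ge0 bmY).
- move=> a a0; have := confined_edge bmY t_gt0 M0 a0 (or_introl erefl).
  by rewrite addrK setIC.
Qed.
End range.
End tail.
End exponential_range.

(** * Laplace's method *)

Section laplace_asymptotics.
Context {R : realType}.
Notation mu := (@lebesgue_measure R).

(** Here 1 + r y is the interval length divided by the saddle point, and r is the relative width of
    the peak. *)
Definition laplace_kernel (k : nat) (r y : R) : R :=
  \1_`]0, +oo[ (1 + r * y) * ((1 + r * y) ^+ k *
    expR (- (y ^+ 2 * (2 * (1 + r * y) + 1) / (2 * (1 + r * y) ^+ 2)))).

Lemma measurable_laplace_kernel k r : measurable_fun setT (laplace_kernel k r).
Proof.
have m1 : measurable_fun setT (fun y : R => 1 + r * y).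
  by apply: measurable_funD => //; exact: measurable_funM.
apply: measurable_funM.
  by apply: (@measurableT_comp _ _ _ _ _ _ (\1_`]0, +oo[ : R -> R)).
apply: measurable_funM; first exact: measurable_funX.
apply: measurableT_comp => //; apply: measurableT_comp => //.
apply: measurable_funM; last first.
  apply: (measurableT_comp measurable_inv); apply: measurable_funM => //.
  exact: measurable_funX.
by apply: measurable_funM => //; apply: measurable_funD => //; exact: measurable_funM.
Qed.

(* Substituting [a = a0 * b], [b = 1 + r * y] at the saddle point [a0], the
   exponent is [lam * a0 * (3 / 2 + (b - 1) ^ 2 * (2 * b + 1) / (2 * b ^ 2))]. *)
Lemma laplace_int_scale (lam a0 r t : R) k : 0 < a0 -> 0 < r ->
  lam * a0 * r ^+ 2 = 1 -> pi ^+ 2 * t = lam * a0 ^+ 3 ->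
  (laplace_int lam k t = (a0 ^+ k.+1 * r * expR (- (3 / 2 * (lam * a0))))%:E *
    \int[mu]_y (laplace_kernel k r y)%:E)%E.
Proof.
move=> a00 r0 e1 e2.
have s0 : 0 < a0 * r by rewrite mulr_gt0.
have mL := @measurable_laplace_fun R lam k t.
rewrite /laplace_int (@ge0_integral_affine _ a0 (a0 * r)) ?gt_eqF//; last 2 first.
- exact/measurable_EFinP.
- by move=> x; rewrite lee_fin laplace_fun_ge0.
have E y : laplace_fun lam k t (a0 + a0 * r * y) =
    a0 ^+ k * expR (- (3 / 2 * (lam * a0))) * laplace_kernel k r y.
  rewrite /laplace_fun /laplace_kernel (_ : a0 + a0 * r * y = a0 * (1 + r * y)); last by ring.
  set b := 1 + r * y; rewrite !indicE.
  have -> : (a0 * b \in `]0, +oo[%classic) = (0 < b).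
    by rewrite -(pmulr_rgt0 _ a00); apply/idP/idP; rewrite inE/= in_itv/= andbT.
  have -> : (b \in `]0, +oo[%classic) = (0 < b).
    by apply/idP/idP; rewrite inE/= in_itv/= andbT.
  have [b0|b0] := ltP 0 b; last by rewrite !mul0r mulr0.
  have exE : - lam * (a0 * b) + - ((pi / (a0 * b)) ^+ 2 * t) / 2 =
      - (3 / 2 * (lam * a0)) + - (y ^+ 2 * (2 * b + 1) / (2 * b ^+ 2)).
    have -> : (pi / (a0 * b)) ^+ 2 * t = lam * a0 / b ^+ 2.
      by rewrite expr_div_n mulrAC e2; field; rewrite !gt_eqF.
    have -> : y ^+ 2 = lam * a0 * (b - 1) ^+ 2.
      have -> : (b - 1) ^+ 2 = r ^+ 2 * y ^+ 2 by rewrite /b; ring.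
      by rewrite mulrA e1 mul1r.
    by field; rewrite gt_eqF.
  by rewrite !mul1r /decay exprMn -[LHS]mulrA -expRD exE expRD; ring.
under eq_integral do rewrite E EFinM.
have mK' := measurable_laplace_kernel k r.
rewrite ge0_integralZl//.
- rewrite muleA -EFinM ger0_norm ?ltW//; congr (_%:E * _)%E; rewrite exprS; ring.
- exact/measurable_EFinP.
- move=> y _; rewrite lee_fin /laplace_kernel indicE; case: (boolP (_ \in _)) => [|_]; last by rewrite mul0r.
  by rewrite inE/= in_itv/= andbT => b0; rewrite mul1r mulr_ge0 ?expR_ge0// exprn_ge0// ltW.
- by rewrite lee_fin mulr_ge0 ?expR_ge0 ?exprn_ge0// ltW.
Qed.

(** Domination uniform in [r]: with b = 1 + r y <= 1 + |y|, one has (|y| - 1) b <= y^2, hence the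
    exponent y^2 (2 b + 1) / (2 b^2) is at least y^2 / b >= |y| - 1. *)
Lemma laplace_kernel_bounds k r y : (k <= 1)%N -> 0 < r <= 1 ->
  0 <= laplace_kernel k r y <= (1 + `|y|) * expR (1 - `|y|).
Proof.
move=> k1 /andP[r0 r1]; rewrite /laplace_kernel; set b := 1 + r * y.
have rhs0 : 0 <= (1 + `|y|) * expR (1 - `|y|) by rewrite mulr_ge0 ?expR_ge0// addr_ge0.
rewrite indicE; case: (boolP (b \in _)) => [|_]; last by rewrite mul0r lexx.
rewrite inE/= in_itv/= andbT => b0; rewrite mul1r.
have bk0 : 0 <= b ^+ k by rewrite exprn_ge0// ltW.
rewrite mulr_ge0 ?expR_ge0//=.
have by1 : b <= 1 + `|y|.
  by rewrite lerD2l (le_trans (ler_norm _))// normrM gtr0_norm// ler_piMl.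
have y0 := normr_ge0 y.
apply: ler_pM; rewrite ?expR_ge0//.
  by case: k k1 {bk0} => [|[|//]] _; rewrite ?expr0 ?expr1// lerDl.
rewrite ler_expR lerNl opprB ler_pdivlMr ?mulr_gt0 ?exprn_gt0//.
have -> : y ^+ 2 = `|y| ^+ 2 by rewrite real_normK ?num_real.
have h : (`|y| - 1) * b <= `|y| ^+ 2 by nra.
nra.
Qed.

(** Since 1 + |y| <= 2 exp (|y| / 2), the bound is below a multiple of exp (- |y| / 2), that is, of
    the exponential density of rate 1 / 2 plus its reflection. *)
Lemma integrable_laplace_bound :
  mu.-integrable setT (fun y : R => ((1 + `|y|) * expR (1 - `|y|))%:E).
Proof.
pose p := exponential_pdf (2^-1 : R).
have h0 : 0 < (2^-1 : R) by rewrite invr_gt0.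
have ip : mu.-integrable setT (EFin \o p) by exact: integrable_exponential_pdf.
have mp : measurable_fun setT p by exact: measurable_exponential_pdf.
have p0 x : 0 <= p x by rewrite exponential_pdf_ge0// ltW.
have mpN : measurable_fun setT (fun x : R => p (- x)) by apply: (measurableT_comp mp).
have ipN : mu.-integrable setT (fun x : R => (p (- x))%:E).
  apply/integrableP; split; first exact/measurable_EFinP.
  rewrite (_ : integral _ _ _ = 1%E) ?ltry//.
  transitivity (\int[mu]_x (p x)%:E)%E; last exact: integral_exponential_pdf.
  rewrite [RHS](@ge0_integral_affine _ 0 (-1)) ?oppr_eq0 ?oner_neq0//.
  - rewrite normrN1 mul1e; apply: eq_integral => x _.
    by rewrite add0r mulN1r/= ger0_norm.
  - exact/measurable_EFinP.
have iS : mu.-integrable setT (fun x : R => ((4 * expR 1)%:E * ((p x)%:E + (p (- x))%:E))%E).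
  by apply: integrableZl => //; apply: integrableD.
apply: (le_integrable _ _ _ iS) => //.
  apply/measurable_EFinP; apply: measurable_funM.
    by apply: measurable_funD => //; exact: measurableT_comp.
  apply: measurableT_comp => //; apply: measurable_funB => //; exact: measurableT_comp.
move=> y _; rewrite -EFinD -EFinM/= lee_fin [leLHS]ger0_norm; last by rewrite mulr_ge0 ?expR_ge0 ?addr_ge0.
rewrite [leRHS]ger0_norm; last by rewrite mulr_ge0 ?addr_ge0// mulr_ge0 ?expR_ge0.
have yb : 2^-1 * expR (- (2^-1 * `|y|)) <= p y + p (- y).
  have [y0|y0] := leP 0 y.
    by rewrite /p exponential_pdfE// ger0_norm// mulNr lerDl.
  rewrite ltr0_norm// {2}/p exponential_pdfE; last by rewrite oppr_ge0 ltW.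
  by rewrite mulNr lerDr.
have e1 : 1 + `|y| <= 2 * expR (2^-1 * `|y|).
  have := expR_ge1Dx (2^-1 * `|y|); have := normr_ge0 y; lra.
apply: (le_trans (ler_wpM2r (expR_ge0 _) e1)).
rewrite -mulrA -expRD (_ : _ + (1 - _) = 1 + - (2^-1 * `|y|)); last by lra.
rewrite expRD; have := expR_gt0 (1 : R); nra.
Qed.

Lemma laplace_kernel_cvg k (r : nat -> R) y : r @ \oo --> (0 : R) ->
  laplace_kernel k (r n) y @[n --> \oo] --> expR (- (3 / 2 * y ^+ 2)).
Proof.
move=> r0; have b1 : 1 + r n * y @[n --> \oo] --> (1 : R).
  by rewrite -[X in _ --> X]addr0 -[X in _ --> _ + X](mul0r y); apply: cvgD; [exact: cvg_cst|exact: cvgMl].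
have bX m : (1 + r n * y) ^+ m @[n --> \oo] --> (1 : R).
  elim: m => [|m IH]; first exact: cvg_cst.
  have h : (1 + r n * y) * (1 + r n * y) ^+ m @[n --> \oo] --> (1 * 1 : R) by exact: cvgM.
  rewrite mulr1 in h; apply: cvg_trans h; apply: near_eq_cvg.
  by apply: nearW => n; rewrite exprS.
have g1 : (1 + r n * y) ^+ k * expR (- (y ^+ 2 * (2 * (1 + r n * y) + 1) / (2 * (1 + r n * y) ^+ 2)))
    @[n --> \oo] --> expR (- (3 / 2 * y ^+ 2)).
  rewrite -[X in _ --> X]mul1r; apply: cvgM; first exact: bX.
  apply: continuous_cvg; first exact: continuous_expR.
  rewrite (_ : 3 / 2 * y ^+ 2 = y ^+ 2 * (2 * 1 + 1) / (2 * 1)); last by field.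
  apply: cvgN; apply: cvgM.
    apply: cvgM; first exact: cvg_cst.
    apply: cvgD; [apply: cvgM => //; exact: cvg_cst|exact: cvg_cst].
  apply: cvgV; first by rewrite mulr1.
  by apply: cvgM; [exact: cvg_cst|exact: bX].
apply: cvg_trans g1; apply: near_eq_cvg.
have : \forall n \near \oo, 0 < 1 + r n * y.
  by apply: (cvgr_gt 1 b1).
apply: filterS => n b0; rewrite /laplace_kernel indicE mem_set ?mul1r//.
by rewrite /= in_itv/= b0.
Qed.

(** A Gaussian of variance 1 / 3; this is where sqrt (2 pi / 3) in C(z) originates. *)
Lemma integral_gauss32 :
  (\int[mu]_y (expR (- (3 / 2 * y ^+ 2)))%:E = (Num.sqrt (2 * pi / 3))%:E)%E.
Proof.
pose s : R := Num.sqrt (3^-1).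
have s0 : 0 < s by rewrite sqrtr_gt0 invr_gt0.
have s2 : s ^+ 2 = 3^-1 by rewrite sqr_sqrtr// invr_ge0.
have sp : 0 < Num.sqrt (2 * pi / 3 : R) by rewrite sqrtr_gt0 divr_gt0// mulr_gt0// pi_gt0.
rewrite -[RHS]mule1 -(integral_normal_pdf (0 : R) s) -ge0_integralZl//.
- apply: eq_integral => y _; rewrite -EFinM normal_pdf_expE ?gt_eqF// /normal_peak.
  congr EFin; rewrite s2 (_ : 3^-1 * pi *+ 2 = 2 * pi / 3); last by rewrite mulr2n; field.
  by rewrite mulVKf ?gt_eqF//; congr expR; rewrite subr0 mulr2n; field.
- by apply/measurable_EFinP; exact: measurable_normal_pdf.
- by move=> y _; rewrite lee_fin normal_pdf_ge0.
Qed.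

Lemma integral_laplace_kernel_cvg k (r : nat -> R) : (k <= 1)%N ->
  (forall n, 0 < r n <= 1) -> r @ \oo --> (0 : R) ->
  (\int[mu]_y (laplace_kernel k (r n) y)%:E)%E @[n --> \oo] --> (Num.sqrt (2 * pi / 3))%:E.
Proof.
move=> k1 r01 r0; rewrite -integral_gauss32.
have [|||||_ _] := @dominated_convergence _ _ _ mu setT measurableT
  (fun n y => (laplace_kernel k (r n) y)%:E) (fun y => (expR (- (3 / 2 * y ^+ 2)))%:E)
  (fun y => ((1 + `|y|) * expR (1 - `|y|))%:E) => //.
- by move=> n; apply/measurable_EFinP; exact: measurable_laplace_kernel.
- apply/measurable_EFinP; apply: measurableT_comp => //; apply: measurableT_comp => //.
  by apply: measurable_funM => //; exact: measurable_funX.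
- by apply: aeW => y _; apply: cvg_EFin; [exact: nearW|exact: laplace_kernel_cvg].
- exact: integrable_laplace_bound.
- apply: aeW => y n _; rewrite /= lee_fin.
  by have /andP[h1 h2] := laplace_kernel_bounds y k1 (r01 n); rewrite ger0_norm.
Qed.

Definition exit_scale (lam t : R) : R :=
  t `^ (- 2^-1) * expR (3 / 2 * pi `^ (2 / 3) * lam `^ (2 / 3) * t `^ (3^-1)).

Lemma exit_scale_ge0 lam t : 0 <= exit_scale lam t.
Proof. by rewrite mulr_ge0 ?powR_ge0 ?expR_ge0. Qed.

Section scale.
Variables (lam : R) (lam_gt0 : 0 < lam).

(** The minimiser of lam a + pi^2 t / (2 a^2), whose critical equation is lam a^3 = pi^2 t. *)
Definition saddle (t : R) : R := (pi ^+ 2 * t / lam) `^ (3^-1).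

Lemma powR3V (x : R) : 0 <= x -> (x `^ (3^-1)) ^+ 3 = x.
Proof. by move=> x0; rewrite -powR_mulrn ?powR_ge0// -powRrM mulVf ?powRr1. Qed.

Lemma saddle_gt0 t : 0 < t -> 0 < saddle t.
Proof. by move=> t0; rewrite powR_gt0// divr_gt0// mulr_gt0// exprn_gt0// pi_gt0. Qed.

Lemma saddle_cube t : 0 < t -> pi ^+ 2 * t = lam * saddle t ^+ 3.
Proof.
have l0 := lam_gt0; move=> t0; rewrite powR3V.
  by rewrite [RHS]mulrC divfK// gt_eqF.
by rewrite divr_ge0 ?ltW// mulr_gt0// exprn_gt0// pi_gt0.
Qed.

(** The right side is the minimal exponent lam a0 + lam a0 / 2. Both sides are nonnegative, and
    cubing removes the fractional powers. *)
Lemma exit_exponent t : 0 < t ->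
  3 / 2 * pi `^ (2 / 3) * lam `^ (2 / 3) * t `^ (3^-1) = 3 / 2 * (lam * saddle t).
Proof.
have l0 := lam_gt0; move=> t0; rewrite -!mulrA; congr (_ * _); congr (_ * _).
have p0 : 0 <= (pi : R) by exact: pi_ge0.
apply: (@pexpIrn _ 3) => //; rewrite ?nnegrE ?mulr_ge0 ?powR_ge0 ?(ltW l0)//.
have h (x : R) : 0 <= x -> (x `^ (2 / 3)) ^+ 3 = x ^+ 2.
  move=> x0; rewrite -powR_mulrn ?powR_ge0// -powRrM divfK ?pnatr_eq0//.
  exact: powR_mulrn.
rewrite !exprMn !h ?(ltW l0)// powR3V ?ltW//.
have e := saddle_cube t0.
rewrite (_ : lam ^+ 3 * saddle t ^+ 3 = lam ^+ 2 * (lam * saddle t ^+ 3)); last by ring.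
by rewrite -e; ring.
Qed.

(** The exponentials cancel, and so do the powers of t: what remains is pi / lam for k = 1 and a
    multiple of 1 / [saddle t] for k = 0. *)
Lemma exit_scale_saddle t k : 0 < t ->
  exit_scale lam t * (saddle t ^+ k.+1 * (Num.sqrt (lam * saddle t))^-1 *
    expR (- (3 / 2 * (lam * saddle t)))) = pi / lam * saddle t ^+ k / saddle t.
Proof.
have l0 := lam_gt0; move=> t0; have s0 := saddle_gt0 t0.
have e := saddle_cube t0; have p0 : 0 < (pi : R) by exact: pi_gt0.
rewrite /exit_scale exit_exponent// powRN powR12_sqrt ?ltW//.
set E := 3 / 2 * _; set s := saddle t in s0 e E *.
have st0 : 0 < Num.sqrt t by rewrite sqrtr_gt0.
have sl0 : 0 < Num.sqrt (lam * s) by rewrite sqrtr_gt0 mulr_gt0.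
have key : lam * s ^+ 2 = pi * (Num.sqrt t * Num.sqrt (lam * s)).
  apply: (@pexpIrn _ 2) => //; rewrite ?nnegrE ?mulr_ge0 ?ltW ?exprn_gt0//.
  rewrite !exprMn !sqr_sqrtr ?mulr_ge0 ?ltW//.
  by rewrite [RHS]mulrA e; ring.
rewrite expRN exprS; have E0 := expR_gt0 E.
rewrite (_ : pi = lam * s ^+ 2 / (Num.sqrt t * Num.sqrt (lam * s))); last first.
  by rewrite key mulfK// gt_eqF// mulr_gt0.
by field; rewrite !gt_eqF.
Qed.

Lemma saddle_pinfty : saddle t @[t --> +oo] --> +oo.
Proof.
have l0 := lam_gt0.
have p0 : 0 < (pi : R) ^+ 2 by rewrite exprn_gt0// pi_gt0.
apply/cvgryPge => A; near=> t.
have t0 : 0 < t by near: t; exact: nbhs_pinfty_gt.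
have B0 : 0 <= Num.max A 0 by rewrite le_max lexx orbT.
apply: (@le_trans _ _ (Num.max A 0)); first by rewrite le_max lexx.
rewrite -(@ler_pXn2r _ 3)// ?nnegrE ?(ltW (saddle_gt0 t0))//.
rewrite -(ler_pM2l l0) -saddle_cube// [leRHS]mulrC -ler_pdivrMr //; near: t; exact: nbhs_pinfty_ge.
Unshelve. all: end_near. Qed.

Lemma exit_scale_laplace_cvg (k : nat) (l : R) : (k <= 1)%N ->
  pi / lam * saddle t ^+ k / saddle t @[t --> +oo] --> l ->
  ((exit_scale lam t)%:E * laplace_int lam k t)%E @[t --> +oo] -->
  (l * Num.sqrt (2 * pi / 3))%:E.
Proof.
have l0 := lam_gt0; move=> k1 hl.
pose r (t : R) : R := (Num.sqrt (lam * saddle t))^-1.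
have r0 : r t @[t --> +oo] --> (0 : R).
  apply/cvgr0Pnorm_lt => e e0; near=> t.
  have t0 : 0 < t by near: t; exact: nbhs_pinfty_gt.
  have s0 := saddle_gt0 t0.
  rewrite /r ger0_norm ?invr_ge0// invf_plt ?posrE ?sqrtr_gt0 ?mulr_gt0//.
  rewrite -[ltLHS]ger0_norm ?invr_ge0 ?(ltW e0)// -sqrtr_sqr ltr_sqrt ?mulr_gt0//.
  rewrite mulrC -ltr_pdivrMr//; near: t.
  exact: (cvgry_gt saddle_pinfty).
apply/cvge_pinftyP => u hu.
have ru : r (u n) @[n --> \oo] --> (0 : R) by exact: ((cvg_pinftyP _ _).1 r0 u hu).
have r01 : \forall n \near \oo, 0 < u n /\ r (u n) <= 1.
  near=> n; split; near: n; first exact: (cvgry_gt hu).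
  by apply: (cvgr_le _ ru); exact: ltr01.
(* Dominated convergence is sequential and wants 0 < r <= 1 for every index, so the values of r
   outside this range, which do not occur for large n, are replaced by 1 / (n + 1). *)
pose r' n := if 0 < r (u n) <= 1 then r (u n) else n.+1%:R^-1.
have r'01 n : 0 < r' n <= 1.
  rewrite /r'; case: ifPn => // _; rewrite invr_gt0 ltr0n/= invf_le1 ?ltr0n//.
  by rewrite ler1n.
have rr' : \forall n \near \oo, r (u n) = r' n.
  apply: filterS r01 => n [u0 h]; rewrite /r' h andbT ifT//.
  by rewrite invr_gt0 sqrtr_gt0 mulr_gt0// saddle_gt0.
have r'0 : r' @ \oo --> (0 : R).
  by apply: cvg_trans ru; apply: near_eq_cvg; apply: filterS rr'.
have K := integral_laplace_kernel_cvg k1 r'01 r'0.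
have L : pi / lam * saddle (u n) ^+ k / saddle (u n) @[n --> \oo] --> l.
  exact: ((cvg_pinftyP _ _).1 hl u hu).
have LE : (pi / lam * saddle (u n) ^+ k / saddle (u n))%:E @[n --> \oo] --> l%:E.
  by apply: cvg_EFin; [exact: nearW|exact: L].
have LK : ((pi / lam * saddle (u n) ^+ k / saddle (u n))%:E *
    \int[mu]_y (laplace_kernel k (r' n) y)%:E)%E @[n --> \oo] --> (l%:E * (Num.sqrt (2 * pi / 3))%:E)%E.
  by apply: cvgeM.
rewrite EFinM; apply: cvg_trans LK; apply: near_eq_cvg.
near=> n; have [u0 _] : 0 < u n /\ r (u n) <= 1 by near: n.
have s0 := saddle_gt0 u0; have ls0 : 0 < lam * saddle (u n) by rewrite mulr_gt0.
rewrite -(near rr' n)//; have -> := @laplace_int_scale lam (saddle (u n)) (r (u n)) (u n) k s0.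
- by rewrite muleA -EFinM /r exit_scale_saddle.
- by rewrite invr_gt0 sqrtr_gt0.
- by rewrite /r exprVn sqr_sqrtr ?ltW// divff// gt_eqF.
- exact: saddle_cube.
Unshelve. all: end_near. Qed.

Lemma exit_scale_laplace1 :
  ((exit_scale lam t)%:E * laplace_int lam 1 t)%E @[t --> +oo] -->
  (pi / lam * Num.sqrt (2 * pi / 3))%:E.
Proof.
have l0 := lam_gt0; apply: exit_scale_laplace_cvg => //.
apply: cvg_near_cst; near=> t.
have t0 : 0 < t by near: t; exact: nbhs_pinfty_gt.
by rewrite expr1 mulfK// gt_eqF// saddle_gt0.
Unshelve. all: end_near. Qed.

Lemma exit_scale_laplace0 :
  ((exit_scale lam t)%:E * laplace_int lam 0 t)%E @[t --> +oo] --> 0%E.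
Proof.
have l0 := lam_gt0.
have h : pi / lam * saddle t ^+ 0 / saddle t @[t --> +oo] --> (0 : R).
  under eq_cvg do rewrite expr0 mulr1.
  have hV : (saddle t)^-1 @[t --> +oo] --> (0 : R).
    apply/gtr0_cvgV0; last exact: saddle_pinfty.
    by near=> t; rewrite saddle_gt0//; near: t; exact: nbhs_pinfty_gt.
  have hM : pi / lam * (saddle t)^-1 @[t --> +oo] --> (pi / lam * 0 : R) by exact: cvgMr.
  by rewrite mulr0 in hM.
by have := exit_scale_laplace_cvg (leqW (leqnn 0)) h; rewrite mul0r.
Unshelve. all: end_near. Qed.

End scale.
End laplace_asymptotics.

(** * Survival of a Brownian motion in an open set *)

Section open_sets.
Context {R : realType} (n : nat).

(** An open set is a countable union of cubes with rational centre and radius 1 / (k + 1), so it is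
    measurable in terms of the coordinates; cubes not inside [U] are replaced by the empty set. *)
Lemma open_cylinders (U : set 'rV[R]_n) : open U ->
  <<s @cylinders R 'I_n >> [set f | U (\row_i f i)].
Proof.
move=> oU; pose TX := g_sigma_algebraType (@cylinders R 'I_n).
pose B (p : {ffun 'I_n -> rat} * nat) : set 'rV[R]_n :=
  [set x | forall i, `|x 0 i - ratr (p.1 i)| < p.2.+1%:R^-1].
pose G (p : {ffun 'I_n -> rat} * nat) : set TX :=
  if `[< B p `<=` U >] then [set f | forall i, `|f i - ratr (p.1 i)| < p.2.+1%:R^-1] else set0.
suff -> : [set f : TX | U (\row_i f i)] = \bigcup_p G p.
  suff : measurable (\bigcup_p G p) by [].
  apply: countable_bigcupT_measurable => // p; rewrite /G; case: ifP => // _.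
  apply: sub_sigma_algebra; exists (fun i => [set y | `|y - ratr (p.1 i)| < p.2.+1%:R^-1]).
  split=> // i; apply: open_measurable.
  rewrite (_ : [set y | _] = ball (ratr (p.1 i) : R) (p.2.+1%:R^-1)); first exact: ball_open.
  by apply/seteqP; split => y; rewrite /ball/= distrC.
apply/seteqP; split => [f /= Uf|f [p _]]; last first.
  rewrite /G; case: ifPn => // /asboolP BU h; apply: BU => i; rewrite mxE; exact: h.
have /nbhs_ballP[e /= e0 eU] := open_nbhs_nbhs (conj oU Uf).
pose k := Num.truncn (2 / e).
have k0 : 0 < (k.+1%:R : R) by rewrite ltr0n.
have ke : 2 / k.+1%:R < e.
  by rewrite ltr_pdivrMr// mulrC -ltr_pdivrMr//; have := truncnS_gt (2 / e).
have hq i : {q : rat | `|f i - ratr q| < k.+1%:R^-1}.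
  have : f i - k.+1%:R^-1 < f i + k.+1%:R^-1.
    by have := k0; rewrite -invr_gt0; move: (_^-1) => v; lra.
  move=> /rat_in_itvoo h; have [q] := cid h; rewrite in_itv/= => /andP[q1 q2]; exists q.
  by rewrite ltr_norml; move: q1 q2; move: (_^-1) (ratr q) => v q'; lra.
exists ([ffun i => sval (hq i)], k) => //; rewrite /G.
case: ifPn => [_ i /=|/asboolP]; first by rewrite ffunE; exact: svalP (hq i).
case=> x hx; apply: eU; rewrite /ball/= /mx_ball; split => // j i.
rewrite (ord1 j) !mxE /ball/=; have := hx i; rewrite ffunE.
have := svalP (hq i); set q := ratr _ => h1 h2.
rewrite (le_lt_trans (ler_distD q _ _))// (lt_trans _ ke)//.
rewrite (_ : 2 / _ = k.+1%:R^-1 + k.+1%:R^-1); last by ring.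
by rewrite ltrD// distrC.
Qed.

Lemma measurable_closed_preimage d (T : measurableType d) (g : T -> 'rV[R]_n) K :
  closed K -> (forall i, measurable_fun setT (fun w => g w 0 i)) ->
  measurable [set w | K (g w)].
Proof.
move=> cK mg; rewrite -[X in measurable X]setCK; apply: measurableC.
have mF : measurable_fun setT ((fun w i => g w 0 i) : T -> g_sigma_algebraType (@cylinders R 'I_n)).
  exact: measurable_path.
have := mF measurableT _ (open_cylinders (closed_openC cK)).
rewrite setTI; congr measurable; apply/seteqP; split => w /=.
  by rewrite (_ : \row_i _ = g w)//; apply/rowP => i; rewrite mxE.
by rewrite (_ : \row_i _ = g w)//; apply/rowP => i; rewrite mxE.
Qed.

(** The points at distance at least 1 / (m + 1) from the complement, written as the complement of a
    union of open balls so that closedness is immediate. *)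
Definition inner_set (D : set 'rV[R]_n) (m : nat) : set 'rV[R]_n :=
  ~` \bigcup_(y in ~` D) ball y (m.+1%:R^-1).

Lemma inner_set_closed D m : closed (inner_set D m).
Proof. by apply: open_closedC; apply: bigcup_open => y _; exact: ball_open. Qed.

Lemma inner_set_sub D m : inner_set D m `<=` D.
Proof.
move=> x h; apply: contrapT => Dx; apply: h; exists x => //; apply: ballxx.
by rewrite invr_gt0.
Qed.

Lemma inner_set_mono D m p : (m <= p)%N -> inner_set D m `<=` inner_set D p.
Proof.
move=> mp x h [y Dy yx]; apply: h; exists y => //; apply: le_ball yx.
by rewrite lef_pV2 ?posrE// ler_nat.
Qed.

(** Compactness of [0, u]: near each time a ball around the path fits in [D], and half its radius
    bounds 1 / (m + 1) uniformly. *)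
Lemma path_inner_set (D : set 'rV[R]_n) (g : R -> 'rV[R]_n) (u : R) :
  open D -> continuous g -> (forall s, 0 <= s <= u -> D (g s)) ->
  exists m, forall s, 0 <= s <= u -> inner_set D m (g s).
Proof.
move=> oD cg gD.
have /compact_near_coveringP/(_ nat \oo (fun m s => inner_set D m (g s)) _) h :=
  @segment_compact R 0 u.
have [s /= | m _ hm] := h; last first.
  by exists m => s su; apply: (hm m) => //=; rewrite in_itv.
rewrite in_itv/= => su.
have /nbhs_ballP[e /= e0 eD] := open_nbhs_nbhs (conj oD (gD s su)).
have e20 : 0 < e / 2 by rewrite divr_gt0.
exists ([set s' | ball (g s) (e / 2) (g s')], [set m | m.+1%:R^-1 < e / 2 :> R]).
  split=> /=; first by apply: cg; exact: nbhsx_ballx.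
  exact: near_infty_natSinv_lt (PosNum e20).
move=> [s' m] /= [h1 h2] [y Dy yb]; apply: Dy; apply: eD.
rewrite (splitr e); apply: (ball_triangle h1); apply: ball_sym.
by apply: le_ball yb; exact: ltW.
Qed.
End open_sets.

Section survival_law.
Context {R : realType} d (T : measurableType d) (P : probability T R) (n : nat).

Definition stays (D : set 'rV[R]_n) (z : 'rV[R]_n) (X : R -> T -> 'rV[R]_n) (u : R) : set T :=
  [set w | forall s, 0 <= s <= u -> D (z + X s w)].

Definition stays_grid (K : set 'rV[R]_n) (z : 'rV[R]_n) (X : R -> T -> 'rV[R]_n) (u : R) (k : nat) : set T :=
  [set w | forall j, (j <= 2 ^ k)%N -> K (z + X (j%:R * (u / (2 ^ k)%:R)) w)].

(* A path staying in the open set D over [0, u] stays in one of the closed sets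
   [inner_set D m], which is a condition on dyadic times only. *)
Lemma staysE (D : set 'rV[R]_n) z (X : R -> T -> 'rV[R]_n) (u : R) : open D -> 0 <= u ->
  (forall w, {within `[0, +oo[, continuous (X^~ w)}) ->
  stays D z X u = \bigcup_m \bigcap_k stays_grid (inner_set D m) z X u k.
Proof.
move=> oD u0 cX.
pose g w s : 'rV[R]_n := z + X (maxr 0 s) w.
have cg w : continuous (g w).
  by move=> s; apply: continuousD; [exact: cst_continuous|exact: (continuous_clamp (cX w))].
have gE w s : 0 <= s -> g w s = z + X s w by move=> s0; rewrite /g max_r.
have grid0 (j k : nat) : 0 <= j%:R * (u / (2 ^ k)%:R) by rewrite mulr_ge0// divr_ge0.
apply/seteqP; split => [w H|w [m _ H] s su].
  have [|m hm] := path_inner_set (u := u) oD (cg w).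
    by move=> s /[dup] /andP[s0 _]; rewrite gE//; exact: H.
  exists m => // k _ j jk; rewrite -gE//; apply: hm; rewrite grid0/=.
  rewrite mulrCA ler_piMr// ler_pdivrMr ?ltr0n ?expn_gt0// mul1r ler_nat//.
apply: (@inner_set_sub _ _ D m).
have := @dyadic_closed R _ (g w) _ u u0 (cg w) (@inner_set_closed _ _ D m).
case/andP: (su) => s0 _; rewrite -gE//; apply=> // k j jk; rewrite gE//.
exact: (H k).
Qed.

Lemma stays_grid_nonincreasing K z X u : nonincreasing_seq (stays_grid K z X u).
Proof.
apply/nonincreasing_seqP => k; apply/subsetPset => w h j jk.
have := h (2 * j)%N; rewrite expnS leq_mul2l jk orbT => /(_ isT).
rewrite (_ : (2 * j)%:R * _ = j%:R * (u / (2 ^ k)%:R))//.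
have k0 : (2 ^ k)%:R != 0 :> R by rewrite pnatr_eq0 expn_eq0.
by rewrite !natrM; field.
Qed.

Lemma stays_grid_sigma D m z X u k : 0 <= u ->
  proc_sigma X (stays_grid (inner_set D m) z X u k).
Proof.
move=> u0; pose TX := g_sigma_algebraType (proc_gen X).
suff : measurable (stays_grid (inner_set D m) z X u k : set TX) by [].
rewrite (_ : stays_grid _ _ _ _ _ = \bigcap_(j in `I_(2 ^ k).+1)
   [set w | inner_set D m (z + X (j%:R * (u / (2 ^ k)%:R)) w)]); last first.
  by apply/seteqP; split => w /= h j; rewrite ?ltnS => jk; apply: h; rewrite /= ?ltnS.
apply: fin_bigcap_measurable => // j _.
set t := _ * _; have t0 : 0 <= t by rewrite mulr_ge0// divr_ge0.
apply: (@measurable_closed_preimage _ _ _ TX (fun w => z + X t w)).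
  exact: inner_set_closed.
move=> i; under eq_fun do rewrite mxE.
apply: measurable_funD => //.
move=> _ B mB; rewrite setTI; apply: sub_sigma_algebra.
by exists t, i, B.
Qed.

Lemma stays_sigma (D : set 'rV[R]_n) z (X : R -> T -> 'rV[R]_n) (u : R) :
  open D -> 0 <= u -> brownian_motion P X -> proc_sigma X (stays D z X u).
Proof.
move=> oD u0 [_ _ cX _]; rewrite staysE//.
have h (F : nat -> set (g_sigma_algebraType (proc_gen X))) :
    (forall m, measurable (F m)) -> measurable (\bigcup_m F m) by exact: bigcupT_measurable.
apply: h => m; apply: bigcap_measurable => [|k _]; first by exists 0%N.
exact: stays_grid_sigma.
Qed.

Section increments.
Variables (u : R) (u_gt0 : 0 < u) (k : nat).
Local Notation N := (2 ^ k)%N.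
Let dt : R := u / N%:R.

Definition grid_increment (X : R -> T -> 'rV[R]_n) (w : T) (p : 'I_N * 'I_n) : R :=
  X (p.1.+1%:R * dt) w 0 p.2 - X (p.1%:R * dt) w 0 p.2.

Let dt0 : 0 < dt.
Proof. by rewrite divr_gt0// ltr0n expn_gt0. Qed.

Lemma measurable_grid_increment X p : brownian_motion P X ->
  measurable_fun setT (grid_increment X ^~ p).
Proof.
move=> [mX _ _ _]; have h := dt0.
by apply: measurable_funB; apply: mX; rewrite mulr_ge0// ltW.
Qed.

Let pt (f : 'I_N * 'I_n -> R) (j : nat) : 'rV[R]_n :=
  \row_i \sum_(l < N | (l < j)%N) f (l, i).

Lemma grid_pointE X w j : brownian_motion P X -> (j <= N)%N ->
  X (j%:R * dt) w = pt (grid_increment X w) j.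
Proof.
move=> [_ X0 _ _] jN; apply/rowP => i; rewrite mxE.
pose x (l : nat) : R := X (l%:R * dt) w 0 i.
rewrite -(big_ord_widen _ (fun l => x l.+1 - x l) jN).
by rewrite -(big_mkord xpredT (fun l => x l.+1 - x l)) telescope_sumr// /x mul0r X0 mxE subr0.
Qed.

Let H (K : set 'rV[R]_n) z : set ('I_N * 'I_n -> R) :=
  [set f | forall j, (j <= N)%N -> K (z + pt f j)].

Let measurable_H D m z : <<s @cylinders R ('I_N * 'I_n)%type >> (H (inner_set D m) z).
Proof.
pose TX := g_sigma_algebraType (@cylinders R ('I_N * 'I_n)%type).
suff : measurable (H (inner_set D m) z : set TX) by [].
rewrite (_ : H _ _ = \bigcap_(j in `I_N.+1) [set f : TX | inner_set D m (z + pt f j)]); last first.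
  by apply/seteqP; split => w /= h j; rewrite ?ltnS => jk; apply: h; rewrite /= ?ltnS.
apply: fin_bigcap_measurable => // j _.
apply: (@measurable_closed_preimage _ _ _ TX (fun f => z + pt f j)).
  exact: inner_set_closed.
move=> i.
rewrite (_ : (fun f => _) = (fun f : TX => z 0 i + \sum_(l < N) if (l < j)%N then (f : 'I_N * 'I_n -> R) (l, i) else 0)).
  apply: measurable_funD => //.
  by apply: measurable_sum => l; case: (l < j)%N => //; exact: measurable_coord.
by apply/funext => f; rewrite !mxE big_mkcond.
Qed.

Let stays_gridE K z X : brownian_motion P X ->
  stays_grid K z X u k = grid_increment X @^-1` H K z.
Proof.
move=> bX; apply/seteqP; split => w /= h j jN.
  by rewrite -(grid_pointE w bX jN); exact: h.
by have := h j jN; rewrite -(grid_pointE w bX jN).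
Qed.

Let increment_law_n X (A : 'I_N * 'I_n -> set R) : brownian_motion P X ->
  (forall p, measurable (A p)) ->
  P [set w | forall p, A p (grid_increment X w p)] =
  (\prod_(j < N) \prod_(i < n) fine (normal_prob 0 (Num.sqrt dt) (A (j, i))))%:E.
Proof.
move=> [_ _ _ lX] mA; have h0 := dt0.
pose B (j : nat) (i : 'I_n) : set R := oapp (fun l : 'I_N => A (l, i)) setT (insub j).
have BE (j : 'I_N) i : B j i = A (j, i) by rewrite /B valK.
have mB j i : measurable (B j i) by rewrite /B; case: insub => [l|] //=; exact: mA.
have tj j : 0 <= j%:R * dt by rewrite mulr_ge0// ltW.
have := lX N (fun j => j%:R * dt) B (tj 0%N) _ mB.
rewrite (_ : \bigcap_(j in `I_N) _ = [set w | forall p, A p (grid_increment X w p)]).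
  move=> ->; last by move=> j _; rewrite ltr_pM2r// ltr_nat.
  apply: (congr1 EFin); apply: eq_bigr => j _.
  apply: eq_bigr => i _.
  by rewrite BE -mulrBl -natr1 addrAC subrr add0r mul1r.
apply/seteqP; split => w /= h.
  by move=> [j i]; have := h j (ltn_ord j) i I; rewrite /= BE.
by move=> j jN i _ /=; have := h (Ordinal jN, i); rewrite -BE.
Qed.

Lemma stays_grid_law D m z X X' : brownian_motion P X -> brownian_motion P X' ->
  P (stays_grid (inner_set D m) z X u k) = P (stays_grid (inner_set D m) z X' u k).
Proof.
move=> bX bX'; rewrite (stays_gridE _ _ bX) (stays_gridE _ _ bX').
apply: cylinder_law_unique => //.
- by move=> p; exact: measurable_grid_increment.
- by move=> p; exact: measurable_grid_increment.
- by rewrite (le_lt_trans (probability_le1 _ _)) ?ltry.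
- by move=> A mA; rewrite [LHS](increment_law_n bX mA) [RHS](increment_law_n bX' mA).
Qed.
End increments.

(** The increments on a dyadic grid have the same law for both motions; the grid is refined at fixed
    m by decreasing limits, then m grows by increasing limits. It lets a single function describe
    the survival of both Xp and Xm. *)
Lemma stays_law (D : set 'rV[R]_n) z (X X' : R -> T -> 'rV[R]_n) (u : R) :
  open D -> 0 <= u -> brownian_motion P X -> brownian_motion P X' ->
  P (stays D z X u) = P (stays D z X' u).
Proof.
move=> oD u0 bX bX'; have [_ X0 cX _] := bX; have [_ X'0 cX' _] := bX'.
(* At u = 0 the grid degenerates to one time, where both paths are at the origin. *)
have [u_gt0|u_le0] := ltP 0 u; last first.
  have {}u0 : u = 0 by apply/eqP; rewrite eq_le u_le0.
  congr (P _); apply/seteqP; split => w h s; rewrite u0 -eq_le => /eqP <-.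
    by have := h 0; rewrite u0 lexx X0 X'0; exact.
  by have := h 0; rewrite u0 lexx X0 X'0; exact.
have mG Z : brownian_motion P Z -> forall m k, measurable (stays_grid (inner_set D m) z Z u k).
  by move=> bZ m k; apply: (proc_sigma_measurable bZ); exact: stays_grid_sigma.
pose E Z m := \bigcap_k stays_grid (inner_set D m) z Z u k.
have mE Z : brownian_motion P Z -> forall m, measurable (E Z m).
  by move=> bZ m; apply: bigcap_measurable => [|k _]; [exists 0%N|exact: mG].
have ninc Z : nondecreasing_seq (E Z).
  move=> m p mp; apply/subsetPset => w h k _ j jk.
  by apply: (inner_set_mono mp); exact: (h k).
have EE m : P (E X m) = P (E X' m).
  have c Z : brownian_motion P Z ->
      P \o (stays_grid (inner_set D m) z Z u) @ \oo --> P (E Z m).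
    move=> bZ; apply: nonincreasing_cvg_mu; [|exact: mG|exact: mE|exact: stays_grid_nonincreasing].
    by rewrite (le_lt_trans (probability_le1 _ _)) ?ltry//; exact: mG.
  have := c X bX; rewrite (_ : _ \o _ = P \o (stays_grid (inner_set D m) z X' u)).
    by move=> h; exact: (cvg_unique _ h (c X' bX')).
  by apply/funext => k /=; exact: stays_grid_law.
have c Z : brownian_motion P Z -> P \o E Z @ \oo --> P (\bigcup_m E Z m).
  move=> bZ; apply: nondecreasing_cvg_mu; [exact: mE| |exact: ninc].
  by apply: bigcupT_measurable => m; exact: mE.
rewrite (staysE z oD u0 cX) (staysE z oD u0 cX'); have := c X bX.
rewrite (_ : P \o _ = P \o E X'); last by apply/funext => m /=; exact: EE.
by move=> h; exact: (cvg_unique _ h (c X' bX')).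
Qed.

End survival_law.

(** * Iterated Brownian motion *)

Section iterated.
Context {R : realType} d (T : measurableType d) (P : probability T R) (n : nat).
Variables (Xp Xm : R -> T -> 'rV[R]_n) (Y : R -> T -> 'rV[R]_1).
Hypotheses (bXp : brownian_motion P Xp) (bXm : brownian_motion P Xm)
  (bY : brownian_motion P Y) (ind : indep3 P Xp Xm Y).
Variables (D : set 'rV[R]_n) (oD : open D) (z : 'rV[R]_n).

Definition iterated_stays (t : R) : set T :=
  [set w | (t%:E < exit_time D (fun s => iterated_bm Xp Xm Y z s w))%E].

(** Both motions vanish at time 0, so one summand is always zero. The formula has no case
    distinction, which makes continuity in s evident. *)
Lemma iterated_bmE s w : iterated_bm Xp Xm Y z s w =
  z + (Xp (maxr 0 (Y s w 0 0)) w + Xm (maxr 0 (- Y s w 0 0)) w).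
Proof.
have [_ Xp0 _ _] := bXp; have [_ Xm0 _ _] := bXm.
rewrite /iterated_bm /two_sided; case: ifPn => [y0|].
  by rewrite max_r// max_l ?oppr_le0// Xm0 addr0.
rewrite -ltNge => y0.
by rewrite max_l ?(ltW y0)// max_r ?oppr_ge0 ?(ltW y0)// Xp0 add0r.
Qed.

Lemma iterated_bm_continuous w :
  {within `[0, +oo[, continuous (fun s => iterated_bm Xp Xm Y z s w)}.
Proof.
have [_ _ cXp _] := bXp; have [_ _ cXm _] := bXm.
have c : continuous (fun s : R => z + (Xp (maxr 0 (coord_path Y s w)) w +
    Xm (maxr 0 (- coord_path Y s w)) w)).
  move=> s; apply: cvgD; first exact: cvg_cst.
  apply: cvgD.
    apply: (@continuous_comp _ _ _ (fun u => coord_path Y u w) (fun u : R => Xp (maxr 0 u) w)).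
      exact: (coord_path_continuous bY).
    exact: (continuous_clamp (cXp w)).
  apply: (@continuous_comp _ _ _ (fun u => - coord_path Y u w) (fun u : R => Xm (maxr 0 u) w)).
    exact: (coord_path_opp_continuous bY).
  exact: (continuous_clamp (cXm w)).
apply: (subspace_eq_continuous _ (continuous_subspaceT c)) => s; rewrite inE/= in_itv/= andbT => s0.
by rewrite /from_subspace iterated_bmE coord_pathE.
Qed.

Lemma stays_exit_time X u w : brownian_motion P X -> 0 <= u ->
  (u%:E < exit_time D (fun s => (z + X s w)%R))%E <-> stays D z X u w.
Proof.
move=> [_ _ cX _] u0; apply: exit_time_gtP => //.
have c : continuous (fun s : R => z + X (maxr 0 s) w).
  by move=> s; apply: continuousD; [exact: cst_continuous|exact: (continuous_clamp (cX w))].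
apply: (subspace_eq_continuous _ (continuous_subspaceT c)) => s; rewrite inE/= in_itv/= andbT => s0.
by rewrite /from_subspace max_r.
Qed.

Section fixed_time.
Variables (t : R) (t_ge0 : 0 <= t).
Local Notation S := (rise Y t).
Local Notation I := (fall Y t).

Lemma path_IVT (g : R -> R) (s : R) : continuous g -> g 0 = 0 ->
  0 <= s <= running_max g t -> exists2 r, 0 <= r <= t & g r = s.
Proof.
have t0 := t_ge0; move=> cg g0 /andP[s0]; have [c /andP[c0 ct] [-> _]] := running_max_attained cg t0.
move=> sc; have [||r] := @IVT _ g 0 c s c0.
- exact: continuous_subspaceT.
- by rewrite g0 ge_min s0 le_max sc orbT.
by rewrite in_itv/= => /andP[r0 rc] <-; exists r => //; rewrite r0 (le_trans rc).
Qed.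

Lemma iterated_staysP w : iterated_stays t w <->
  stays D z Xp (S w) w /\ stays D z Xm (I w) w.
Proof.
have t0 := t_ge0; have [_ Xp0 _ _] := bXp; have [_ Xm0 _ _] := bXm.
have cy : continuous (coord_path Y ^~ w) by exact: (coord_path_continuous bY).
have cNy : continuous (fun s => - coord_path Y s w) by exact: (coord_path_opp_continuous bY).
rewrite /iterated_stays/= exit_time_gtP//; last exact: iterated_bm_continuous.
split=> [h|[hp hm] s /[dup] st /andP[s0 _]]; last first.
  have /= yS := running_max_ge cy t0 st; have /= yI := running_max_ge cNy t0 st.
  rewrite /iterated_bm /two_sided -coord_pathE//; case: ifPn => [y0|].
    by apply: hp; rewrite y0.
  by rewrite -ltNge => y0; apply: hm; rewrite oppr_ge0 (ltW y0).
split=> s /[dup] ss.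
  move=> /(path_IVT cy (coord_path0 bY w)) [r /[dup] rt /andP[r0 _] yr].
  have := h r rt; rewrite iterated_bmE -coord_pathE// yr; move: ss => /andP[s0 _].
  by rewrite max_r// max_l ?oppr_le0// Xm0 addr0.
have y0 : - coord_path Y 0 w = 0 by rewrite (coord_path0 bY) oppr0.
move=> /(path_IVT cNy y0) [r /[dup] rt /andP[r0 _] /= yr].
have := h r rt; rewrite iterated_bmE -coord_pathE// yr; move: ss => /andP[s0 _].
by rewrite (max_r s0) -[coord_path Y r w]opprK yr max_l ?oppr_le0// Xp0 add0r.
Qed.

(** By openness of [D], survival up to [V w] leaves a gap before the exit time, and a rational q in
    this gap reduces the random time to countably many fixed ones. *)
Lemma measurable_stays_random X (V : T -> R) : brownian_motion P X ->
  (forall w, 0 <= V w) -> measurable_fun setT V ->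
  measurable [set w | stays D z X (V w) w].
Proof.
move=> bX V0 mV.
rewrite (_ : [set w | _] = \bigcup_(q : rat)
   (if (0 <= ratr q :> R) then [set w | V w <= ratr q] `&` stays D z X (ratr q) else set0)).
  apply: bigcupT_measurable_rat => q; case: ifP => // q0; apply: measurableI.
    exact: measurable_sublevel.
  by apply: (proc_sigma_measurable bX); apply: stays_sigma bX.
apply/seteqP; split => w /=; last first.
  move=> [q _]; case: ifP => // q0 [Vq h] s /andP[s0 sV]; apply: h.
  by rewrite s0 (le_trans sV).
move=> /(stays_exit_time w bX (V0 w)) h.
have [r Vr rt] : exists2 r : R, V w < r & (r%:E <= exit_time D (fun s => (z + X s w)%R))%E.
  case: exit_time h => [e| |//]; first by rewrite lte_fin => h; exists e.
  by move=> _; exists (V w + 1); [rewrite ltrDl|rewrite leey].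
have [q] := rat_in_itvoo Vr; rewrite in_itv/= => /andP[q1 q2].
have q0 : (0 : R) <= ratr q by rewrite (le_trans (V0 w))// ltW.
exists q => //; rewrite q0; split; first exact: ltW.
by apply/(stays_exit_time w bX q0); rewrite (lt_le_trans _ rt)// lte_fin.
Qed.

Lemma measurable_iterated_stays : measurable (iterated_stays t).
Proof.
have t0 := t_ge0; have [mS mI] := measurable_rise_fall bY t0.
rewrite (_ : iterated_stays t = [set w | stays D z Xp (S w) w] `&` [set w | stays D z Xm (I w) w]).
  apply: measurableI; apply: measurable_stays_random => // w; first exact: (rise_ge0 bY).
  exact: (fall_ge0 bY).
by apply/seteqP; split => w /iterated_staysP.
Qed.

Section cells.
Variables (eta : R) (eta_gt0 : 0 < eta).

Definition cell (p : nat * nat) : set T :=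
  [set w | p.1%:R * eta <= S w < p.1.+1%:R * eta /\ p.2%:R * eta <= I w < p.2.+1%:R * eta].

(** Cells are numbered by natural numbers, with the empty set for codes of no pair, so that
    countable additivity reads as a series. *)
Let ncell (k : nat) : set T := if pickle_inv k is Some p then cell p else set0.

Lemma cell_sigma p : proc_sigma Y (cell p).
Proof.
have t0 := t_ge0; pose TY := g_sigma_algebraType (proc_gen Y).
suff : measurable (cell p : set TY) by [].
have mS := measurable_rise bY t0; have mI := measurable_fall bY t0.
rewrite (_ : cell p = (S : TY -> R) @^-1` `[p.1%:R * eta, p.1.+1%:R * eta[ `&`
    (I : TY -> R) @^-1` `[p.2%:R * eta, p.2.+1%:R * eta[).
  apply: measurableI.
    by have := mS measurableT _ (measurable_itv `[p.1%:R * eta, p.1.+1%:R * eta[); rewrite setTI.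
  by have := mI measurableT _ (measurable_itv `[p.2%:R * eta, p.2.+1%:R * eta[); rewrite setTI.
by apply/seteqP; split => w /=; rewrite !in_itv.
Qed.

Let measurable_cell p : measurable (cell p).
Proof. by apply: (proc_sigma_measurable bY); exact: cell_sigma. Qed.

Let measurable_ncell k : measurable (ncell k).
Proof. by rewrite /ncell; case: pickle_inv. Qed.

Let grid_cell_inj (x : R) (i j : nat) :
  i%:R * eta <= x < i.+1%:R * eta -> j%:R * eta <= x < j.+1%:R * eta -> i = j.
Proof.
have e0 := eta_gt0; move=> /andP[i1 i2] /andP[j1 j2]; apply/eqP; rewrite eqn_leq.
apply/andP; split; rewrite -ltnS -(ltr_nat R) -(ltr_pM2r e0).
  exact: le_lt_trans j2.
exact: le_lt_trans i2.
Qed.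

Let ncell_trivIset : trivIset setT ncell.
Proof.
apply/trivIsetP => a b _ _ ab; apply/seteqP; split => // w []; rewrite /ncell.
have := pickle_invK (T := (nat * nat)%type) a; have := pickle_invK (T := (nat * nat)%type) b.
case: (pickle_inv a) => [[i1 j1]|//]; case: (pickle_inv b) => [[i2 j2]|//] /= eb ea.
move=> [/= h1 h2] [/= h3 h4]; move: ab; apply/negP; rewrite negbK -ea -eb.
by rewrite (grid_cell_inj h1 h3) (grid_cell_inj h2 h4).
Qed.

Let ncell_cover : \bigcup_k ncell k = setT.
Proof.
have t0 := t_ge0; have e0 := eta_gt0.
apply/seteqP; split => // w _.
exists (pickle (Num.truncn (S w / eta), Num.truncn (I w / eta))) => //.
have h x : 0 <= x -> (Num.truncn (x / eta))%:R * eta <= x < (Num.truncn (x / eta)).+1%:R * eta.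
  move=> x0; have := truncn_itv (divr_ge0 x0 (ltW e0)).
  by rewrite ler_pdivlMr// ltr_pdivrMr.
rewrite /ncell pickleK_inv; split => /=; apply: h; first exact: (rise_ge0 bY).
exact: (fall_ge0 bY).
Qed.

Local Notation f u := (P (stays D z Xp u)).

Let cell_indep p u v : 0 <= u -> 0 <= v ->
  P (stays D z Xp u `&` stays D z Xm v `&` cell p) = (f u * f v * P (cell p))%E.
Proof.
move=> u0 v0; rewrite (stays_law z oD v0 bXp bXm); apply: ind.
- exact: stays_sigma bXp.
- exact: stays_sigma bXm.
- exact: cell_sigma.
Qed.

Let measurable_stays X u : brownian_motion P X -> 0 <= u -> measurable (stays D z X u).
Proof. by move=> bX u0; apply: (proc_sigma_measurable bX); exact: stays_sigma bX. Qed.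

Let grid_ge0 (i : nat) : 0 <= i%:R * eta.
Proof. by have e0 := eta_gt0; rewrite mulr_ge0// ltW. Qed.

Let stays_mono (X : R -> T -> 'rV[R]_n) (u v : R) (w : T) : u <= v -> stays D z X v w -> stays D z X u w.
Proof. by move=> uv h s /andP[s0 su]; apply: h; rewrite s0 (le_trans su). Qed.

Let iterated_sum : P (iterated_stays t) = (\sum_(k <oo) P (iterated_stays t `&` ncell k))%E.
Proof.
have mE := measurable_iterated_stays.
have mEk k : measurable (iterated_stays t `&` ncell k) by exact: measurableI.
rewrite -[X in P X = _]setIT -ncell_cover setI_bigcupr measure_semi_bigcup//.
  exact: trivIset_setIl.
exact: bigcupT_measurable.
Qed.

Let integral_sum (k : T -> R) : measurable_fun setT k -> (forall w, 0 <= k w) ->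
  (\int[P]_w (k w)%:E = \sum_(j <oo) \int[P]_(w in ncell j) (k w)%:E)%E.
Proof.
move=> mk k0; rewrite -ncell_cover ge0_integral_bigcup//.
- by rewrite ncell_cover; exact/measurable_EFinP.
- by move=> w _; rewrite lee_fin.
Qed.

(* On a cell the range of Y is known up to eta, and the cell is independent of the
   survival of Xp and Xm up to fixed times. *)
Lemma iterated_stays_le (k : T -> R) : measurable_fun setT k -> (forall w, 0 <= k w) ->
  (forall p w, cell p w -> (f (p.1%:R * eta) * f (p.2%:R * eta) <= (k w)%:E)%E) ->
  (P (iterated_stays t) <= \int[P]_w (k w)%:E)%E.
Proof.
have t0 := t_ge0; move=> mk k0 fk; have mE := measurable_iterated_stays.
rewrite iterated_sum (integral_sum mk k0); apply: lee_nneseries => // j _.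
rewrite /ncell; case: (pickle_inv j) => [p|]; last by rewrite setI0 measure0 integral_set0.
have mU := measurable_stays bXp (grid_ge0 p.1); have mV := measurable_stays bXm (grid_ge0 p.2).
apply: (@le_trans _ _ (f (p.1%:R * eta) * f (p.2%:R * eta) * P (cell p))%E).
  rewrite -cell_indep//; apply: le_measure; rewrite ?inE.
  - exact: measurableI.
  - by apply: measurableI => //; exact: measurableI.
  move=> w [/(iterated_staysP) [hS hI] cw]; have [/andP[c1 _] /andP[c2 _]] := cw.
  by split => //; split; [exact: stays_mono hS|exact: stays_mono hI].
rewrite -integral_cst//; apply: ge0_le_integral => //.
- by move=> w _; rewrite mule_ge0.
- exact/measurable_EFinP/measurable_funTS.
- by move=> w /fk.
Qed.

(** Upper corners replace lower ones: survival of Xp and Xm up to the upper corner of a cell implies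
    survival up to the rise and the fall. *)
Lemma iterated_stays_ge (k : T -> R) : measurable_fun setT k -> (forall w, 0 <= k w) ->
  (forall p w, cell p w -> ((k w)%:E <= f (p.1.+1%:R * eta) * f (p.2.+1%:R * eta))%E) ->
  (\int[P]_w (k w)%:E <= P (iterated_stays t))%E.
Proof.
have t0 := t_ge0; move=> mk k0 fk; have mE := measurable_iterated_stays.
rewrite iterated_sum (integral_sum mk k0); apply: lee_nneseries => // j _.
  by rewrite integral_ge0// => w _; rewrite lee_fin.
rewrite /ncell; case: (pickle_inv j) => [p|]; last by rewrite setI0 measure0 integral_set0.
have mU := measurable_stays bXp (grid_ge0 p.1.+1); have mV := measurable_stays bXm (grid_ge0 p.2.+1).
apply: (@le_trans _ _ (f (p.1.+1%:R * eta) * f (p.2.+1%:R * eta) * P (cell p))%E).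
  rewrite -integral_cst//; apply: ge0_le_integral => //.
  - by move=> w _; rewrite lee_fin.
  - exact/measurable_EFinP/measurable_funTS.
  - by move=> w /fk.
rewrite -cell_indep//; apply: le_measure; rewrite ?inE.
- by apply: measurableI => //; exact: measurableI.
- exact: measurableI.
move=> w [[hS hI] cw]; have [/andP[_ c1] /andP[_ c2]] := cw.
by split => //; apply/iterated_staysP; split; [apply: stays_mono hS|apply: stays_mono hI]; exact: ltW.
Qed.

End cells.
End fixed_time.
End iterated.

Section limits.
Context {R : realType}.

Lemma limf_esup_le (f : R -> \bar R) (l : R) :
  (forall e, 0 < e -> \forall t \near +oo, (f t <= (l + e)%:E)%E) ->
  (limf_esup f +oo%R <= l%:E)%E.
Proof.
move=> h; apply/lee_addgt0Pr => e e0; rewrite limf_esupE.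
apply: ge_ereal_inf; exists (ereal_sup (f @` [set t | (f t <= (l + e)%:E)%E])).
  by exists [set t | (f t <= (l + e)%:E)%E] => //; exact: h.
by apply: ge_ereal_sup => _ [t /= ft <-].
Qed.

Lemma limf_einf_ge (f : R -> \bar R) (l : R) :
  (forall e, 0 < e -> \forall t \near +oo, ((l - e)%:E <= f t)%E) ->
  (l%:E <= limf_einf f +oo%R)%E.
Proof.
move=> h; rewrite /limf_einf leeNr -EFinN; apply: limf_esup_le => e e0.
by apply: filterS (h e e0) => t; rewrite leeNl -EFinN opprD opprK.
Qed.

Lemma limf_einf_le_esup (f : R -> \bar R) :
  (limf_einf f +oo%R <= limf_esup f +oo%R)%E.
Proof.
rewrite limf_einfE limf_esupE; apply: ge_ereal_sup => _ [A FA <-].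
apply: le_ereal_inf_tmp => _ [B FB <-].
have [t [At Bt]] : (A `&` B) !=set0 by apply: (@filter_ex _ (+oo%R : set_system R)); exact: filterI.
apply: (@le_trans _ _ (f t)).
  by apply: ereal_inf_lbound; exists t.
by apply: ereal_sup_ubound; exists t.
Qed.

End limits.

(** * Bounds for the survival of iterated Brownian motion *)

Section exit_asymptotics.
Context {R : realType} d (T : measurableType d) (P : probability T R) (n : nat).
Variables (Xp Xm : R -> T -> 'rV[R]_n) (Y : R -> T -> 'rV[R]_1).
Hypotheses (bXp : brownian_motion P Xp) (bXm : brownian_motion P Xm)
  (bY : brownian_motion P Y) (ind : indep3 P Xp Xm Y).
Variables (D : set 'rV[R]_n) (oD : open D) (z : 'rV[R]_n).
Variables (lam A : R) (lam_gt0 : 0 < lam) (A_gt0 : 0 < A).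
Local Notation f u := (fine (P (stays D z Xp u))).
Hypothesis f_cvg : expR (lam * t) * f t @[t --> +oo] --> A.

Let fE u : 0 <= u -> P (stays D z Xp u) = (f u)%:E.
Proof.
move=> u0; rewrite fineK// ge0_fin_numE//; apply: (le_lt_trans (probability_le1 _ _)).
  by apply: (proc_sigma_measurable bXp); exact: stays_sigma bXp.
by rewrite ltry.
Qed.

Let f0 u : 0 <= f u. Proof. exact: fine_ge0. Qed.

Let f1 u : 0 <= u -> f u <= 1.
Proof.
move=> u0; rewrite -lee_fin -fE//; apply: probability_le1.
by apply: (proc_sigma_measurable bXp); exact: stays_sigma bXp.
Qed.

Let E t w : R := expR (- lam * (rise Y t w + fall Y t w)).

Section fixed_time.
Variables (t : R) (t_gt0 : 0 < t).
Let t0 : 0 <= t. Proof. exact: ltW. Qed.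
Local Notation S := (rise Y t).
Local Notation I := (fall Y t).

Let mS : measurable_fun setT S. Proof. by case: (measurable_rise_fall bY t0). Qed.
Let mI : measurable_fun setT I. Proof. by case: (measurable_rise_fall bY t0). Qed.

Let mE : measurable_fun setT (E t).
Proof.
by apply: measurableT_comp => //; apply: measurable_funM => //; exact: measurable_funD.
Qed.

Let integral_indicM (B : set T) :
  (\int[P]_w (\1_B w * E t w)%:E = \int[P]_(w in B) (E t w)%:E)%E.
Proof.
rewrite [RHS]integral_mkcond; apply: eq_integral => w _; rewrite patchE indicE.
by case: ifPn => _; rewrite ?mul1r ?mul0r.
Qed.

Let mind (B : set T) : measurable B -> measurable_fun setT (fun w => \1_B w * E t w).
Proof. by move=> mB; apply: measurable_funM => //; exact: measurable_indic. Qed.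

Let ind0 (B : set T) w : 0 <= \1_B w * E t w.
Proof. by rewrite mulr_ge0 ?expR_ge0. Qed.

(** The cells have side [x], so each lower corner is within [x] of the true value: two corners cost
    exp (2 lam x), and a corner below M forces a value below M + x. The second term collects both
    edges. *)
Lemma iterated_stays_upper x M : 0 < x -> 0 < M ->
  (forall u, M <= u -> expR (lam * u) * f u <= A + x) ->
  (P (iterated_stays Xp Xm Y D z t) <=
   (expR (2 * lam * x) * (A + x) ^+ 2 * lam ^+ 2)%:E * laplace_int lam 1 t +
   (expR (2 * lam * x) * ((A + x) * expR (lam * M) + expR (lam * M) ^+ 2) *
     (2 * (2 * lam * expR (3 * lam * (M + x)))))%:E * laplace_int lam 0 t)%E.
Proof.
have l0 := lam_gt0; have A0 := A_gt0; move=> x0 M0 hf.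
set e2 := expR (2 * lam * x); set al := A + x; set be := expR (lam * M).
have al0 : 0 < al by rewrite addr_gt0.
have be0 : 0 < be by exact: expR_gt0.
pose BS := [set w | S w <= M + x]; pose BI := [set w | I w <= M + x].
have mBS : measurable BS by exact: measurable_sublevel.
have mBI : measurable BI by exact: measurable_sublevel.
(* Below M only f <= 1 is known; 1 <= exp (lam M) exp (- lam u) brings it to the same exponential
   form. *)
have fb u : 0 <= u -> f u <= expR (- (lam * u)) * (al + be * (u < M)%R%:R).
  move=> u0; rewrite expRN -ler_pdivrMl ?invr_gt0 ?expR_gt0// invrK.
  have [uM|Mu] := ltP u M; last by rewrite mulr0 addr0; exact: hf.
  rewrite mulr1; apply: (@le_trans _ _ be); last by rewrite lerDr ltW.
  apply: (@le_trans _ _ (expR (lam * u))); first by rewrite ler_piMr ?expR_ge0 ?f1.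
  by rewrite ler_expR ler_pM2l// ltW.
pose a := e2 * al ^+ 2; pose b := e2 * (al * be + be ^+ 2).
have a0 : 0 <= a by rewrite mulr_ge0 ?expR_ge0 ?sqr_ge0.
have b0 : 0 <= b by rewrite mulr_ge0 ?expR_ge0// addr_ge0 ?sqr_ge0// mulr_ge0// ltW.
pose k w := a * E t w + b * (\1_BS w * E t w + \1_BI w * E t w).
have mk : measurable_fun setT k.
  apply: measurable_funD; first exact: measurable_funM.
  by apply: measurable_funM => //; apply: measurable_funD; exact: mind.
have k0 w : 0 <= k w.
  by apply: addr_ge0; apply: mulr_ge0 => //; [exact: expR_ge0|exact: addr_ge0].
have cell_bound (i : nat) (V : T -> R) w : i%:R * x <= V w < i.+1%:R * x ->
    f (i%:R * x) <= expR (lam * x) * expR (- lam * V w) * (al + be * (V w <= M + x)%R%:R).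
  move=> /andP[iV Vi]; have ix0 : 0 <= i%:R * x by rewrite mulr_ge0// ltW.
  rewrite -natr1 mulrDl mul1r in Vi.
  apply: (le_trans (fb _ ix0)); apply: ler_pM; rewrite ?expR_ge0//.
  - by rewrite addr_ge0 ?(ltW al0)// mulr_ge0// ltW.
  - by rewrite -expRD ler_expR; nra.
  rewrite lerD2l ler_pM2l// ler_nat; case: (ltP _ M) => // h.
  by rewrite (_ : V w <= M + x) //; lra.
have := @iterated_stays_le _ _ _ _ _ _ _ _ bXp bXm bY ind _ oD z t t0 x x0 k mk k0.
move=> /(_ _)/le_trans; apply.
  move=> p w [hS hI]; have ix0 (i : nat) : 0 <= i%:R * x by rewrite mulr_ge0// ltW.
  rewrite (fE (ix0 p.1)) (fE (ix0 p.2)) -EFinM lee_fin.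
  apply: (le_trans (ler_pM (f0 _) (f0 _) (cell_bound _ S w hS) (cell_bound _ I w hI))).
  rewrite /k /E !indicE.
  have -> : (w \in BS) = (S w <= M + x) by apply/idP/idP; rewrite inE.
  have -> : (w \in BI) = (I w <= M + x) by apply/idP/idP; rewrite inE.
  have E2 : e2 = expR (lam * x) * expR (lam * x).
    by rewrite -expRD; congr expR; ring.
  rewrite /a /b E2 (mulrDr (- lam)) expRD.
  set q := expR (lam * x); set qS := expR (- lam * S w); set qI := expR (- lam * I w).
  have Q : 0 <= q * q * (qS * qI) by rewrite !mulr_ge0 ?expR_ge0.
  set p1 := (_ <= M + x); set p2 := (_ <= M + x).
  (* Every term of the expansion except al^2 carries an edge indicator, and the product of two
     indicators is at most half their sum. *)
  have h : (al + be * p1%:R) * (al + be * p2%:R) <= al ^+ 2 + (al * be + be ^+ 2) * (p1%:R + p2%:R).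
    have ab : 0 <= al * be by rewrite mulr_ge0// ltW.
    have bb : 0 <= be ^+ 2 by rewrite sqr_ge0.
    by case: p1; case: p2 => /=; lra.
  have := ler_wpM2l Q h; lra.
have mE' : measurable_fun setT (fun w => (E t w)%:E) by exact/measurable_EFinP.
have mB' B : measurable B -> measurable_fun setT (fun w => (\1_B w * E t w)%:E).
  by move=> mB; apply/measurable_EFinP; exact: mind.
have nn B w : (0 <= (\1_B w * E t w)%:E)%E by rewrite lee_fin.
have nE w : (0 <= (E t w)%:E)%E by rewrite lee_fin expR_ge0.
have -> : (\int[P]_w (k w)%:E = a%:E * range_exp lam P Y t +
    b%:E * (\int[P]_(w in BS) (E t w)%:E + \int[P]_(w in BI) (E t w)%:E))%E.
  rewrite -!integral_indicM -ge0_integralD//; [|exact: mB'|exact: mB'].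
  have mB2 : measurable_fun setT (fun w => (\1_BS w * E t w)%:E + (\1_BI w * E t w)%:E)%E.
    by apply: emeasurable_funD; exact: mB'.
  rewrite -ge0_integralZl//; last by move=> w _; exact: adde_ge0.
  rewrite /range_exp -ge0_integralZl// -ge0_integralD//.
  - by move=> w _; apply: mule_ge0 => //; rewrite lee_fin expR_ge0.
  - exact: measurable_funeM.
  - by move=> w _; apply: mule_ge0 => //; exact: adde_ge0.
  - exact: measurable_funeM.
apply: leeD.
  rewrite -/a [X in (_ <= X * _)%E]EFinM -muleA lee_wpmul2l//; exact: (range_exp_le lam_gt0 bY t_gt0).
have Mx : 0 < M + x by rewrite addr_gt0.
rewrite -/b [X in (_ <= X * _)%E]EFinM -muleA lee_wpmul2l//.
set c := 2 * lam * _; have c0 : (0 <= c%:E)%E by rewrite lee_fin !mulr_ge0 ?expR_ge0// ltW.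
rewrite (_ : (2 * c)%:E = c%:E + c%:E)%E; last by rewrite -EFinD; congr EFin; ring.
rewrite ge0_muleDl//; apply: leeD.
  exact: (rise_edge_le lam_gt0 bY t_gt0 Mx).
exact: (fall_edge_le lam_gt0 bY t_gt0 Mx).
Qed.

(** Away from the edges both upper corners exceed M and are within [x] of the rise and the fall. The
    edge contribution is then added on the right, which avoids subtracting extended reals. *)
Lemma iterated_stays_lower x M : 0 < x < A -> 0 < M ->
  (forall u, M <= u -> A - x <= expR (lam * u) * f u) ->
  ((expR (- (2 * lam * x)) * (A - x) ^+ 2 * (lam ^+ 2 * (2 / pi)))%:E * laplace_int lam 1 t <=
   P (iterated_stays Xp Xm Y D z t) +
   (expR (- (2 * lam * x)) * (A - x) ^+ 2 * (2 * (2 * lam * expR (3 * lam * M))))%:E *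
     laplace_int lam 0 t)%E.
Proof.
have l0 := lam_gt0; move=> /andP[x0 xA] M0 hf.
set al := A - x; have al0 : 0 < al by rewrite subr_gt0.
pose a := expR (- (2 * lam * x)) * al ^+ 2.
have a0 : 0 <= a by rewrite mulr_ge0 ?expR_ge0 ?sqr_ge0.
pose BS := [set w | S w <= M]; pose BI := [set w | I w <= M].
have mBS : measurable BS by exact: measurable_sublevel.
have mBI : measurable BI by exact: measurable_sublevel.
pose G := ~` (BS `|` BI).
have mG : measurable G by apply: measurableC; exact: measurableU.
have mE' : measurable_fun setT (fun w => (E t w)%:E) by exact/measurable_EFinP.
have mB' B : measurable B -> measurable_fun setT (fun w => (\1_B w * E t w)%:E).
  by move=> mB; apply/measurable_EFinP; exact: mind.
have nn B w : (0 <= (\1_B w * E t w)%:E)%E by rewrite lee_fin.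
have nE w : (0 <= (E t w)%:E)%E by rewrite lee_fin expR_ge0.
have split3 : (range_exp lam P Y t <= \int[P]_(w in G) (E t w)%:E +
    (\int[P]_(w in BS) (E t w)%:E + \int[P]_(w in BI) (E t w)%:E))%E.
  rewrite -!integral_indicM -ge0_integralD//; [|exact: mB'|exact: mB'].
  have mB2 : measurable_fun setT (fun w => (\1_BS w * E t w)%:E + (\1_BI w * E t w)%:E)%E.
    by apply: emeasurable_funD; exact: mB'.
  have nn2 w : (0 <= (\1_BS w * E t w)%:E + (\1_BI w * E t w)%:E)%E by exact: adde_ge0.
  have mGE := mB' _ mG.
  rewrite -ge0_integralD//; apply: ge0_le_integral => //.
  - exact: emeasurable_funD.
  - move=> w _; rewrite -!EFinD lee_fin -!mulrDl ler_peMl ?expR_ge0//.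
    rewrite !indicE /G in_setC in_setU.
    by case: (w \in BS); case: (w \in BI) => /=; rewrite ?(addr0, add0r) ?lerDl.
have fb u : 0 <= u -> M <= u -> expR (- (lam * u)) * al <= f u.
  by move=> u0 Mu; rewrite expRN ler_pdivrMl ?expR_gt0//; exact: hf.
have cell_bound (i : nat) (V : T -> R) w : i%:R * x <= V w < i.+1%:R * x -> M < V w ->
    expR (- (lam * x)) * expR (- lam * V w) * al <= f (i.+1%:R * x).
  move=> /andP[iV Vi] MV; have ix0 : 0 <= i.+1%:R * x by rewrite mulr_ge0// ltW.
  apply: (le_trans _ (fb _ ix0 _)); last by rewrite ltW// (lt_trans MV).
  rewrite ler_pM2r// -expRD ler_expR -[_ * V w]mulrC; rewrite -natr1 mulrDl mul1r; nra.
have lower : (a%:E * \int[P]_(w in G) (E t w)%:E <= P (iterated_stays Xp Xm Y D z t))%E.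
  rewrite -integral_indicM -ge0_integralZl//; last exact: mB'.
  pose k w := a * (\1_G w * E t w).
  apply: (@iterated_stays_ge _ _ _ _ _ _ _ _ bXp bXm bY ind _ oD z t t0 x x0 k).
  - by apply: measurable_funM => //; exact: mind.
  - by move=> w; exact: mulr_ge0.
  move=> p w [hS hI]; have ix0 (i : nat) : 0 <= i%:R * x by rewrite mulr_ge0// ltW.
  rewrite (fE (ix0 p.1.+1)) (fE (ix0 p.2.+1)) -EFinM lee_fin /k indicE.
  case: (boolP (w \in G)) => [|_]; last by rewrite mul0r mulr0 mulr_ge0.
  rewrite inE => /not_orP[/negP + /negP]; rewrite -!ltNge mul1r => MS MI.
  apply: le_trans (ler_pM _ _ (cell_bound _ S w hS MS) (cell_bound _ I w hI MI)).
  - have E2 : expR (- (2 * lam * x)) = expR (- (lam * x)) * expR (- (lam * x)).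
      by rewrite -expRD; congr expR; ring.
    by rewrite /a /E E2 (mulrDr (- lam)) expRD le_eqVlt; apply/orP; left; apply/eqP; ring.
  - by rewrite mulr_ge0 ?(ltW al0)// mulr_ge0 ?expR_ge0.
  - by rewrite mulr_ge0 ?(ltW al0)// mulr_ge0 ?expR_ge0.
rewrite -/a [X in (X * _ <= _)%E]EFinM -muleA.
apply: (@le_trans _ _ (a%:E * range_exp lam P Y t)%E).
  by rewrite lee_wpmul2l//; exact: (range_exp_ge lam_gt0 bY t_gt0).
apply: (@le_trans _ _ (a%:E * (\int[P]_(w in G) (E t w)%:E +
    (\int[P]_(w in BS) (E t w)%:E + \int[P]_(w in BI) (E t w)%:E)))%E).
  by rewrite lee_wpmul2l.
rewrite ge0_muleDr//; last 2 first.
- by apply: integral_ge0 => w _; exact: nE.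
- by apply: adde_ge0; apply: integral_ge0 => w _; exact: nE.
apply: leeD => //.
rewrite [X in (_ <= X * _)%E]EFinM -muleA lee_wpmul2l//.
set c := 2 * lam * _; have c0 : (0 <= c%:E)%E by rewrite lee_fin !mulr_ge0 ?expR_ge0// ltW.
rewrite (_ : (2 * c)%:E = c%:E + c%:E)%E; last by rewrite -EFinD; congr EFin; ring.
rewrite ge0_muleDl//; apply: leeD.
  exact: (rise_edge_le lam_gt0 bY t_gt0 M0).
exact: (fall_edge_le lam_gt0 bY t_gt0 M0).
Qed.
End fixed_time.

(** One continuous function serves both bounds: its value at x is the upper constant and its value
    at - x the lower one. *)
Let small_shift (c e : R) : 0 < e -> exists2 x, 0 < x < A &
  expR (2 * lam * x) * (A + x) ^+ 2 * c < A ^+ 2 * c + e /\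
  A ^+ 2 * c - e < expR (- (2 * lam * x)) * (A - x) ^+ 2 * c.
Proof.
have A0 := A_gt0; move=> e0; pose q (y : R) := expR (2 * lam * y) * (A + y) ^+ 2 * c.
have cq : q y @[y --> (0 : R)] --> q 0.
  apply: cvgM; last exact: cvg_cst.
  apply: cvgM.
    apply: continuous_cvg; first exact: continuous_expR.
    by apply: cvgM; [exact: cvg_cst|exact: cvg_id].
  by rewrite /= !expr2; apply: cvgM; apply: cvgD; [exact: cvg_cst|exact: cvg_id|exact: cvg_cst|exact: cvg_id].
have q0 : q 0 = A ^+ 2 * c by rewrite /q mulr0 expR0 mul1r addr0.
have /cvgrPdist_lt/(_ e e0)[dl /= dl0 hd] := cq.
pose x := Num.min (dl / 2) (A / 2).
have x0 : 0 < x by rewrite lt_min !divr_gt0.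
have xd : x < dl by rewrite gt_min; apply/orP; left; lra.
have xA : x < A by rewrite gt_min; apply/orP; right; lra.
exists x; first by rewrite x0.
have := hd x; have := hd (- x); rewrite /= !sub0r opprK normrN ger0_norm ?(ltW x0)//.
move=> /(_ xd) h1 /(_ xd); move: h1; rewrite q0 /q mulrN => /ltr_normlP h1 /ltr_normlP h2.
by case: h1 => _ h1; case: h2 => h2 _; split; lra.
Qed.

Let Pfin t : 0 <= t -> P (iterated_stays Xp Xm Y D z t) = (fine (P (iterated_stays Xp Xm Y D z t)))%:E.
Proof.
move=> t0; rewrite fineK// ge0_fin_numE//; apply: (le_lt_trans (probability_le1 _ _)).
  exact: (measurable_iterated_stays bXp bXm bY oD).
by rewrite ltry.
Qed.

Let f_near (x : R) : 0 < x -> exists2 M, 0 < M &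
  forall u, M <= u -> A - x <= expR (lam * u) * f u <= A + x.
Proof.
move=> x0; have /cvgrPdist_le/(_ x x0)[M0 [_ hM]] := f_cvg.
exists (Num.max (M0 + 1) 1); first by rewrite lt_max ltr01 orbT.
move=> u; rewrite ge_max => /andP[Mu _]; have /= := hM u; rewrite distrC ler_distl.
by apply; lra.
Qed.

Local Notation G t := (exit_scale lam t * fine (P (iterated_stays Xp Xm Y D z t))).
Let C := lam * Num.sqrt (2 * pi / 3) * A ^+ 2.

Let laplace_int_ge0 k t : (0 <= laplace_int lam k t)%E.
Proof. by apply: integral_ge0 => a _; rewrite lee_fin laplace_fun_ge0. Qed.

Let scaled_cvg (K K' : R) :
  (K%:E * ((exit_scale lam t)%:E * laplace_int lam 1 t) +
   K'%:E * ((exit_scale lam t)%:E * laplace_int lam 0 t))%E @[t --> +oo] -->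
  (K * (pi / lam * Num.sqrt (2 * pi / 3)))%:E.
Proof.
rewrite -[X in _ --> X]adde0 -(mule0 K'%:E) EFinM; apply: cvgeD => //.
- by apply: cvgeZl => //; exact: exit_scale_laplace1.
- by apply: cvgeZl => //; exact: exit_scale_laplace0.
Qed.

Lemma exit_limsup : (limf_esup (fun t => (G t)%:E) +oo%R <= (pi * C)%:E)%E.
Proof.
have l0 := lam_gt0; apply: limf_esup_le => e e0.
(* The product of lam^2 from the mixture and of the limit for k = 1; lam^2 (pi / lam) = pi lam
   explains the factor pi in front of [C]. *)
pose c := lam ^+ 2 * (pi / lam * Num.sqrt (2 * pi / 3)).
have cE : A ^+ 2 * c = pi * C by rewrite /c /C; field; rewrite gt_eqF.
have [x /andP[x0 xA] [hx _]] := small_shift c e0.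
have [M M0 hM] := f_near x0.
pose K := expR (2 * lam * x) * (A + x) ^+ 2 * lam ^+ 2.
pose K' := expR (2 * lam * x) * ((A + x) * expR (lam * M) + expR (lam * M) ^+ 2) *
     (2 * (2 * lam * expR (3 * lam * (M + x)))).
have Kl : ((K * (pi / lam * Num.sqrt (2 * pi / 3)))%:E < (pi * C + e)%:E)%E.
  by rewrite lte_fin -cE /K -[ltLHS]mulrA.
have hlt := @scaled_cvg K K' _ (open_ereal_lt' Kl).
near=> t.
have t0 : 0 < t by near: t; exact: nbhs_pinfty_gt.
have : (K%:E * ((exit_scale lam t)%:E * laplace_int lam 1 t) +
   K'%:E * ((exit_scale lam t)%:E * laplace_int lam 0 t) < (pi * C + e)%:E)%E by near: t.
move=> /ltW; apply: le_trans; rewrite EFinM -Pfin ?(ltW t0)//.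
have M1 u : M <= u -> expR (lam * u) * f u <= A + x by move=> /hM /andP[].
have h := iterated_stays_upper t0 x0 M0 M1.
have H0 : (0 <= (exit_scale lam t)%:E)%E by rewrite lee_fin exit_scale_ge0.
apply: (le_trans (lee_wpmul2l H0 h)).
rewrite ge0_muleDr; first by rewrite !(muleCA (exit_scale lam t)%:E).
  rewrite mule_ge0// lee_fin; apply: mulr_ge0; last exact: sqr_ge0.
  by apply: mulr_ge0; [exact: expR_ge0|exact: sqr_ge0].
have Ax : 0 <= A + x by lra.
rewrite mule_ge0// lee_fin; apply: mulr_ge0; last by rewrite !mulr_ge0 ?expR_ge0// ltW.
by rewrite mulr_ge0 ?expR_ge0// addr_ge0 ?sqr_ge0// mulr_ge0 ?expR_ge0.
Unshelve. all: end_near. Qed.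

Lemma exit_liminf : ((2 * C)%:E <= limf_einf (fun t => (G t)%:E) +oo%R)%E.
Proof.
have l0 := lam_gt0; apply: limf_einf_ge => e e0.
(* Half of [e] for the main term and half for the edge term. *)
have e20 : 0 < e / 2 by rewrite divr_gt0.
pose c := lam ^+ 2 * (2 / pi) * (pi / lam * Num.sqrt (2 * pi / 3)).
have p0 : 0 < (pi : R) by exact: pi_gt0.
have cE : A ^+ 2 * c = 2 * C.
  by rewrite /c /C; move: (pi : R) p0 => q q0; field; rewrite !gt_eqF.
have [x /andP[x0 xA] [_ hx]] := small_shift c e20.
have [M M0 hM] := f_near x0.
pose K := expR (- (2 * lam * x)) * (A - x) ^+ 2 * (lam ^+ 2 * (2 / pi)).
pose K' := expR (- (2 * lam * x)) * (A - x) ^+ 2 * (2 * (2 * lam * expR (3 * lam * M))).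
have Kl : ((2 * C - e / 2)%:E < (K * (pi / lam * Num.sqrt (2 * pi / 3)))%:E)%E.
  by rewrite lte_fin -cE /K -[ltRHS]mulrA.
have K0 : ((0 * (pi / lam * Num.sqrt (2 * pi / 3)))%:E < (e / 2)%:E)%E.
  by rewrite mul0r lte_fin.
have hgt := @scaled_cvg K 0 _ (open_ereal_gt' Kl).
have hlt := @scaled_cvg 0 K' _ (open_ereal_lt' K0).
near=> t.
have t0 : 0 < t by near: t; exact: nbhs_pinfty_gt.
have : ((2 * C - e / 2)%:E < K%:E * ((exit_scale lam t)%:E * laplace_int lam 1 t) +
   0%:E * ((exit_scale lam t)%:E * laplace_int lam 0 t))%E by near: t.
rewrite mul0e adde0 => h1.
have : (0%:E * ((exit_scale lam t)%:E * laplace_int lam 1 t) +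
   K'%:E * ((exit_scale lam t)%:E * laplace_int lam 0 t) < (e / 2)%:E)%E by near: t.
rewrite mul0e add0e => h2.
have M1 u : M <= u -> A - x <= expR (lam * u) * f u by move=> /hM /andP[].
have xA' : 0 < x < A by rewrite x0.
have h := iterated_stays_lower t0 xA' M0 M1.
have H0 : (0 <= (exit_scale lam t)%:E)%E by rewrite lee_fin exit_scale_ge0.
have := lee_wpmul2l H0 h; rewrite [X in (_ <= X)%E -> _]ge0_muleDr; last 2 first.
- exact: measure_ge0.
- rewrite mule_ge0// lee_fin; apply: mulr_ge0; last by rewrite !mulr_ge0 ?expR_ge0// ltW.
  by apply: mulr_ge0; [exact: expR_ge0|exact: sqr_ge0].
rewrite !(muleCA (exit_scale lam t)%:E) Pfin ?(ltW t0)// -EFinM => h3.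
have := lt_le_trans h1 h3 => h4; have := lt_le_trans h4 (leeD2l _ (ltW h2)).
rewrite -EFinD lte_fin => h5; rewrite lee_fin; lra.
Unshelve. all: end_near. Qed.
End exit_asymptotics.

(** * Positivity of the eigenfunction integral *)

Import HBNNSimple.

Section nonmeasurable_integral.
Context {R : realType} d (T : measurableType d) (mu : {measure set T -> \bar R}).

(* No measurability is needed: a nonnegative integral is a supremum over simple minorants. *)
Lemma ge0_le_integral_any (f g : T -> \bar R) : (forall x, 0 <= f x)%E ->
  (forall x, f x <= g x)%E -> (\int[mu]_x f x <= \int[mu]_x g x)%E.
Proof.
move=> f0 fg; have g0 x : (0 <= g x)%E by exact: le_trans (fg x).
rewrite !ge0_integralE// !patch_setT; apply: ereal_sup_le => _ [h /= hf <-].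
by exists h => //= x; exact: le_trans (fg x).
Qed.

(** One measurable summand suffices for subadditivity: a simple minorant s of g + h gives the
    measurable function (s - g)^+, which lies below h and satisfies s <= g + (s - g)^+. *)
Lemma ge0_integralD_any (g : T -> R) (h : T -> \bar R) : measurable_fun setT g ->
  (forall x, 0 <= g x) -> (forall x, 0 <= h x)%E ->
  (\int[mu]_x ((g x)%:E + h x) <= \int[mu]_x (g x)%:E + \int[mu]_x h x)%E.
Proof.
move=> mg g0 h0; rewrite [leLHS]ge0_integralE; last by move=> x _; rewrite adde_ge0 ?lee_fin.
rewrite patch_setT; apply: ge_ereal_sup => _ [s /= sle <-].
pose k (x : T) : R := maxr (s x - g x) 0.
have k0 x : 0 <= k x by rewrite le_max lexx orbT.
have mk : measurable_fun setT k.
  by apply: measurable_maxr => //; apply: measurable_funB.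
rewrite -integralT_nnsfun.
apply: (@le_trans _ _ (\int[mu]_x ((g x)%:E + (k x)%:E))%E).
  apply: ge0_le_integral_any => x; rewrite lee_fin//.
  by rewrite /k -lerBlDl le_max lexx.
rewrite ge0_integralD//; last 4 first.
- by move=> x _; rewrite lee_fin.
- exact/measurable_EFinP.
- by move=> x _; rewrite lee_fin.
- exact/measurable_EFinP.
apply: leeD => //; apply: ge0_le_integral_any => x; first by rewrite lee_fin.
rewrite /k; case: (leP (s x - g x) 0) => [_|_]; first exact: h0.
by have := sle x; rewrite EFinB leeBlDl.
Qed.
End nonmeasurable_integral.

Section iterated_integral.
Context {R : realType}.
Notation mu := (@lebesgue_measure R).

Lemma leb_integral_ge0 n (f : 'rV[R]_n -> \bar R) :
  (forall x, 0 <= f x)%E -> (0 <= leb_integral f)%E.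
Proof.
elim: n f => [|n IH] f f0 /=; first exact: f0.
by apply: integral_ge0 => x _; apply: IH.
Qed.

Lemma leb_integral_le n (f g : 'rV[R]_n -> \bar R) : (forall x, 0 <= f x)%E ->
  (forall x, f x <= g x)%E -> (leb_integral f <= leb_integral g)%E.
Proof.
elim: n f g => [|n IH] f g f0 fg /=; first exact: fg.
apply: ge0_le_integral_any => x; first exact: leb_integral_ge0.
exact: IH.
Qed.

Definition cube n (z : 'rV[R]_n) (r : R) : set 'rV[R]_n :=
  [set y | forall i, `|y 0 i - z 0 i| <= r].

Lemma cube_row_mx n (z : 'rV[R]_(1 + n)) r x (v : 'rV[R]_n) :
  \1_(cube z r) (row_mx (\row_(j < 1) x) v) =
  \1_`[z 0 0 - r, z 0 0 + r] x * \1_(cube (rsubmx z) r) v :> R.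
Proof.
rewrite !indicE -natrM mulnb; congr (nat_of_bool _)%:R.
have e : lshift n (0 : 'I_1) = 0 by apply: val_inj.
apply/idP/andP => [|[]]; rewrite !inE/= in_itv/=.
  move=> h; split.
    by have := h (lshift n 0); rewrite row_mxEl mxE e ler_distl.
  by move=> i; have := h (rshift 1 i); rewrite row_mxEr mxE.
move=> h1 h2 i; case: (split_ordP i) => j ->.
  by rewrite row_mxEl mxE (ord1 j) e ler_distl.
by rewrite row_mxEr; have := h2 j; rewrite mxE.
Qed.

Let cube_row_fun n (z : 'rV[R]_(1 + n)) (c r x : R) :
  (fun v : 'rV[R]_n => (c * \1_(cube z r) (row_mx (\row_(j < 1) x) v))%:E) =
  (fun v => (c * \1_`[z 0 0 - r, z 0 0 + r] x * \1_(cube (rsubmx z) r) v)%:E).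
Proof. by apply/funext => v; rewrite cube_row_mx mulrA. Qed.

Lemma leb_integral_cube n (z : 'rV[R]_n) (c r : R) : 0 <= c -> 0 <= r ->
  leb_integral (fun y => (c * \1_(cube z r) y)%:E) = (c * (2 * r) ^+ n)%:E.
Proof.
elim: n z c => [|n IH] z c c0 r0 /=.
  by rewrite indicE mem_set// => -[].
transitivity (\int[mu]_x ((c * (2 * r) ^+ n)%:E * (\1_`[z 0 0 - r, z 0 0 + r] x)%:E))%E.
  apply: eq_integral => x _.
  by rewrite cube_row_fun IH// ?mulr_ge0// -EFinM mulrAC.
rewrite ge0_integralZl//; last first.
- by rewrite lee_fin mulr_ge0// exprn_ge0// mulr_ge0.
- exact/measurable_EFinP.
rewrite integral_indic// setIT. rewrite [X in (_ * X)%E](_ : _ = lebesgue_measure [set` `[z 0 0 - r, z 0 0 + r]])// lebesgue_measure_itv/= lte_fin.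
have [r_gt0|] := ltP 0 r; last first.
  move=> r_le0; have -> : r = 0 by apply/eqP; rewrite eq_le r_le0.
  by rewrite subr0 addr0 ltxx mule0 mulr0 exprS mul0r mulr0.
rewrite ifT; last by lra.
by rewrite -EFinB -EFinM; congr EFin; rewrite exprS; ring.
Qed.

(** The indicator of a cube factors over the coordinates, so at each level of the iterated integral
    its partial integral is measurable, while [h] may be arbitrary. *)
Lemma leb_integral_cubeD n (z : 'rV[R]_n) (c r : R) h : 0 <= c -> 0 <= r ->
  (forall x, 0 <= h x)%E ->
  (leb_integral (fun y => (c * \1_(cube z r) y)%:E + h y)%E <=
   (c * (2 * r) ^+ n)%:E + leb_integral h)%E.
Proof.
move=> c0 r0; rewrite -(leb_integral_cube z c0 r0).
elim: n z c h c0 => [|n IH] z c h c0 h0 //=.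
have nn v x : (0 <= (c * \1_(cube z r) (row_mx (\row_(j < 1) x) v))%:E)%E.
  by rewrite lee_fin mulr_ge0.
have E x : leb_integral (fun v : 'rV[R]_n => (c * \1_(cube z r) (row_mx (\row_(j < 1) x) v))%:E) =
    (c * (2 * r) ^+ n * \1_`[z 0 0 - r, z 0 0 + r] x)%:E.
  by rewrite cube_row_fun leb_integral_cube ?mulr_ge0// mulrAC.
under [X in (_ <= X + _)%E]eq_integral do rewrite E.
apply: le_trans (ge0_integralD_any _ _ _ _); last 3 first.
- by apply: measurable_funM => //; exact: measurable_indic.
- by move=> x; rewrite mulr_ge0// mulr_ge0// exprn_ge0// mulr_ge0.
- by move=> x; exact: leb_integral_ge0.
apply: ge0_le_integral_any => x.
  by apply: leb_integral_ge0 => v; apply: adde_ge0; [exact: nn|exact: h0].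
rewrite -E.
have eD : (fun v : 'rV[R]_n => (c * \1_(cube z r) (row_mx (\row_(j < 1) x) v))%:E +
      h (row_mx (\row_(j < 1) x) v))%E =
   (fun v => (c * \1_`[z 0 0 - r, z 0 0 + r] x *
      \1_(cube (rsubmx (z : 'rV[R]_(1 + n))) r) v)%:E + h (row_mx (\row_(j < 1) x) v))%E.
  by apply/funext => v; rewrite cube_row_mx mulrA.
by rewrite cube_row_fun eD; apply: IH => //; rewrite mulr_ge0.
Qed.

(** From psi <= 1 + psi^2 on [D], with the constant 1 integrated over a cube containing [D]. *)
Lemma int_on_lty n (D : set 'rV[R]_n) (psi : 'rV[R]_n -> R) : bounded_set D ->
  (forall y, D y -> 0 <= psi y) -> (int_on D (fun y => (psi y ^+ 2)%R) < +oo)%E ->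
  (int_on D psi < +oo)%E.
Proof.
move=> bD psi0 fin2.
have [r r0 rD] : exists2 r, 0 <= r & D `<=` cube 0 r.
  have [M [_ hM]] := bD.
  exists (maxr 0 (M + 1)); first by rewrite le_max lexx.
  move=> y Dy i; rewrite mxE subr0; apply: (@le_trans _ _ `|y|).
    by rewrite [leRHS]/normr/= mx_normrE; apply/bigmax_geP; right => /=; exists (0, i).
  by apply: hM Dy; rewrite lt_max ltrDl ltr01 orbT.
have := @leb_integral_cubeD n 0 1 r (fun y => (\1_D y * psi y ^+ 2)%:E) ler01 r0 _.
move=> /(_ _)/le_lt_trans-h.
apply: (@le_lt_trans _ _ _ _ _ _ (h _ _ _)).
- apply: leb_integral_le => y.
    by rewrite lee_fin indicE; case: (boolP (y \in D)) => [/set_mem/psi0|_]; rewrite ?mul0r// mul1r.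
  rewrite -EFinD lee_fin mul1r !indicE; case: (boolP (y \in D)) => [yD|_]; last first.
    by rewrite !mul0r addr0.
  rewrite mem_set; last by apply: rD; exact: set_mem.
  by rewrite (_ : true%:R = 1 :> R)// !mul1r; nra.
- by move=> y; rewrite lee_fin mulr_ge0// sqr_ge0.
- by rewrite lte_add_pinfty// ltry.
Qed.

(** By continuity psi exceeds half its value at a point on a small cube inside [D]. *)
Lemma int_on_gt0 n (D : set 'rV[R]_n) (psi : 'rV[R]_n -> R) : D !=set0 -> open D ->
  (forall y, D y -> {for y, continuous psi}) -> (forall y, D y -> 0 < psi y) ->
  (0 < int_on D psi)%E.
Proof.
move=> [z Dz] oD cpsi psi0.
have p0 := psi0 z Dz.
have h1 : \forall y \near z, psi z / 2 < psi y.
  by apply: (cvgr_gt _ (cpsi z Dz)); rewrite ltr_pdivrMr// mulr2n mulrDr mulr1 ltrDl.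
have h2 : \forall y \near z, D y by exact: open_nbhs_nbhs.
have /nbhs_ballP[e /= e0 he] : \forall y \near z, D y /\ psi z / 2 < psi y by exact: filterI.
have hc : cube z (e / 2) `<=` ball z e.
  move=> y hy; split => // i j; rewrite (ord1 i) /ball/= distrC (le_lt_trans (hy j))//.
  by rewrite ltr_pdivrMr// mulr2n mulrDr mulr1 ltrDl.
have c0 : 0 <= psi z / 2 by rewrite divr_ge0// ltW.
have r0 : 0 <= e / 2 by rewrite divr_ge0// ltW.
apply: (@lt_le_trans _ _ (psi z / 2 * (2 * (e / 2)) ^+ n)%:E).
  by rewrite lte_fin mulr_gt0 ?divr_gt0// exprn_gt0// mulr_gt0// divr_gt0.
rewrite -(leb_integral_cube z c0 r0); apply: leb_integral_le => y; rewrite lee_fin.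
  by rewrite mulr_ge0.
rewrite !indicE; case: (boolP (y \in cube z _)) => [/set_mem/hc/he[Dy]|_].
  by rewrite mem_set// mulr1 mul1r => /ltW.
by rewrite mulr0; case: (boolP (y \in D)) => [/set_mem/psi0/ltW|_]; rewrite ?mul0r// mul1r.
Qed.
End iterated_integral.

(** * Nonpositive eigenvalue *)

Section degenerate.
Context {R : realType}.

Lemma expR_decay_cvg (lam : R) (f : R -> R) : lam < 0 -> (forall t, 0 <= f t <= 1) ->
  expR (lam * t) * f t @[t --> +oo] --> 0.
Proof.
move=> l0 f01.
have l0' : 0 < - lam by rewrite oppr_gt0.
apply/cvgrPdist_le => e e0; near=> t.
have /andP[ft0 ft1] := f01 t.
rewrite sub0r normrN ger0_norm ?mulr_ge0 ?expR_ge0//.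
apply: (@le_trans _ _ (expR (lam * t))); first by rewrite ler_piMr ?expR_ge0.
rewrite -[leRHS]lnK ?posrE// ler_expR -[lam]opprK mulNr lerNl -ler_pdivrMl //; near: t; exact: nbhs_pinfty_ge.
Unshelve. all: end_near. Qed.

Lemma exit_scale0 (t : R) : exit_scale 0 t = t `^ (- 2^-1).
Proof.
rewrite /exit_scale powR0 ?mulr0 ?mul0r ?expR0 ?mulr1//.
Qed.

Lemma exit_scale0_le (e : R) : 0 < e -> \forall t \near +oo, exit_scale 0 t <= e.
Proof.
move=> e0; near=> t; rewrite exit_scale0 powRN.
have t0 : 0 < t by near: t; exact: nbhs_pinfty_gt.
have s0 : 0 < Num.sqrt t by rewrite sqrtr_gt0.
rewrite powR12_sqrt ?(ltW t0)// -[leRHS]invrK lef_pV2 ?posrE ?invr_gt0//.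
rewrite -[leLHS]ger0_norm ?invr_ge0 ?(ltW e0)// -sqrtr_sqr ler_sqrt ?(ltW t0)//.
Unshelve. all: end_near. Qed.
End degenerate.

Theorem theorem1p1 (R : realType) (n : nat) (D : set 'rV[R]_n)
    (lam : R) (psi : 'rV[R]_n -> R)
    (d : measure_display) (T : measurableType d) (P : probability T R)
    (Xp Xm : R -> T -> 'rV[R]_n) (Y : R -> T -> 'rV[R]_1) :
  is_domain D -> bounded_set D ->
  first_dirichlet_eigenfunction D lam psi ->
  brownian_motion P Xp -> brownian_motion P Xm -> brownian_motion P Y ->
  indep3 P Xp Xm Y ->
  (forall z, D z ->
     expR (lam * t) * survival P D (fun s w => z + Xp s w) t
       @[t --> +oo] --> psi z * fine (int_on D psi)) ->
  forall z, D z ->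
    let C := lam * Num.sqrt (2 * pi / 3) * (psi z * fine (int_on D psi)) ^+ 2 in
    let G := fun t : R => t `^ (- 2^-1) *
        expR (3 / 2 * pi `^ (2 / 3) * lam `^ (2 / 3) * t `^ (3^-1)) *
        survival P D (iterated_bm Xp Xm Y z) t in
    [/\ ((2 * C)%:E <= limf_einf (fun t => (G t)%:E) +oo%R)%E,
        (limf_einf (fun t => (G t)%:E) +oo%R <= limf_esup (fun t => (G t)%:E) +oo%R)%E &
        (limf_esup (fun t => (G t)%:E) +oo%R <= (pi * C)%:E)%E].
Proof.
move=> [D0 oD _] bD [_ _ psi2 cpsi psi0] bXp bXm bY ind surv_cvg z Dz; set A := psi z * _ => C G.
(* [fine] would turn an infinite integral into 0; positivity and finiteness together give A > 0. *)
have I0 : (0 < int_on D psi)%E by exact: int_on_gt0.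
have Ioo : (int_on D psi < +oo)%E.
  apply: int_on_lty => //; last by rewrite psi2 ltry.
  by move=> y /psi0/ltW.
have A0 : 0 < A by rewrite mulr_gt0 ?psi0// fine_gt0// I0.
have fE t : 0 <= t -> survival P D (fun s w => z + Xp s w) t = fine (P (stays D z Xp t)).
  move=> t0; rewrite /survival; congr (fine (P _)).
  by apply/seteqP; split => w; [move/(stays_exit_time oD _ _ bXp t0)|move/(stays_exit_time oD _ _ bXp t0)].
have fine_prob_le1 E : measurable E -> fine (P E) <= 1.
  move=> mE; have P1 := probability_le1 P mE.
  by rewrite -lee_fin fineK// ge0_fin_numE// (le_lt_trans P1)// ltry.
have mD t : 0 <= t -> measurable (stays D z Xp t).
  by move=> t0; apply: (proc_sigma_measurable bXp); exact: stays_sigma bXp.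
have f_cvg : expR (lam * t) * fine (P (stays D z Xp t)) @[t --> +oo] --> A.
  apply: cvg_trans (surv_cvg z Dz); apply: near_eq_cvg; near=> t.
  by rewrite fE//; near: t; exact: nbhs_pinfty_ge.
have GE : G = (fun t => exit_scale lam t * fine (P (iterated_stays Xp Xm Y D z t))) by [].
have mid := limf_einf_le_esup (fun t => (G t)%:E).
(* A negative [lam] would make exp (lam t) times a probability tend to 0, against the positive limit
   [A]. *)
have [l0|l0|l0] := ltgtP 0 lam.
- split => //; rewrite GE.
    exact: (exit_liminf bXp bXm bY ind oD l0 A0 f_cvg).
  exact: (exit_limsup bXp bXm bY ind oD l0 A0 f_cvg).
- exfalso.
  pose f t := if 0 <= t then fine (P (stays D z Xp t)) else 0.
  have f01 t : 0 <= f t <= 1.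
    rewrite /f; case: ifPn => [t0|_]; last by rewrite lexx ler01.
    by rewrite fine_ge0//= fine_prob_le1//; exact: mD.
  have := expR_decay_cvg l0 f01 => h.
  have h2 : expR (lam * t) * f t @[t --> +oo] --> A.
    apply: cvg_trans f_cvg; apply: near_eq_cvg; near=> t.
    by rewrite /f ifT//; near: t; exact: nbhs_pinfty_ge.
  have A00 : A = 0 by exact: (cvg_unique _ h2 h).
  by rewrite A00 ltxx in A0.
(* For lam = 0, as happens when n = 0, all three constants vanish, the exponential factor is 1, and
   t^(-1/2) alone sends [G] to 0. *)
have C0 : C = 0 by rewrite /C -l0 !mul0r.
have G01 t : 0 <= t -> 0 <= G t <= exit_scale 0 t.
  move=> t0; rewrite GE -l0 mulr_ge0 ?exit_scale_ge0 ?fine_ge0//=.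
  rewrite ler_piMr ?exit_scale_ge0// fine_prob_le1//.
  exact: (measurable_iterated_stays bXp bXm bY oD).
split => //; rewrite C0 mulr0.
  apply: limf_einf_ge => e e0; near=> t; rewrite lee_fin sub0r.
  have t0 : 0 <= t by near: t; exact: nbhs_pinfty_ge.
  by have /andP[G0 _] := G01 t t0; lra.
apply: limf_esup_le => e e0; near=> t; rewrite lee_fin add0r.
have t0 : 0 <= t by near: t; exact: nbhs_pinfty_ge.
have /andP[_ G1] := G01 t t0; apply: (le_trans G1).
by near: t; exact: exit_scale0_le.
Unshelve. all: end_near. Qed.
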